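(* For every constant $c>0$ there exists an increasing sequence of real numbers $(x_n)_{n\ge1}$ with $x_{n+1}-x_n\ge 1$ for all $n$, such that, with $\gamma_N=\frac{\log N\,(\log\log N)^{1+c}}{N}$, the additive energy satisfies $E_{N,\gamma_N}\gg N^3$ (i.e. $E_{N,\gamma_N}\ge C N^3$ for some constant $C>0$ and all sufficiently large $N$), and such that for Lebesgue-almost every $\alpha\in\mathbb{R}$ the sequence $(\alpha x_n)_{n\ge1}$ has Poissonian pair correlation.
   Context: For a real sequence $(x_n)$, $N\ge1$ and $\gamma>0$, the additive energy at scale $\gamma$ is $E_{N,\gamma}=\#\{1\le a,b,c,d\le N : |x_a+x_b-x_c-x_d|<\gamma\}$. $\|x\|$ denotes the distance from $x$ to the nearest integer. A real sequence $(y_n)_{n\ge1}$ has Poissonian pair correlation if for every $s>0$, $\lim_{N\to\infty}\frac1N\#\{(m,n): 1\le m\ne n\le N,\ \|y_m-y_n\|<s/N\}=2s$. *)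

(* Defs.v *)
From HB Require Import structures.
From mathcomp Require Import all_boot all_order all_algebra.
From mathcomp Require Import all_classical all_reals all_analysis.
Set Implicit Arguments. Unset Strict Implicit. Unset Printing Implicit Defensive.
Import Order.TTheory GRing.Theory Num.Theory.
Import numFieldNormedType.Exports.
Local Open Scope classical_set_scope.
Local Open Scope ring_scope.

Definition dist_int {R : realType} (x : R) : R :=
  Num.min (x - (Num.floor x)%:~R) ((Num.floor x)%:~R + 1 - x).

(* Sequences are x : nat -> R, used at indices n >= 1 (x 0 is ignored). *)
Definition add_energy {R : realType} (x : nat -> R) (N : nat) (g : R) : nat :=
  #|[set t : 'I_N * 'I_N * 'I_N * 'I_N |
      `| x t.1.1.1.+1 + x t.1.1.2.+1 - x t.1.2.+1 - x t.2.+1 | < g]|.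

Definition pc_count {R : realType} (y : nat -> R) (N : nat) (s : R) : nat :=
  #|[set t : 'I_N * 'I_N | (t.1 != t.2) &&
      (dist_int (y t.1.+1 - y t.2.+1) < s / N%:R)]|.

Definition poissonian_pc {R : realType} (y : nat -> R) : Prop :=
  forall s : R, 0 < s ->
    (fun N : nat => (pc_count y N s)%:R / N%:R) @ \oo --> 2 * s.

Definition gammaN {R : realType} (c : R) (N : nat) : R :=
  ln (N%:R) * (ln (ln (N%:R))) `^ (1 + c) / N%:R.

(* Main.v *)
Require Import Defs.
From HB Require Import structures.
From mathcomp Require Import all_boot all_order all_algebra.
From mathcomp Require Import all_classical all_reals all_analysis.
From mathcomp Require Import measurable_realfun.
From mathcomp Require Import ring lra zify.
Import Order.TTheory GRing.Theory Num.Theory.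
Import numFieldNormedType.Exports.
Local Open Scope classical_set_scope.
Local Open Scope ring_scope.

(** On the block of indices [n^4 <= m < 16 n^4], [n = 2^j], put
    [x_m = <(1, m, m/n, m/n^2, m/n^3), P> + eps |d(m)|^2], where [P] is a vector
    of five real frequencies, [d(m)] is the vector of base-[n] digits of [m]
    (the fourth one being [m/n^3 < 16 n]), the quotients are integral, and
    [eps] is a small multiple of [L_j / n^6] with [L_j] of size
    [j (log j)^(1+c)].  The main term is additive on digit vectors that add
    without carry; so a positive proportion of the [n^12] triples [(a, b, c)]
    have a fourth index [d] with [x_a + x_b - x_c - x_d = O(eps n^2)], which is
    below [gamma_N].

    For the pair correlation, first replace [alpha P] by independent uniform
    variables modulo 1.  Two differences [x_m - x_m'] are then independent unless
    their integer coefficient vectors are parallel, and in the parallel case the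
    quadratic perturbation makes it unlikely, on average over [alpha], that both
    are close to integers.  The variance of the pair count of a block is
    [O(n^8 (1/L_j + 1/n))].  By averaging over [P], the frequencies of each block
    can be chosen so that the same bound holds for the true variance in [alpha],
    for the first [j] members of a countable family of windows.  As
    [sum 1/L_j] converges, almost every [alpha] has the right counts for all
    these windows; monotonicity in the window parameters and a summation over
    the blocks give the pair correlation of the whole sequence. *)

Set Implicit Arguments.
Unset Strict Implicit.

(** * Periodic integrals and averages over frequencies *)


(** The size of [eps] is squeezed from both sides. The energy needs [eps n^2] below [gamma_N], about
    [L_j / n^4]. Two parallel differences with multipliers [a], [b] collide modulo 1 only if a
    certain integer is below [K / min(a, b)], where [K] has order [r / eps = n^2 / L_j]: a smaller
    [eps] means more collisions. At the largest admissible [eps] they add [n^8 / L_j] to the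
    variance, against a squared main term of order [n^8]; so [sum 1/L_j] must converge, whence the
    exponent [1 + c]. Four digits make the sum over [(a, b)] with [a <= b] one of [1 / (a b^3)],
    which is bounded; two digits would give [1 / (a b)]. The coefficient 1 of the first frequency
    cancels inside a block. It serves pairs with one older index: their forms are never parallel to
    those of new pairs, and are parallel to each other only when the new index is the same. This
    frequency also lifts the block above all earlier elements. As [P] runs through [[tau, 2 tau]],
    [alpha P] covers a full period only if [|alpha| tau >= 1]; hence the annuli
    [1/A <= |alpha| <= A], which exhaust the nonzero reals. *)

Section Periodic.
Context {R : realType}.
Notation mu := (@lebesgue_measure R).
Implicit Types f g h : R -> \bar R.

Definition affine (b c x : R) : measurableTypeR R := b * x + c.

Lemma measurable_affine (b c : R) : measurable_fun [set: R] (affine b c).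
Proof. by apply: measurable_funD => //; apply: measurable_funM. Qed.

Definition affine_pushforward (b c : R) :
  {measure set (measurableTypeR R) -> \bar R}.
Proof.
refine (pushforward mu (affine b c)); exact: measurable_affine.
Defined.

(** Uniqueness of Lebesgue measure: the scaled pushforward gives each interval []u, v]] its length.
    For [b < 0] the preimage is half-open at the other end. *)
Lemma lebesgue_measure_affine (b c : R) (A : set R) : b != 0 -> measurable A ->
  (mu A = `|b|%:E * affine_pushforward b c A)%E.
Proof.
move=> b0 mA.
have nb : 0 <= `|b| by [].
pose k : {nonneg R} := NngNum nb.
transitivity (mscale k (affine_pushforward b c) A); last by [].
apply: lebesgue_measure_unique => //= _ [[u v]] _ <-.
rewrite /mscale /= /pushforward lebesgue_measure_itv/=.
have [b_gt0|b_lt0|] := ltgtP 0 b; last by move/esym/eqP; rewrite (negbTE b0).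
- rewrite (_ : affine b c @^-1` `]u, v] = `](u - c) / b, (v - c) / b]%classic); last first.
    apply/seteqP; split => x /=; rewrite !in_itv/= /affine;
    rewrite ltr_pdivrMr// ler_pdivlMr// => /andP[? ?]; apply/andP; split; lra.
  rewrite lebesgue_measure_itv /= !lte_fin ltr_pM2r ?invr_gt0// ltrD2r.
  case: ifP => _; last by rewrite mule0.
  rewrite gtr0_norm// -!EFinB -EFinM; congr _%:E; field; lra.
- rewrite (_ : affine b c @^-1` `]u, v] = `[(v - c) / b, (u - c) / b[%classic); last first.
    apply/seteqP; split => x /=; rewrite !in_itv/= /affine;
    rewrite ltr_ndivlMr// ler_ndivrMr// => /andP[? ?]; apply/andP; split; lra.
  rewrite lebesgue_measure_itv /= !lte_fin ltr_nM2r ?invr_lt0// ltrD2r.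
  case: ifP => _; last by rewrite mule0.
  rewrite ltr0_norm// -!EFinB -EFinM; congr _%:E; field; lra.
Qed.

Lemma ge0_integral_affine (b c : R) (D : set R) f : b != 0 ->
  measurable D -> measurable_fun [set: R] f -> (forall x, 0 <= f x)%E ->
  (\int[mu]_(x in D) f x =
   `|b|%:E * \int[mu]_(x in (affine b c) @^-1` D) f (b * x + c)%R)%E.
Proof.
move=> b0 mD mf f0.
have nb : 0 <= `|b| by [].
pose k : {nonneg R} := NngNum nb.
transitivity (\int[mscale k (affine_pushforward b c)]_(x in D) f x)%E.
  by apply: eq_measure_integral => A mA _; exact: lebesgue_measure_affine.
rewrite ge0_integral_mscale//=; last exact: measurable_funTS.
congr (_ * _)%E.
rewrite ge0_integral_pushforward//; first exact: measurable_affine.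
exact: measurable_funTS.
Qed.


Definition unit_integral g : \bar R := (\int[mu]_(x in `[0%R, 1%R[) g x)%E.

Section one_periodic.
Variable g : R -> \bar R.
Hypothesis mg : measurable_fun [set: R] g.
Hypothesis g0 : forall x, (0 <= g x)%E.
Hypothesis g1 : forall x, g (x + 1) = g x.

Lemma periodicz (k : int) x : g (x + k%:~R) = g x.
Proof.
have nat_case (n : nat) y : g (y + n%:R) = g y.
  by elim: n => [|n IH]; rewrite ?addr0// -natr1 addrA g1 IH.
case: k => n; first by rewrite -pmulrn nat_case.
by rewrite NegzE mulrNz -pmulrn -[in RHS](subrK n.+1%:R x) nat_case.
Qed.

Lemma periodic_integral_shift (c : R) :
  (\int[mu]_(x in `[c, (c + 1)%R[) g x = unit_integral g)%E.
Proof.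
have shift (u v t : R) : (forall x, g (x + t) = g x) ->
    (\int[mu]_(x in `[(u + t)%R, (v + t)%R[) g x = \int[mu]_(x in `[u, v[) g x)%E.
  move=> gt; rewrite (@ge0_integral_affine 1 t)// ?oner_eq0// normr1 mul1e.
  rewrite (_ : affine 1 t @^-1` _ = `[u, v[%classic); last first.
    by apply/seteqP; split => x /=; rewrite !in_itv/= /affine mul1r lerD2r ltrD2r.
  by apply: eq_integral => x _; rewrite mul1r gt.
have split_at (u v w : R) : u <= v -> v <= w ->
    (\int[mu]_(x in `[u, w[) g x =
     \int[mu]_(x in `[u, v[) g x + \int[mu]_(x in `[v, w[) g x)%E.
  move=> uv vw; rewrite -ge0_integral_setU//=.
  - by rewrite -itv_bndbnd_setU// bnd_simp.
  - exact: measurable_funTS.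
  - rewrite disj_set2E; apply/eqP/seteqP; split => x //=.
    by rewrite !in_itv/= => -[/andP[_ xv] /andP[vx _]]; move: (lt_le_trans xv vx); rewrite ltxx.
(* Cut at the integer [k] in [[c, c + 1[] and move the right-hand piece back by 1: the two pieces
   then form [[k - 1, k[], an integer translate of the unit interval. *)
pose k := Num.ceil c.
have /andP[kc ck] := Num.Theory.ceil_itv c.
rewrite -/k intrB in kc ck.
rewrite (split_at c k%:~R)//; last by lra.
rewrite (_ : `[k%:~R, c + 1[%classic = `[(k%:~R - 1) + 1, c + 1[%classic); last by rewrite subrK.
rewrite (shift _ _ 1)// addeC -split_at//; last by rewrite ltW.
have := shift 0 1 (k%:~R - 1); rewrite add0r addrCA subrr addr0 => ->//.
by move=> x; rewrite -[X in _ - X]/(1%:~R) -intrB periodicz.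
Qed.


Lemma periodic_integral_nat (c : R) (n : nat) :
  (\int[mu]_(x in `[c, (c + n%:R)%R[) g x = n%:R%:E * unit_integral g)%E.
Proof.
elim: n => [|n IH].
  by rewrite addr0 mul0e set_itvco0 integral_set0.
rewrite -natr1 EFinD ge0_muleDl ?lee_fin// mul1e -IH -(periodic_integral_shift (c + n%:R)).
rewrite -ge0_integral_setU//=.
- by rewrite addrA -itv_bndbnd_setU// bnd_simp ?lerDl ?ler_wpDr.
- exact: measurable_funTS.
- rewrite disj_set2E; apply/eqP/seteqP; split => x //=.
  by rewrite !in_itv/= => -[/andP[_ xv] /andP[vx _]]; move: (lt_le_trans xv vx); rewrite ltxx.
Qed.

(** The hypothesis on [|b| * L] says that [b x + c] sweeps exactly [n] periods. The slope may be
    fractional, as it is after the shear in [two_frequencies]. *)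
Lemma periodic_integral_affine (a b c L : R) (n : nat) : 0 < L -> b != 0 ->
  `|b| * L = n%:R ->
  (\int[mu]_(x in `[a, (a + L)%R[) g (b * x + c)%R = L%:E * unit_integral g)%E.
Proof.
move=> L0 b0 bL.
have nb0 : 0 < `|b| by rewrite normr_gt0.
suff : (`|b|%:E * \int[mu]_(x in `[a, (a + L)%R[) g (b * x + c)%R =
        n%:R%:E * unit_integral g)%E.
  move/(congr1 (fun z => (`|b|^-1)%:E * z)%E).
  by rewrite !muleA -!EFinM mulVf ?gt_eqF// mul1e -bL mulrA mulVf ?gt_eqF// mul1r.
have [b_gt0|b_lt0|] := ltgtP 0 b; last by move/esym/eqP; rewrite (negbTE b0).
- rewrite -(periodic_integral_nat (b * a + c)).
  rewrite [RHS](@ge0_integral_affine b c)//; congr (_ * _)%E; congr (integral _ _ _).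
  apply/seteqP; split => x /=; rewrite !in_itv/= /affine => /andP[? ?]; apply/andP;
  rewrite gtr0_norm// in bL; split; nra.
- have mgc : measurable_fun [set: R] (fun x => g (b * x + c)).
    by apply: measurableT_comp => //; exact: measurable_affine.
  rewrite -(periodic_integral_nat (b * (a + L) + c)).
  (* A negative slope reverses the interval, so the closed end is exchanged first. *)
  transitivity (`|b|%:E * \int[mu]_(x in `]a, (a + L)%R]) g (b * x + c)%R)%E.
    congr (_ * _)%E.
    rewrite integral_itv_obnd_cbnd; last exact: measurable_funTS.
    by rewrite integral_itv_bndo_bndc//; exact: measurable_funTS.
  rewrite [RHS](@ge0_integral_affine b c)//; congr (_ * _)%E; congr (integral _ _ _).
  apply/seteqP; split => x /=; rewrite !in_itv/= /affine => /andP[? ?]; apply/andP;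
  rewrite ltr0_norm// in bL; split; nra.
Qed.

Lemma periodic_integral_intM (k : int) (c : R) : k != 0 ->
  (\int[mu]_(x in `[0%R, 1%R[) g (k%:~R * x + c)%R = unit_integral g)%E.
Proof.
move=> k0; rewrite -[X in `[_, X[](add0r 1) (@periodic_integral_affine _ _ _ _ `|k|)%N//.
- by rewrite mul1e.
- by rewrite intr_eq0.
- by rewrite mulr1 -intr_norm natr_absz.
Qed.

(** Enlarge [[t, 2 t]] to [n] whole periods of [a x], with [n] the least integer above [|a| t]. As
    [1 <= |a| t], the new length [n / |a|] lies between [t] and [2 t], whence the constant. *)
Lemma periodic_integral_le (a t : R) : 0 < t -> 1 <= `|a| * t ->
  (\int[mu]_(x in `[t, (2 * t)%R]) g (a * x)%R <= (2 * t)%:E * unit_integral g)%E.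
Proof.
move=> t0 at1.
have a0 : 0 < `|a| by rewrite normr_gt0; apply/eqP => a0; move: at1; rewrite a0 normr0 mul0r ler10.
pose n := (Num.truncn (`|a| * t)).+1.
have /andP[nl nu] : (`|a| * t < n%:R) && (n%:R <= `|a| * t + 1).
  have := Num.Theory.truncn_itv (ltW (lt_le_trans ltr01 at1)) => /andP[h1 h2].
  by rewrite h2/= /n -natr1 lerD2r.
have tL : t < n%:R / `|a| by rewrite ltr_pdivlMr// mulrC.
have L2t : n%:R / `|a| <= 2 * t by rewrite ler_pdivrMr// -mulrA [t * _]mulrC; lra.
have mgc : measurable_fun [set: R] (fun x => g (a * x)).
  by apply: measurableT_comp => //; exact: measurable_funM.
apply: (@le_trans _ _ (\int[mu]_(x in `[t, (t + n%:R / `|a|)%R[) g (a * x + 0)%R)%E).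
  under [leRHS]eq_integral do rewrite addr0.
  apply: ge0_subset_integral => //; first exact: measurable_funTS.
  by move=> x /=; rewrite !in_itv/= => /andP[-> ?] /=; lra.
rewrite (@periodic_integral_affine _ _ _ _ n)//.
- by apply: lee_wpmul2r; rewrite ?lee_fin//; exact: integral_ge0.
- lra.
- by rewrite -normr_gt0.
- by rewrite mulrC divfK// gt_eqF.
Qed.

End one_periodic.
End Periodic.

Section TonelliOn.
Local Open Scope ereal_scope.
Context d1 d2 (T1 : measurableType d1) (T2 : measurableType d2) (R : realType).
Variables (m1 : {sigma_finite_measure set T1 -> \bar R})
          (m2 : {sigma_finite_measure set T2 -> \bar R}).
Variables (D1 : set T1) (D2 : set T2) (f : T1 * T2 -> \bar R).
Hypotheses (mD1 : measurable D1) (mD2 : measurable D2).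
Hypotheses (mf : measurable_fun setT f) (f0 : forall z, 0 <= f z).

Lemma measurable_partial_integral :
  measurable_fun setT (fun x => \int[m2]_(y in D2) f (x, y)).
Proof.
have mD : measurable ([set: T1] `*` D2) by exact: measurableX.
pose h := f \_ (setT `*` D2).
have mh : measurable_fun setT h by apply: (measurable_restrictT _ _).1 => //; exact: measurable_funTS mf.
have h0 z : 0 <= h z by rewrite /h /patch; case: ifP.
have := measurable_fun_fubini_tonelli_F (m2 := m2) h mh h0.
rewrite (_ : fubini_F m2 h = fun x => \int[m2]_(y in D2) f (x, y))//.
apply/funext => x; rewrite /fubini_F [RHS]integral_mkcond.
by apply: eq_integral => y _; rewrite /h /patch in_setX /= in_setT.
Qed.

Lemma tonelli_on :
  \int[m1]_(x in D1) \int[m2]_(y in D2) f (x, y) =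
  \int[m2]_(y in D2) \int[m1]_(x in D1) f (x, y).
Proof.
have mD : measurable (D1 `*` D2) by exact: measurableX.
pose h := f \_ (D1 `*` D2).
have mh : measurable_fun setT h by apply: (measurable_restrictT _ _).1 => //; exact: measurable_funTS mf.
have h0 z : 0 <= h z by rewrite /h /patch; case: ifP.
have := fubini_tonelli (m1 := m1) (m2 := m2) h mh h0.
move=> hE.
transitivity (\int[m1]_x \int[m2]_y h (x, y)).
  rewrite integral_mkcond; apply: eq_integral => x _; rewrite /patch; case: ifPn => xD.
    rewrite [LHS]integral_mkcond; apply: eq_integral => y _.
    by rewrite /h /patch in_setX /= xD.
  by rewrite integral0_eq// => y _; rewrite /h /patch in_setX /= (negbTE xD).
rewrite hE [RHS]integral_mkcond.
apply: eq_integral => y _; rewrite /patch; case: ifPn => yD.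
  rewrite [RHS]integral_mkcond; apply: eq_integral => x _.
  by rewrite /h /patch in_setX /= yD andbT.
by rewrite integral0_eq// => x _; rewrite /h /patch in_setX /= (negbTE yD) andbF.
Qed.

End TonelliOn.

Section TwoFrequencies.
Context {R : realType}.
Notation mu := (@lebesgue_measure R).
Variables g h : R -> \bar R.
Hypotheses (mg : measurable_fun [set: R] g) (mh : measurable_fun [set: R] h).
Hypotheses (g0 : forall x, (0 <= g x)%E) (h0 : forall x, (0 <= h x)%E).
Hypotheses (g1 : forall x, g (x + 1) = g x) (h1 : forall x, h (x + 1) = h x).

Let measurable_lin (a b c : R) : measurable_fun [set: R * R] (fun z => a * z.1 + b * z.2 + c).
Proof.
by apply: measurable_funD => //; apply: measurable_funD; apply: measurable_funM.
Qed.

Let measurable_gh (a p c a' q c' : R) : measurable_fun [set: R * R]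
  (fun z => g (a * z.1 + p * z.2 + c) * h (a' * z.1 + q * z.2 + c'))%E.
Proof.
by apply: emeasurable_funM; apply: measurableT_comp => //; exact: measurable_lin.
Qed.

(* The shear [y -> y - (a/p) x] is measure preserving on full periods and
   removes [x] from the argument of [g]; the [x]-integral of [h] is then taken
   over the [p]-fold period, on which the remaining frequency is an integer. *)
Lemma two_frequencies (a p a' q : int) (c c' : R) : a * q != a' * p ->
  (\int[mu]_(x in `[0%R, 1%R[) \int[mu]_(y in `[0%R, 1%R[)
     (g (a%:~R * x + p%:~R * y + c)%R * h (a'%:~R * x + q%:~R * y + c')%R) =
   unit_integral g * unit_integral h)%E.
Proof.
move=> Dneq0.
pose f (x y : R) := (g (a%:~R * x + p%:~R * y + c)%R * h (a'%:~R * x + q%:~R * y + c')%R)%E.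
have f0 x y : (0 <= f x y)%E by rewrite mule_ge0.
have Uh0 : (0 <= unit_integral h)%E by exact: integral_ge0.
have maff (b e : R) : measurable_fun [set: R] (fun x => b * x + e).
  exact: measurable_affine.
(* For [p = 0] the shear is undefined, but then [a] and [q] are nonzero and the integrals over [y]
   and [x] separate directly. *)
have [p0|p0] := eqVneq p 0.
  subst p; move: Dneq0; rewrite mulr0 mulf_eq0 negb_or => /andP[a0 q0].
  transitivity (\int[mu]_(x in `[0%R, 1%R[) (g (a%:~R * x + c)%R * unit_integral h))%E.
    apply: eq_integral => x _; rewrite -(@periodic_integral_intM _ h mh h0 h1 q (a'%:~R * x + c'))//.
    rewrite -ge0_integralZl//=; first last.
    - apply: measurable_funTS; apply: measurableT_comp => //; exact: maff.
    - apply: eq_integral => y _; congr (g _ * h _)%E; ring.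
  rewrite ge0_integralZr//=; first last.
  - by apply: measurable_funTS; apply: measurableT_comp => //; exact: maff.
  - by rewrite periodic_integral_intM.
pose n := `|p|%N.
have n0 : (0 < n)%N by rewrite absz_gt0.
have np : `|p%:~R| = n%:R :> R by rewrite -intr_norm natr_absz.
have pR0 : p%:~R != 0 :> R by rewrite intr_eq0.
have mf : measurable_fun [set: R * R] (fun z => f z.1 z.2) by exact: measurable_gh.
have mfx x : measurable_fun [set: R] (f x).
  have -> : f x = (fun z => f z.1 z.2) \o (pair x) by [].
  exact: measurableT_comp.
have fper x y : f x (y + 1) = f x y.
  rewrite /f; congr (_ * _)%E.
    rewrite -[RHS](@periodicz _ g g1 p); congr g; ring.
  rewrite -[RHS](@periodicz _ h h1 q); congr h; ring.
pose H x := (\int[mu]_(y in `[0%R, 1%R[) f x y)%E.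
have Hper x : H (x + 1) = H x.
  apply: eq_integral => y _; rewrite /f; congr (_ * _)%E.
    rewrite -[RHS](@periodicz _ g g1 a); congr g; ring.
  rewrite -[RHS](@periodicz _ h h1 a'); congr h; ring.
have H0 x : (0 <= H x)%E by exact: integral_ge0.
have mH : measurable_fun [set: R] H.
  by apply: (@measurable_partial_integral _ _ _ _ _ mu `[0%R, 1%R[ (fun z => f z.1 z.2)).
have shear x : H x = (\int[mu]_(y in `[0%R, 1%R[) (g (p%:~R * y + c)%R *
    h ((a'%:~R - q%:~R * a%:~R / p%:~R) * x + (q%:~R * y + c'))%R))%E.
  have := @periodic_integral_affine _ (f x) (mfx x) (f0 x) (fper x) 0 1 (- (a%:~R / p%:~R) * x) 1 1.
  rewrite mulr1 normr1 oner_eq0 add0r mul1e => /(_ ltr01 isT erefl) E; rewrite -[H x]/(unit_integral (f x)) -E.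
  apply: eq_integral => y _; rewrite /f; congr (g _ * h _)%E; field; exact: pR0.
(* [H] is 1-periodic although the sheared integrand is not, so [x] may run over [n = |p|] periods.
   The slope of [x] in [h], multiplied by [n], is up to sign the determinant [a' p - q a], a nonzero
   integer. *)
have : (n%:R%:E * unit_integral H = n%:R%:E * (unit_integral g * unit_integral h))%E.
  rewrite -(@periodic_integral_nat _ H mH H0 Hper 0) add0r.
  under eq_integral do rewrite shear.
  rewrite (@tonelli_on _ _ _ _ _ mu mu _ _ (fun z => g (p%:~R * z.2 + c)%R *
    h ((a'%:~R - q%:~R * a%:~R / p%:~R) * z.1 + (q%:~R * z.2 + c'))%R)%E)//=; first last.
  - by move=> z; rewrite mule_ge0.
  - have := measurable_gh 0 p%:~R c (a'%:~R - q%:~R * a%:~R / p%:~R) q%:~R c'.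
    by congr (measurable_fun _ _); apply/funext => z; rewrite mul0r add0r addrA.
  transitivity (\int[mu]_(y in `[0%R, 1%R[) (g (p%:~R * y + c)%R * (n%:R%:E * unit_integral h)))%E.
    apply: eq_integral => y _; rewrite ge0_integralZl//; last first.
      by apply: measurable_funTS; apply: measurableT_comp => //; exact: maff.
    congr (_ * _)%E.
    have := @periodic_integral_affine _ h mh h0 h1 0
      (a'%:~R - q%:~R * a%:~R / p%:~R) (q%:~R * y + c') n%:R (absz (a' * p - q * a)%R).
    rewrite add0r; apply.
    + by rewrite ltr0n.
    + rewrite -(mulfK pR0 a'%:~R) -mulrBl mulf_neq0 ?invr_eq0// -!intrM -intrB intr_eq0 subr_eq0.
      by rewrite eq_sym [q * a]mulrC.
    + rewrite -np natr_absz intr_norm -normrM.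
      congr `|_|; rewrite rmorphB !rmorphM/=; field; exact: pR0.
  rewrite ge0_integralZr//; first last.
  - by rewrite mule_ge0// lee_fin.
  - by apply: measurable_funTS; apply: measurableT_comp => //; exact: maff.
  by rewrite periodic_integral_intM// muleCA.
move/(congr1 (fun z => (n%:R^-1)%:E * z)%E).
by rewrite !muleA -!EFinM mulVf ?pnatr_eq0 -?lt0n// !mul1e.
Qed.

End TwoFrequencies.

(** * Iterated means over the unit cube and the choice of frequencies *)

Section Mean.
Context {R : realType}.
Notation mu := (@lebesgue_measure R).

(** An iterated integral in place of a product measure: every induction on [d], including the choice
    of frequencies one by one, peels off the head variable. *)
Fixpoint mean (d : nat) (F : seq R -> \bar R) : \bar R :=
  if d is d'.+1 then (\int[mu]_(x in `[0%R, 1%R[) mean d' (fun l => F (x :: l)))%E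
  else F [::].

(* [F t l] depends measurably on [t] and on the entries of [l], for [size l = d];
   stated along arbitrary measurable parametrisations, to avoid a sigma-algebra
   on sequences. *)
Definition seq_measurable {dT} (T : measurableType dT) (d : nat)
    (F : T -> seq R -> \bar R) : Prop :=
  forall dS (S : measurableType dS) (phi : S -> T) (xs : seq (S -> R)),
    size xs = d -> measurable_fun setT phi ->
    (forall i, measurable_fun setT (nth (fun=> 0) xs i)) ->
    measurable_fun setT (fun t => F (phi t) [seq x t | x <- xs]).

(** Moving the head of the list into the parameter is the induction step of all the statements on
    [mean]; this is why they are quantified over the parameter space [T]. *)
Lemma seq_measurable_cons dT (T : measurableType dT) d (F : T -> seq R -> \bar R) :
  seq_measurable d.+1 F ->
  seq_measurable d (fun (tx : T * R) l => F tx.1 (tx.2 :: l)).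
Proof.
move=> mF dS S phi xs sxs mphi mxs.
apply: (mF _ S (fst \o phi) ((snd \o phi) :: xs)) => /=.
- by rewrite sxs.
- exact: measurableT_comp.
- by case=> [|i] //=; exact: measurableT_comp.
Qed.

Lemma seq_measurable_comp dT (T : measurableType dT) dS (S : measurableType dS) d
    (F : T -> seq R -> \bar R) (phi : S -> T) :
  seq_measurable d F -> measurable_fun setT phi ->
  seq_measurable d (fun s => F (phi s)).
Proof. by move=> mF mphi dU U psi xs sxs mpsi mxs; apply: (mF _ U (phi \o psi)) => //; exact: measurableT_comp. Qed.

Lemma mean_ge0 d F : (forall l, 0 <= F l)%E -> (0 <= mean d F)%E.
Proof.
by elim: d F => [|d IH] F F0 //=; apply: integral_ge0 => x _; exact: IH.
Qed.

Lemma mean_measurable dT (T : measurableType dT) d (F : T -> seq R -> \bar R) :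
  seq_measurable d F -> (forall t l, 0 <= F t l)%E ->
  measurable_fun setT (fun t => mean d (F t)).
Proof.
elim: d dT T F => [|d IH] dT T F mF F0.
  by apply: (mF _ T id [::]) => // i; rewrite nth_nil.
have := IH _ _ _ (seq_measurable_cons mF) (fun z l => F0 z.1 (z.2 :: l)).
move=> mG; apply: (@measurable_partial_integral _ _ _ _ _ mu `[0%R, 1%R[%classic
  (fun z => mean d (fun l => F z.1 (z.2 :: l)))) => // z.
exact: mean_ge0.
Qed.

Let mean_measurable_slice dT (T : measurableType dT) d (F : T -> seq R -> \bar R) t :
  seq_measurable d.+1 F -> (forall t l, 0 <= F t l)%E ->
  measurable_fun setT (fun x => mean d (fun l => F t (x :: l))).
Proof.
move=> mF F0.
have mG := mean_measurable (seq_measurable_cons mF) (fun z l => F0 z.1 (z.2 :: l)).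
rewrite (_ : (fun x => _) = (fun z => mean d (fun l => F z.1 (z.2 :: l))) \o (pair t))//.
exact: measurableT_comp.
Qed.

Lemma meanD dT (T : measurableType dT) d (F G : T -> seq R -> \bar R) t :
  seq_measurable d F -> seq_measurable d G ->
  (forall t l, 0 <= F t l)%E -> (forall t l, 0 <= G t l)%E ->
  (mean d (fun l => F t l + G t l) = mean d (F t) + mean d (G t))%E.
Proof.
elim: d dT T F G t => [|d IH] dT T F G t mF mG F0 G0 //=.
rewrite -ge0_integralD//; first last.
- by apply: measurable_funTS; exact: mean_measurable_slice.
- by move=> x _; exact: mean_ge0.
- by apply: measurable_funTS; exact: mean_measurable_slice.
- by move=> x _; exact: mean_ge0.
apply: eq_integral => x _.
exact: (IH _ _ _ _ (t, x) (seq_measurable_cons mF) (seq_measurable_cons mG)).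
Qed.

Lemma meanZl dT (T : measurableType dT) d (F : T -> seq R -> \bar R) (k : R) t : 0 <= k ->
  seq_measurable d F -> (forall t l, 0 <= F t l)%E ->
  (mean d (fun l => k%:E * F t l) = k%:E * mean d (F t))%E.
Proof.
move=> k0; elim: d dT T F t => [|d IH] dT T F t mF F0 //=.
rewrite -ge0_integralZl//; first last.
- by move=> x _; exact: mean_ge0.
- by apply: measurable_funTS; exact: mean_measurable_slice.
apply: eq_integral => x _.
exact: (IH _ _ _ (t, x) (seq_measurable_cons mF)).
Qed.

Lemma le_mean dT (T : measurableType dT) d (F G : T -> seq R -> \bar R) t :
  seq_measurable d F -> seq_measurable d G ->
  (forall t l, 0 <= F t l)%E -> (forall t l, 0 <= G t l)%E ->
  (forall l, F t l <= G t l)%E ->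
  (mean d (F t) <= mean d (G t))%E.
Proof.
elim: d dT T F G t => [|d IH] dT T F G t mF mG F0 G0 FG //=.
apply: ge0_le_integral => //.
- by move=> x _; exact: mean_ge0.
- by apply: measurable_funTS; exact: mean_measurable_slice.
- by apply: measurable_funTS; exact: mean_measurable_slice.
move=> x _.
exact: (IH _ _ _ _ (t, x) (seq_measurable_cons mF) (seq_measurable_cons mG)).
Qed.

Lemma integral_unit_cst (k : \bar R) : (\int[mu]_(x in `[0%R, 1%R[) (cst k x) = k)%E.
Proof.
by rewrite integral_cst//= lebesgue_measure_itv/= lte_fin ltr01 sube0 mule1.
Qed.

Lemma mean_cst d (k : \bar R) : mean d (fun=> k) = k.
Proof. by elim: d => //= d ->; exact: integral_unit_cst. Qed.

Lemma seq_measurable_sum dT (T : measurableType dT) d I (s : seq I)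
    (F : I -> T -> seq R -> \bar R) :
  (forall i, seq_measurable d (F i)) -> (forall i t l, 0 <= F i t l)%E ->
  seq_measurable d (fun t l => \sum_(i <- s) F i t l)%E.
Proof.
move=> mF F0 dS S phi xs sxs mphi mxs.
apply: emeasurable_sum => i; exact: mF.
Qed.

Lemma mean_sum dT (T : measurableType dT) d I (s : seq I)
    (F : I -> T -> seq R -> \bar R) t :
  (forall i, seq_measurable d (F i)) -> (forall i t l, 0 <= F i t l)%E ->
  (mean d (fun l => \sum_(i <- s) F i t l) = \sum_(i <- s) mean d (F i t))%E.
Proof.
move=> mF F0; elim: s => [|i s IH].
  by rewrite big_nil; under eq_fun do rewrite big_nil; exact: mean_cst.
rewrite big_cons -IH; under eq_fun do rewrite big_cons.
apply: (@meanD _ _ _ (F i) (fun t l => \sum_(i <- s) F i t l)%E) => //.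
- exact: seq_measurable_sum.
- by move=> t' l; apply: sume_ge0.
Qed.

(* Averaging over the new frequency [P] replaces [alpha * P] by a uniform
   variable modulo 1, at the cost of a constant. *)
Lemma select_frequency (G : R * R -> \bar R) (A b tau : R) :
  measurable_fun [set: R * R] G -> (forall z, 0 <= G z)%E ->
  (forall al x, G (al, x + 1) = G (al, x)) ->
  (forall al x, `|al| < A -> G (al, x) = 0%E) ->
  0 < tau -> 1 <= A * tau -> 0 < b ->
  (\int[mu]_al \int[mu]_(x in `[0%R, 1%R[) G (al, x) <= b%:E)%E ->
  exists2 P, tau <= P <= 2 * tau & (\int[mu]_al G (al, (al * P)%R) <= (3 * b)%:E)%E.
Proof.
move=> mG G0 G1 GA tau0 Atau b0 hb; apply: contrapT => noP.
have mG2 : measurable_fun [set: R * R] (fun z => G (z.2, z.2 * z.1)).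
  apply: measurableT_comp => //; apply: measurable_fun_pair => //.
  exact: measurable_funM.
have mGsw : measurable_fun [set: R * R] (fun z => G (z.1, z.1 * z.2)).
  apply: measurableT_comp => //; apply: measurable_fun_pair => //.
  exact: measurable_funM.
(* If no [P] worked, the integral over [P] in [[tau, 2 tau]] would be at least [3 b tau]. Exchanging
   the integrals and bounding the inner one by full periods, legitimate where [|al| tau >= 1], gives
   at most [2 b tau]. *)
have large P : tau <= P <= 2 * tau -> ((3 * b)%:E <= \int[mu]_al G (al, (al * P)%R))%E.
  move=> hP; rewrite leNgt; apply/negP => hlt; apply: noP; exists P => //.
  exact: ltW.
have lo : ((3 * b * tau)%:E <= \int[mu]_(P in `[tau, (2 * tau)%R]) \int[mu]_al G (al, (al * P)%R))%E.
  apply: (@le_trans _ _ (\int[mu]_(P in `[tau, (2 * tau)%R]) (cst (3 * b)%:E P))%E).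
    rewrite integral_cst//= lebesgue_measure_itv/= lte_fin ifT; last by lra.
    by rewrite -EFinB -EFinM lee_fin; nra.
  apply: ge0_le_integral => //.
  - by move=> P _; rewrite lee_fin; lra.
  - apply: measurable_funTS.
    exact: (@measurable_partial_integral _ _ _ _ _ mu setT _ _ mG2).
have hi : (\int[mu]_(P in `[tau, (2 * tau)%R]) \int[mu]_al G (al, (al * P)%R) <= (2 * tau * b)%:E)%E.
  rewrite -(@tonelli_on _ _ _ _ _ mu mu setT `[tau, (2 * tau)%R]%classic (fun z => G (z.1, z.1 * z.2)%R))//=.
  apply: (@le_trans _ _ (\int[mu]_al ((2 * tau)%:E * \int[mu]_(x in `[0%R, 1%R[) G (al, x)))%E).
    apply: ge0_le_integral => //=.
    - by move=> al _; apply: integral_ge0.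
    - exact: (@measurable_partial_integral _ _ _ _ _ mu `[tau, (2 * tau)%R]%classic _ _ mGsw).
    - apply: emeasurable_funM => //.
      exact: (@measurable_partial_integral _ _ _ _ _ mu `[0%R, 1%R[%classic _ _ mG).
    move=> al _; have [alA|alA] := ltP `|al| A.
      rewrite integral0_eq => [|x _]; last exact: GA.
      by rewrite mule_ge0 ?integral_ge0// lee_fin; lra.
    apply: (@periodic_integral_le _ (fun x => G (al, x))) => //.
    - rewrite (_ : (fun x => _) = G \o (pair al))//; exact: measurableT_comp.
    - by rewrite (le_trans Atau)// ler_pM2r.
  rewrite ge0_integralZl//.
  - by rewrite (EFinM (2 * tau) b) lee_wpmul2l// lee_fin; lra.
  - exact: (@measurable_partial_integral _ _ _ _ _ mu `[0%R, 1%R[%classic _ _ mG).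
  - by move=> al _; apply: integral_ge0.
  - by rewrite lee_fin; lra.
have := le_trans lo hi; rewrite lee_fin; nra.
Qed.

(** The head frequency is fixed while the others are still averaged, and the new integrand is
    treated the same way; each choice costs a factor 3. *)
Lemma select_frequencies d (F : R -> seq R -> \bar R) (A b tau : R) :
  seq_measurable d F -> (forall al l, 0 <= F al l)%E ->
  (forall al l1 x l2, F al (l1 ++ (x + 1) :: l2) = F al (l1 ++ x :: l2)) ->
  (forall al l, `|al| < A -> F al l = 0%E) ->
  0 < tau -> 1 <= A * tau -> 0 < b ->
  (\int[mu]_al mean d (F al) <= b%:E)%E ->
  exists Ps : seq R, [/\ size Ps = d, {in Ps, forall P, tau <= P <= 2 * tau} &
    (\int[mu]_al F al [seq (al * P)%R | P <- Ps] <= (3 ^+ d * b)%:E)%E].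
Proof.
elim: d F b => [|d IH] F b mF F0 F1 FA tau0 Atau b0 hb.
  by exists [::]; split => //; rewrite expr0 mul1r.
have mG := mean_measurable (seq_measurable_cons mF) (fun z l => F0 z.1 (z.2 :: l)).
have [|||P hP hPb] := @select_frequency _ A b tau mG _ _ _ tau0 Atau b0 hb.
- by move=> z; exact: mean_ge0.
- by move=> al x; congr mean; apply/funext => l /=; exact: (F1 al [::]).
- by move=> al x alA; rewrite -[RHS](mean_cst d); congr mean; apply/funext => l; exact: FA.
pose F' al l := F al ((al * P) :: l).
have [|||||Ps [sPs hPs hPsb]] := IH F' (3 * b) _ _ _ _ tau0 Atau _ hPb.
- apply: (@seq_measurable_comp _ _ _ _ _ _ (fun al : R => (al, al * P)) (seq_measurable_cons mF)).
  by apply: measurable_fun_pair => //; exact: measurable_funM.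
- by move=> al l; exact: F0.
- by move=> al l1 x l2; exact: (F1 al (_ :: l1)).
- by move=> al l; exact: FA.
- by lra.
exists (P :: Ps); split => /=.
- by rewrite sPs.
- by move=> P'; rewrite inE => /predU1P[->//|]; exact: hPs.
- by rewrite exprSr -mulrA.
Qed.

End Mean.

(** * Counting near integers *)

Section DistInt.
Context {R : realType}.
Notation mu := (@lebesgue_measure R).
Implicit Types x y r : R.

Lemma dist_int_ltP x r : (dist_int x < r) <-> exists j : int, `|x - j%:~R| < r.
Proof.
rewrite /dist_int; have /andP[fx xf] := Num.Theory.floor_itv x.
rewrite intrD in xf.
rewrite gt_min; split.
  case/orP => h; first by exists (Num.floor x); rewrite ger0_norm ?subr_ge0.
  exists (Num.floor x + 1); rewrite intrD ler0_norm; lra.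
case=> j; have [jf|jf] := leP j (Num.floor x).
  have jf' : j%:~R <= (Num.floor x)%:~R :> R by rewrite ler_int.
  by rewrite ger0_norm; [move=> h; apply/orP; left; lra | lra].
have jf' : (Num.floor x + 1)%:~R <= j%:~R :> R by rewrite ler_int; lia.
rewrite intrD in jf'.
by rewrite ler0_norm; [move=> h; apply/orP; right; lra | lra].
Qed.

Lemma dist_intN x : dist_int (- x) = dist_int x.
Proof.
suff le_opp y : dist_int y <= dist_int (- y).
  by apply/eqP; rewrite eq_le le_opp andbT; have := le_opp (- x); rewrite opprK.
rewrite leNgt; apply/negP => /dist_int_ltP[j hj].
suff : dist_int y < dist_int y by rewrite ltxx.
by apply/dist_int_ltP; exists (- j); rewrite intrN opprK -normrN opprD.
Qed.

Definition near_int r x : R := (dist_int x < r)%R%:R.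

Lemma near_int_periodic r x : near_int r (x + 1) = near_int r x.
Proof.
rewrite /near_int; congr (_%:R); congr nat_of_bool; apply/idP/idP => /dist_int_ltP[j hj];
apply/dist_int_ltP.
  by exists (j - 1); rewrite intrB (_ : x - _ = x + 1 - j%:~R)//; ring.
by exists (j + 1); rewrite intrD (_ : _ - _ = x - j%:~R)//; ring.
Qed.

Lemma measurable_near_int r : measurable_fun [set: R] (near_int r).
Proof.
rewrite (_ : near_int r = \1_(\bigcup_(j in [set: int]) (ball (j%:~R : R) r))).
  apply: measurable_indic; apply: countable_bigcupT_measurable => // j.
  exact: measurable_ball.
apply/funext => x; rewrite /near_int indicE; congr (_%:R); congr nat_of_bool.
apply/idP/idP => [/dist_int_ltP[j hj]|].
  by rewrite inE; exists j => //; rewrite -ball_normE /= distrC.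
by rewrite inE => -[j _]; rewrite -ball_normE /= distrC => hj; apply/dist_int_ltP; exists j.
Qed.

Lemma near_int_ge0 r x : 0 <= near_int r x.
Proof. exact: ler0n. Qed.

Lemma unit_integral_near_int r : 0 < r -> r <= 1 / 2 ->
  unit_integral (fun x => (near_int r x)%:E) = (2 * r)%:E.
Proof.
move=> r0 r2.
have mE : measurable_fun [set: R] (fun x => (near_int r x)%:E).
  by apply/measurable_EFinP; exact: measurable_near_int.
(* On the period centred at 0, and for [r <= 1 / 2], the reals within [r] of an integer are exactly
   []-r, r[]. *)
rewrite -(@periodic_integral_shift _ (fun x => (near_int r x)%:E) mE _ _ (- (1 / 2))).
- transitivity (\int[mu]_(x in `[(- (1 / 2))%R, (- (1 / 2) + 1)%R[) (\1_(`]- r, r[%classic) x)%:E)%E.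
    apply: eq_integral => x; rewrite inE/= in_itv/= => /andP[x1 x2].
    rewrite /near_int indicE; congr (_%:R%:E); congr nat_of_bool.
    apply/idP/idP => [/dist_int_ltP[j]|].
      rewrite ltr_norml => /andP[h1 h2]; rewrite inE/= in_itv/=.
      have [j0|j0|j0] := ltgtP j 0.
      + have : j%:~R <= -1 :> R by rewrite -[X in _ <= X]/((-1)%:~R) ler_int; lia.
        lra.
      + have : 1 <= j%:~R :> R by rewrite -[X in X <= _]/(1%:~R) ler_int; lia.
        lra.
      + by move: h1 h2; rewrite j0 subr0 => -> ->.
    rewrite inE/= in_itv/= => hx; apply/dist_int_ltP; exists 0.
    by rewrite subr0 ltr_norml.
  rewrite integral_indic//=.
  rewrite (_ : _ `&` _ = `]- r, r[%classic); last first.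
    apply/seteqP; split => x /=; first by case.
    by rewrite !in_itv/= => /andP[h1 h2]; split; apply/andP; split; lra.
  rewrite lebesgue_measure_itv/= lte_fin ifT; last by lra.
  by rewrite -EFinB; congr _%:E; lra.
- by move=> x; rewrite lee_fin near_int_ge0.
- by move=> x; rewrite near_int_periodic.
Qed.

End DistInt.

(** * Independence modulo 1 of non-parallel integer forms *)

Section LinearForms.
Context {R : realType}.
Notation mu := (@lebesgue_measure R).

Fixpoint dot (v : seq int) (l : seq R) : R :=
  if v is a :: v' then (if l is x :: l' then a%:~R * x + dot v' l' else 0) else 0.

(** Rational proportionality, stated through a common integer vector so that parallel differences
    can be counted by multipliers and direction. *)
Definition parallel (v w : seq int) : Prop :=
  exists p q z, v = [seq p * a | a <- z] /\ w = [seq q * a | a <- z].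

Lemma dot_scale p z l : dot [seq p * a | a <- z] l = p%:~R * dot z l.
Proof.
elim: z l => [|a z IH] [|x l] /=; rewrite ?mulr0//.
by rewrite IH intrM mulrDr mulrA.
Qed.

Lemma dot_eq0 v l : ~~ has (fun a => a != 0) v -> dot v l = 0.
Proof.
elim: v l => [|a v IH] [|x l] //=; rewrite negb_or negbK => /andP[/eqP -> /IH ->].
by rewrite mul0r add0r.
Qed.

Lemma parallel_zero_tail a a' v w : size v = size w ->
  ~~ has (fun a => a != 0) v -> ~~ has (fun a => a != 0) w ->
  parallel (a :: v) (a' :: w).
Proof.
move=> svw /hasPn hv /hasPn hw; exists a, a', (1 :: nseq (size v) 0).
have zer s : {in s, forall a : int, ~~ (a != 0)} -> s = nseq (size s) 0.
  elim: s => //= b s IH hs; have /negPn/eqP -> := hs b (mem_head _ _).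
  by rewrite -IH// => c cs; apply: hs; rewrite inE cs orbT.
rewrite /= !mulr1 !map_nseq !mulr0; split; first by rewrite -zer.
by rewrite svw -zer.
Qed.

(** A single nonzero coefficient makes the form uniform modulo 1. The head variable is part of the
    phase as long as the tail has a nonzero coefficient; otherwise it is the only variable that
    counts. *)
Lemma mean_linear_form (g : R -> \bar R) d v (c : R) :
  measurable_fun [set: R] g -> (forall x, 0 <= g x)%E -> (forall x, g (x + 1) = g x) ->
  size v = d -> has (fun a => a != 0) v ->
  mean d (fun l => g (dot v l + c)) = unit_integral g.
Proof.
move=> mg g0 g1; elim: d v c => [|d IH] [|a v] c //= [sv].
have [hv _|hv] := boolP (has (fun a => a != 0) v).
  transitivity (\int[mu]_(x in `[0%R, 1%R[) (cst (unit_integral g) x))%E; last exact: integral_unit_cst.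
  apply: eq_integral => x _ /=; rewrite -(IH v (a%:~R * x + c))//.
  by congr mean; apply/funext => l; congr g; ring.
rewrite orbF => a0; rewrite -(periodic_integral_intM mg g0 g1 c a0).
apply: eq_integral => x _; under eq_fun do rewrite dot_eq0// addr0.
exact: mean_cst.
Qed.

(** If the tails are not parallel, the heads are absorbed into the phases. If the tails are [p z]
    and [q z], then [dot z l] is a single uniform variable [y] and the claim reduces to
    [two_frequencies] in the head and [y]. *)
Lemma mean_two_linear_forms (g h : R -> \bar R) d v w (c c' : R) :
  measurable_fun [set: R] g -> (forall x, 0 <= g x)%E -> (forall x, g (x + 1) = g x) ->
  measurable_fun [set: R] h -> (forall x, 0 <= h x)%E -> (forall x, h (x + 1) = h x) ->
  size v = d -> size w = d -> ~ parallel v w ->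
  (mean d (fun l => g (dot v l + c)%R * h (dot w l + c')%R) = unit_integral g * unit_integral h)%E.
Proof.
move=> mg g0 g1 mh h0 h1; elim: d v w c c' => [|d IH] [|a v] [|a' w] c c' //=.
  by move=> _ _ []; exists 0, 0, [::].
move=> [sv] [sw] npar.
have [[p [q [z [vE wE]]]]|nvw] := pselect (parallel v w); last first.
  transitivity (\int[mu]_(x in `[0%R, 1%R[) (cst (unit_integral g * unit_integral h) x))%E; last exact: integral_unit_cst.
  apply: eq_integral => x _ /=; rewrite -(IH v w (a%:~R * x + c) (a'%:~R * x + c'))//.
  by congr mean; apply/funext => l; congr (g _ * h _)%E; ring.
have sz : size z = d by rewrite -sv vE size_map.
have hvw : has (fun a => a != 0) v || has (fun a => a != 0) w.
  apply/negP => /negP; rewrite negb_or => /andP[hv hw]; apply: npar.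
  by apply: parallel_zero_tail => //; rewrite sv sw.
have hz : has (fun a => a != 0) z.
  move: hvw; rewrite vE wE !has_map; apply: contraTT => hz.
  rewrite negb_or; apply/andP; split; apply: contra hz; apply: sub_has => b /=;
  by apply: contra => /eqP ->; rewrite mulr0.
have pq0 : (p != 0) || (q != 0).
  move: hvw; rewrite vE wE !has_map; apply: contraTT; rewrite negb_or !negbK => /andP[/eqP -> /eqP ->].
  rewrite negb_or; apply/andP; split; apply/hasPn => b _ /=; by rewrite mul0r eqxx.
(* A zero determinant would make the full vectors parallel. With [p0], [q0] the coprime parts of
   [p], [q] and [u p0 + u' q0 = 1], the heads are [p0] and [q0] times [u a + u' a']. *)
have Dneq : a * q != a' * p.
  apply/eqP => D; apply: npar.
  have g_neq0 : gcdz p q != 0 by rewrite gcdz_eq0 negb_and.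
  have [u [u' bez]] := Bezoutz p q.
  have pE := divzK (dvdz_gcdl p q); have qE := divzK (dvdz_gcdr p q).
  set p0 := (p %/ gcdz p q)%Z in pE; set q0 := (q %/ gcdz p q)%Z in qE.
  have D0 : a * q0 = a' * p0.
    by apply: (mulIf g_neq0); rewrite -!mulrA qE pE.
  have bez0 : u * p0 + u' * q0 = 1.
    by apply: (mulIf g_neq0); rewrite mulrDl -!mulrA pE qE bez mul1r.
  exists p0, q0, ((u * a + u' * a') :: [seq gcdz p q * b | b <- z]); split => /=.
    rewrite vE -map_comp; congr (_ :: _).
      transitivity (a * (u * p0 + u' * q0)); first by rewrite bez0 mulr1.
      by rewrite mulrDr [p0 * _]mulrDr; congr (_ + _); [ring | rewrite mulrCA D0; ring].
    by apply: eq_map => b /=; rewrite mulrA pE.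
  rewrite wE -map_comp; congr (_ :: _).
    transitivity (a' * (u * p0 + u' * q0)); first by rewrite bez0 mulr1.
    by rewrite mulrDr [q0 * _]mulrDr; congr (_ + _); [rewrite mulrCA -D0; ring | ring].
  by apply: eq_map => b /=; rewrite mulrA qE.
rewrite -(two_frequencies mg mh g0 h0 g1 h1 c c' Dneq).
apply: eq_integral => x _.
have maff (b e : R) : measurable_fun [set: R] (fun x => b * x + e).
  exact: measurable_affine.
pose K y := (g (a%:~R * x + p%:~R * y + c)%R * h (a'%:~R * x + q%:~R * y + c')%R)%E.
have := @mean_linear_form K d z 0; rewrite /unit_integral => <- //.
- congr mean; apply/funext => l; rewrite /K vE wE !dot_scale addr0; congr (g _ * h _)%E; ring.
- apply: emeasurable_funM; apply: measurableT_comp => //.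
    rewrite (_ : (fun y : R => _) = (fun y => p%:~R * y + (a%:~R * x + c))); first exact: maff.
    by apply/funext => y; ring.
  rewrite (_ : (fun y : R => _) = (fun y => q%:~R * y + (a'%:~R * x + c'))); first exact: maff.
  by apply/funext => y; ring.
- by move=> y; rewrite mule_ge0.
- move=> y; rewrite /K; congr (_ * _)%E.
    rewrite -[RHS](@periodicz _ g g1 p); congr g; ring.
  rewrite -[RHS](@periodicz _ h h1 q); congr h; ring.
Qed.

End LinearForms.

(** * The variance for uniform frequencies *)

Section IdealVariance.
Context {R : realType}.
Notation mu := (@lebesgue_measure R).

Lemma measurable_dot dS (S : measurableType dS) (v : seq int) (xs : seq (S -> R)) :
  (forall i, measurable_fun setT (nth (fun=> 0) xs i)) ->
  measurable_fun setT (fun t => dot v [seq x t | x <- xs]).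
Proof.
elim: v xs => [|a v IH] [|x xs] //= mxs.
apply: measurable_funD; first by apply: measurable_funM => //; exact: (mxs 0%N).
by apply: IH => i; exact: (mxs i.+1).
Qed.

Lemma seq_measurable_near_int dT (T : measurableType dT) d v (c : T -> R) r :
  measurable_fun setT c ->
  seq_measurable d (fun t l => (near_int r (dot v l + c t))%:E).
Proof.
move=> mc dS S phi xs sxs mphi mxs; apply/measurable_EFinP.
apply: measurableT_comp; first exact: measurable_near_int.
by apply: measurable_funD; [exact: measurable_dot|exact: measurableT_comp].
Qed.

Variables (dT : measure_display) (T : measurableType dT).
Variables (I : Type) (s : seq I) (d : nat) (v : I -> seq int) (c : I -> T -> R) (r : R).
Hypotheses (r0 : 0 < r) (r2 : r <= 1 / 2).
Hypothesis sv : forall i, size (v i) = d.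
Hypothesis v0 : forall i, has (fun a => a != 0) (v i).
Hypothesis mc : forall i, measurable_fun setT (c i).

Definition near_count (t : T) (l : seq R) : R :=
  \sum_(i <- s) near_int r (dot (v i) l + c i t).

Let N i t l := (near_int r (dot (v i) l + c i t))%:E.

Let mN i : seq_measurable d (N i).
Proof. exact: seq_measurable_near_int. Qed.

Let N0 i t l : (0 <= N i t l)%E.
Proof. by rewrite lee_fin near_int_ge0. Qed.

Let mnear : measurable_fun [set: R] (fun x => (near_int r x)%:E).
Proof. by apply/measurable_EFinP; exact: measurable_near_int. Qed.

Let near0 x : (0 <= (near_int r x)%:E)%E.
Proof. by rewrite lee_fin near_int_ge0. Qed.

Let near1 x : (near_int r (x + 1))%:E = (near_int r x)%:E.
Proof. by rewrite near_int_periodic. Qed.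

Let mean_N i t : mean d (N i t) = (2 * r)%:E.
Proof.
by rewrite -unit_integral_near_int//; apply: (mean_linear_form (c i t) mnear).
Qed.

(** [chi i j t] is any necessary condition for two parallel forms to be near integers together. It
    does not see [l], so it can be averaged over [t], the role of [alpha], afterwards. *)
Variables (chi : I -> I -> T -> bool).
Hypothesis chiP : forall i j t l, parallel (v i) (v j) ->
  dist_int (dot (v i) l + c i t) < r -> dist_int (dot (v j) l + c j t) < r -> chi i j t.

Let mNN i j : seq_measurable d (fun t l => N i t l * N j t l)%E.
Proof.
by move=> dS S phi xs sxs mphi mxs; apply: emeasurable_funM; exact: mN.
Qed.

(** Non-parallel forms give exactly [(2 r)^2] by independence. For parallel forms the product is
    zero unless [chi] holds, and then it is bounded by one of its factors. *)
Let mean_NN i j t : (mean d (fun l => N i t l * N j t l) <=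
  (4 * r ^+ 2 + 2 * r * (`[< parallel (v i) (v j) >] && chi i j t)%:R)%:E)%E.
Proof.
have [par|npar] := pselect (parallel (v i) (v j)); last first.
  rewrite (mean_two_linear_forms (c i t) (c j t) mnear near0 near1 mnear near0 near1)//.
  rewrite unit_integral_near_int// -EFinM lee_fin.
  by have := r0; rewrite (asboolF npar)/= mulr0 addr0; nra.
rewrite (asboolT par)/=.
case chiE: (chi i j t).
  apply: (@le_trans _ _ (mean d (N i t))).
    apply: (le_mean (mNN i j) (mN i)) => //.
    - by move=> t' l; rewrite mule_ge0.
    - move=> l; rewrite /N -EFinM lee_fin /near_int.
      by case: (_ < _)%R; case: (_ < _)%R; rewrite ?mulr1 ?mulr0.
  by rewrite mean_N lee_fin mulr1; nra.
rewrite (_ : (fun l => _) = fun=> 0%E); last first.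
  apply/funext => l; rewrite /N /near_int -EFinM.
  case hi: (_ < _)%R; case hj: (_ < _)%R; rewrite ?mulr0 ?mul0r//.
  by have := chiP par hi hj; rewrite chiE.
by rewrite mean_cst lee_fin mulr0 addr0 mulr_ge0 ?sqr_ge0.
Qed.

Let m : R := 2 * r * (size s)%:R.

(** In the second moment the terms [4 r^2] add up to [m^2], which cancels; only parallel pairs
    remain, the diagonal among them. *)
Lemma ideal_variance t :
  (mean d (fun l => ((near_count t l - m) ^+ 2)%:E) <=
   (2 * r * \sum_(i <- s) \sum_(j <- s)
       (`[< parallel (v i) (v j) >] && chi i j t)%:R)%:E)%E.
Proof.
have m0 : 0 <= m by rewrite /m mulr_ge0// mulr_ge0// ltW.
have SE t' l : (near_count t' l)%:E = (\sum_(i <- s) N i t' l)%E.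
  by rewrite /near_count sumEFin.
have nc0 t' l : 0 <= near_count t' l.
  by apply: sumr_ge0 => i _; exact: near_int_ge0.
have mS : seq_measurable d (fun t l => (near_count t l)%:E).
  under eq_fun do under eq_fun do rewrite SE.
  exact: seq_measurable_sum.
have mean_S : mean d (fun l => (near_count t l)%:E) = m%:E.
  under eq_fun do rewrite SE.
  rewrite mean_sum//; under eq_bigr do rewrite mean_N.
  by rewrite sumEFin big_const_seq count_predT iter_addr_0 /m mulr_natr.
have mSr : seq_measurable d (fun t l => (near_count t l ^+ 2)%:E).
  move=> dS S phi xs sxs mphi mxs; apply/measurable_EFinP.
  by apply: measurable_funX; apply/measurable_EFinP; exact: mS.
have mD : seq_measurable d (fun t l => ((near_count t l - m) ^+ 2)%:E).
  move=> dS S phi xs sxs mphi mxs; apply/measurable_EFinP.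
  apply: measurable_funX; apply: measurable_funB => //.
  by apply/measurable_EFinP; exact: mS.
have mean_S2 : (mean d (fun l => (near_count t l ^+ 2)%:E) <=
   (m ^+ 2 + 2 * r * \sum_(i <- s) \sum_(j <- s)
       (`[< parallel (v i) (v j) >] && chi i j t)%:R)%:E)%E.
  rewrite (_ : (fun l => _) = fun l => (\sum_(i <- s) \sum_(j <- s) (N i t l * N j t l))%E); last first.
    apply/funext => l; rewrite expr2 /near_count mulr_suml -sumEFin.
    apply: eq_bigr => i _; rewrite mulr_sumr -sumEFin; apply: eq_bigr => j _.
    by rewrite EFinM.
  rewrite (@mean_sum _ _ _ _ _ _ (fun i t l => \sum_(j <- s) (N i t l * N j t l))%E); first last.
  - by move=> i t' l; apply: sume_ge0 => j _; rewrite mule_ge0.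
  - by move=> i; apply: seq_measurable_sum => // j t' l; rewrite mule_ge0.
  apply: (@le_trans _ _ (\sum_(i <- s) \sum_(j <- s) (4 * r ^+ 2 + 2 * r * (`[< parallel (v i) (v j) >] && chi i j t)%:R)%:E)%E).
    apply: lee_sum => i _.
    rewrite (@mean_sum _ _ _ _ _ _ (fun j t l => (N i t l * N j t l))%E)//; last first.
      by move=> j t' l; rewrite mule_ge0.
    by apply: lee_sum => j _; exact: mean_NN.
  under eq_bigr do rewrite sumEFin.
  rewrite sumEFin lee_fin; under eq_bigr do rewrite big_split/= -[X in _ + X]mulr_sumr.
  rewrite big_split/= -[X in _ + X]mulr_sumr lerD2r.
  have sum_cst k : \sum_(i <- s) k = k * (size s)%:R :> R.
    by rewrite big_const_seq count_predT iter_addr_0 mulr_natr.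
  rewrite sum_cst sum_cst /m [leRHS](_ : _ = 4 * r ^+ 2 * (size s)%:R * (size s)%:R)//.
  ring.
(* The square is expanded as [(S - m)^2 + 2 m S = S^2 + m^2], with nonnegative terms on both sides,
   as additivity of [mean] requires. *)
have key : (mean d (fun l => ((near_count t l - m) ^+ 2)%:E) + (2 * m ^+ 2)%:E =
    mean d (fun l => (near_count t l ^+ 2)%:E) + (m ^+ 2)%:E)%E.
  transitivity (mean d (fun l => ((near_count t l - m) ^+ 2)%:E + (2 * m)%:E * (near_count t l)%:E)%E).
    rewrite (@meanD _ _ _ _ (fun t l => ((near_count t l - m) ^+ 2)%:E) (fun t l => (2 * m)%:E * (near_count t l)%:E)%E)//; first last.
    - by move=> t' l; rewrite -EFinM lee_fin mulr_ge0// mulr_ge0.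
    - by move=> t' l; rewrite lee_fin sqr_ge0.
    - move=> dS S phi xs sxs mphi mxs; apply: emeasurable_funM => //; exact: mS.
    rewrite (@meanZl _ _ _ _ (fun t l => (near_count t l)%:E))//; last by rewrite mulr_ge0.
    by rewrite mean_S -EFinM expr2 mulrA.
  transitivity (mean d (fun l => ((near_count t l) ^+ 2)%:E + (m ^+ 2)%:E)%E).
    congr mean; apply/funext => l; rewrite -EFinM -!EFinD; congr _%:E; ring.
  rewrite (@meanD _ _ _ _ (fun t l => (near_count t l ^+ 2)%:E) (fun _ _ => (m ^+ 2)%:E))//; first last.
  - by move=> t' l; rewrite lee_fin sqr_ge0.
  - by move=> t' l; rewrite lee_fin sqr_ge0.
  by rewrite (mean_cst d (m ^+ 2)%:E).
have {}mean_S2 := leeD mean_S2 (lexx (m ^+ 2)%:E).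
move: mean_S2; rewrite -key -EFinD -leeBrDr// -EFinB.
move=> /le_trans; apply; rewrite lee_fin; nra.
Qed.

End IdealVariance.

(** * Collisions of parallel differences *)

Section Counting.
Local Open Scope set_scope.
Local Open Scope ring_scope.
Context {R : realType}.

Lemma card_ord_bounded_diff (Q : nat) (S : {set 'I_Q}) (D : R) : 0 <= D ->
  {in S &, forall x y : 'I_Q, (x : nat)%:R - (y : nat)%:R <= D :> R} -> #|S|%:R <= D + 1 :> R.
Proof.
move=> D0 hS; have [->|[x0 x0S]] := set_0Vmem S.
  by rewrite cards0; lra.
pose x := [arg min_(y < x0 in S) (y : nat)].
have [xS xmin] : x \in S /\ forall y, y \in S -> (x <= y)%N.
  by rewrite /x; case: arg_minnP => // y yS hy; split.
pose t := Num.truncn D.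
have hyt y : y \in S -> (y - x < t.+1)%N.
  move=> yS; rewrite ltnS /t Num.Theory.truncn_ge_nat//.
  by rewrite natrB ?xmin//; exact: hS.
have inj : {in S &, injective (fun y : 'I_Q => inord (y - x) : 'I_t.+1)}.
  move=> y z yS zS /(congr1 val) /=; rewrite !inordK ?hyt// => yz.
  apply: val_inj => /=; have := xmin _ yS; have := xmin _ zS; lia.
apply: (@le_trans _ _ t.+1%:R).
  rewrite ler_nat -[leqRHS](card_ord t.+1) -(card_in_imset inj).
  exact: max_card.
by rewrite -natr1 lerD2r Num.Theory.truncn_le.
Qed.

Lemma card_affine_small (Q : nat) (z c : int) (H : R) : z != 0 -> 0 <= H ->
  #|[set x : 'I_Q | `|(2 * z * x%:Z + c)%:~R| < H]|%:R <= H / `|z|%:~R + 1 :> R.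
Proof.
move=> z0 H0.
have nz : 0 < `|z|%:~R :> R by rewrite ltr0z normr_gt0.
apply: card_ord_bounded_diff; first by rewrite divr_ge0// ltW.
move=> x y; rewrite !inE => hx hy.
rewrite ler_pdivlMr//.
have : `|(2 * z * x%:Z + c)%:~R - (2 * z * y%:Z + c)%:~R| < H + H :> R.
  exact: le_lt_trans (ler_normB _ _) (ltrD hx hy).
rewrite -intrB (_ : _ - _ = 2 * (z * (x%:Z - y%:Z))); last by ring.
rewrite intrM normrM ger0_norm// intrM normrM -intr_norm intrB/=.
move=> h; have := ler_norm (x%:R - y%:R : R); nra.
Qed.

Variables (Q : nat).
Hypothesis Q0 : (0 < Q)%N.

Lemma card_ffun_fiber (T : finType) (P : pred {ffun 'I_4 -> T}) (i : 'I_4) (t0 : T) (B : R) :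
  (forall w, #|[set x : T | P [ffun j => if j == i then x else w j]]|%:R <= B) ->
  #|[set w | P w]|%:R <= (#|T| ^ 3)%:R * B.
Proof.
move=> hB.
pose proj (w : {ffun 'I_4 -> T}) : {ffun 'I_3 -> T} := [ffun j => w (lift i j)].
pose ext (u : {ffun 'I_3 -> T}) (x : T) : {ffun 'I_4 -> T} :=
  [ffun j => if unlift i j is Some j' then u j' else x].
rewrite -sum1_card (partition_big proj xpredT)//= natr_sum.
apply: (@le_trans _ _ (\sum_(u : {ffun 'I_3 -> T}) B)); last first.
  by rewrite sumr_const card_ffun card_ord mulr_natl.
apply: ler_sum => u _; rewrite sum1_card.
apply: le_trans (hB (ext u t0)); rewrite ler_nat.
set A := (X in (#|X| <= _)%N).
have inj : {in A &, injective (fun w : {ffun 'I_4 -> T} => w i)}.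
  move=> w w'; rewrite /A !unfold_in => /andP[_ /eqP wu] /andP[_ /eqP w'u] ww'.
  apply/ffunP => j; case: (unliftP i j) => [j'|] ->//.
  by have := congr1 (fun f : {ffun _} => f j') wu; rewrite -w'u !ffunE.
rewrite -(card_in_imset inj); apply: subset_leq_card; apply/fintype.subsetP => x /imsetP[w].
rewrite /A unfold_in inE => /andP[Pw /eqP wu] ->; rewrite inE in Pw; move: Pw; congr P.
apply/ffunP => j; rewrite !ffunE; case: eqP => [->//|/eqP ji].
by case: unliftP => [j' ->|jE]; [rewrite -wu ffunE | rewrite jE eqxx in ji].
Qed.

(** Sign and magnitude code for the integers of modulus below [Q]. Zero has two codes, which is
    harmless since only upper bounds on cardinals are wanted. *)
Definition sgd (z : bool * 'I_Q) : int := if z.1 then - (z.2 : nat)%:Z else (z.2 : nat)%:Z.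

Lemma abs_sgd z : `|sgd z| = (z.2 : nat)%:Z.
Proof. by rewrite /sgd; case: ifP => _; rewrite ?normrN. Qed.

Definition maxabs (ze : {ffun 'I_4 -> bool * 'I_Q}) : nat := \max_i ((ze i).2 : nat).

(** One of the 4 coordinates has modulus [t], with 2 codes, and each of the other three at most
    [2 (t + 1) <= 4 t] codes: [4 * 2 * 4^3 = 512]. *)
Lemma card_maxabs_eq (t : nat) : (0 < t)%N ->
  (#|[set ze | maxabs ze == t]| <= 512 * t ^ 3)%N.
Proof.
move=> t0.
pose F i (j : 'I_4) := [pred x : bool * 'I_Q | if j == i then x.2 == t :> nat else (x.2 <= t)%N].
have sub : [set ze | maxabs ze == t] \subset
    \bigcup_(i : 'I_4) [set ze : {ffun 'I_4 -> bool * 'I_Q} | ze \in family (F i)].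
  apply/fintype.subsetP => ze; rewrite inE => /eqP mt.
  have := @bigop.eq_bigmax _ (fun i => ((ze i).2 : nat)); rewrite card_ord => /(_ isT)[i iE].
  rewrite -/(maxabs ze) in iE.
  apply/bigcupP; exists i => //; rewrite inE; apply/familyP => j.
  rewrite inE; case: eqP => [->|_]; first by rewrite -iE mt.
  by rewrite -mt; exact: (leq_bigmax j).
apply: (leq_trans (subset_leq_card sub)).
have card_le (P : pred 'I_Q) : (#|[pred x : bool * 'I_Q | P x.2]| <= 2 * #|P|)%N.
  rewrite [X in (_ <= X * _)%N](_ : 2 = #|{: bool}|)%N; last by rewrite card_bool.
  apply: (@leq_trans #|[predX {: bool} & P]|%N); last by rewrite cardX.
  by apply: subset_leq_card; apply/fintype.subsetP => -[x1 x2]; rewrite !inE.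
have card_lt (c : nat) : (#|[pred x : 'I_Q | (x <= c)%N]| <= c.+1)%N.
  rewrite -[leqRHS](card_ord c.+1).
  have inj : {in [pred x : 'I_Q | (x <= c)%N] &, injective (fun x : 'I_Q => inord x : 'I_c.+1)}.
    move=> x y; rewrite !inE => hx hy /(congr1 val) /=; rewrite !inordK// => xy.
    exact: val_inj.
  by rewrite -(card_in_imset inj); exact: max_card.
have cF i : (#|[set ze : {ffun 'I_4 -> bool * 'I_Q} | ze \in family (F i)]| <= 2 * (2 * t.+1) ^ 3)%N.
  rewrite cardsE card_family foldrE big_map big_enum /= (bigD1 i)//=.
  apply: leq_mul.
    rewrite /F; apply: (@leq_trans #|[pred x : bool * 'I_Q | (fun y : 'I_Q => y == t :> nat) x.2]|%N).
      by apply: subset_leq_card; apply/fintype.subsetP => x; rewrite !inE eqxx.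
    apply: leq_trans (card_le (fun y : 'I_Q => y == t :> nat)) _.
    rewrite -[X in (_ <= X)%N]muln1 leq_mul2l /=.
    rewrite leqNgt; apply/negP => /card_gt1P[x [y [hx hy /eqP xy]]]; apply: xy.
    by apply: val_inj; rewrite !unfold_in in hx hy; exact: (etrans (eqP hx) (esym (eqP hy))).
  apply: (@leq_trans (\prod_(j < 4 | j != i) (2 * t.+1))%N).
    apply: leq_prod => j ji; rewrite /F.
    apply: (@leq_trans #|[pred x : bool * 'I_Q | [pred y : 'I_Q | (y <= t)%N] x.2]|%N).
      by apply: subset_leq_card; apply/fintype.subsetP => x; rewrite !inE (negbTE ji).
    apply: leq_trans (card_le [pred y : 'I_Q | (y <= t)%N]) _.
    by rewrite leq_mul2l card_lt orbT.
  by rewrite prod_nat_const cardC1 card_ord.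
have le_bigcup : (#|\bigcup_(i : 'I_4) [set ze : {ffun 'I_4 -> bool * 'I_Q} | ze \in family (F i)]| <=
    \sum_(i < 4) #|[set ze : {ffun 'I_4 -> bool * 'I_Q} | ze \in family (F i)]|)%N.
  elim/big_ind2: _ => [|A a B b hA hB|//]; first by rewrite cards0.
  by apply: leq_trans (leq_card_setU _ _) _; exact: leq_add.
apply: leq_trans le_bigcup _.
apply: (@leq_trans (\sum_(i < 4) 2 * (2 * t.+1) ^ 3)); first by apply: leq_sum => i _.
rewrite sum_nat_const card_ord.
have : (t.+1 <= 2 * t)%N by lia.
rewrite -(leq_exp2r _ _ (isT : 0 < 3)%N) !expnMn; lia.
Qed.

(* [u = a zeta] and [u' = b zeta] are the parallel differences, [w] and [w']
   the base points, and [K] measures the window in which two perturbed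
   differences can collide. *)
Definition collision (K : R)
  (q : 'I_Q * 'I_Q * {ffun 'I_4 -> bool * 'I_Q} * {ffun 'I_4 -> 'I_Q} * {ffun 'I_4 -> 'I_Q}) :=
  let: (a, b, ze, w', w) := q in
  [&& (0 < a)%N, (0 < b)%N, (0 < maxabs ze)%N, (a * maxabs ze < Q)%N, (b * maxabs ze < Q)%N &
   `|(2 * (\sum_i sgd (ze i) * ((w i)%:Z - (w' i)%:Z)) +
      (a%:Z - b%:Z) * (\sum_i sgd (ze i) ^+ 2))%:~R| * (minn a b)%:R < K].

(** The condition is affine in each coordinate of [w]. At a coordinate where [ze] attains its
    maximal modulus the slope is [2 * maxabs ze] up to sign; the other three coordinates are
    free. *)
Lemma card_collision_fiber (K : R) a b ze w' : 0 <= K ->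
  #|[set w | collision K (a, b, ze, w', w)]|%:R <=
  (Q ^ 3)%:R * (K / ((minn a b)%:R * (maxabs ze)%:R) + 1).
Proof.
move=> K0; rewrite /collision.
case: (ltnP 0 a) => [a0|_] /=; last first.
  by rewrite cards0 mulr_ge0// addr_ge0// divr_ge0// mulr_ge0.
case: (ltnP 0 b) => [b0|_] /=; last first.
  by rewrite cards0 mulr_ge0// addr_ge0// divr_ge0// mulr_ge0.
case: (ltnP 0 (maxabs ze)) => [m0|_] /=; last first.
  by rewrite cards0 mulr_ge0// addr_ge0// divr_ge0// mulr_ge0.
have mab : 0 < (minn a b)%:R :> R by rewrite ltr0n leq_min a0.
have := @bigop.eq_bigmax _ (fun i => ((ze i).2 : nat)); rewrite card_ord => /(_ isT)[i iE].
rewrite -/(maxabs ze) in iE.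
have zi0 : sgd (ze i) != 0 by rewrite -normr_eq0 abs_sgd -iE; lia.
rewrite [X in _ <= X * _](_ : _ = (#|'I_Q| ^ 3)%:R); last by rewrite card_ord.
apply: (card_ffun_fiber (Ordinal Q0) (i := i)) => w.
pose rest := (\sum_(j | j != i) sgd (ze j) * ((w j)%:Z - (w' j)%:Z)).
pose c := 2 * (rest - sgd (ze i) * (w' i)%:Z) + (a%:Z - b%:Z) * (\sum_i sgd (ze i) ^+ 2).
apply: (@le_trans _ _ (#|[set x : 'I_Q | `|(2 * sgd (ze i) * x%:Z + c)%:~R| < K / (minn a b)%:R]|%:R)).
  rewrite ler_nat; apply: subset_leq_card; apply/fintype.subsetP => x; rewrite !inE.
  move=> /and3P[_ _]; rewrite ltr_pdivlMr//.
  rewrite (bigD1 i)//= ffunE eqxx (eq_bigr (fun j => sgd (ze j) * ((w j)%:Z - (w' j)%:Z))); last first.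
    by move=> j ji; rewrite ffunE (negbTE ji).
  rewrite -/rest (_ : 2 * (_ + _) + _ = 2 * sgd (ze i) * x%:Z + c)//.
  by rewrite /c; ring.
apply: le_trans (card_affine_small Q c zi0 (divr_ge0 K0 (ltW mab))) _.
by rewrite abs_sgd -iE -mulrA -invfM.
Qed.

Lemma sum_inv_sqr_le2 (m : nat) :
  \sum_(a < m) (if (0 < a)%N then (a%:R ^+ 2)^-1 else 0) <= 2 :> R.
Proof.
suff H k : \sum_(a < k.+2) (if (0 < a)%N then (a%:R ^+ 2)^-1 else 0) <= 2 - k.+1%:R^-1 :> R.
  case: m => [|[|m]]; first by rewrite big_ord0.
    by rewrite big_ord_recr big_ord0 /= add0r.
  by apply: le_trans (H m) _; rewrite lerBlDr lerDl invr_ge0.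
elim: k => [|k IH].
  by rewrite !big_ord_recr big_ord0/= expr1n invr1; lra.
rewrite big_ord_recr /=; apply: le_trans (lerD IH (lexx _)) _.
have k0 : 0 < k.+1%:R :> R by [].
have -> : k.+2%:R = k.+1%:R + 1 :> R by rewrite natr1.
set x : R := k.+1%:R in k0 *.
have : ((x + 1) ^+ 2)^-1 <= (x * (x + 1))^-1.
  by rewrite lef_pV2 ?posrE ?mulr_gt0 ?exprn_gt0; nra.
have -> : (x * (x + 1))^-1 = x^-1 - (x + 1)^-1.
  by field; apply/andP; split; apply/eqP => E; lra.
have lin (u y z : R) : y <= u - z -> 2 - u + y <= 2 - z by move=> ?; lra.
exact: lin.
Qed.

(** For [a <= b] there are at most [X = Q / b] values of [t], each below [X], so the sum is at most
    [K Q^3 / (a b^3) + Q^4 / b^4]. Both [a b^3] and [b^4] are at least [a^2 b^2], which leaves a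
    product of two convergent series. *)
Lemma collision_weight_sum (K : R) (a b : nat) : 0 <= K -> (0 < a < Q)%N -> (0 < b < Q)%N ->
  \sum_(t < Q | [&& (0 < t)%N, (a * t < Q)%N & (b * t < Q)%N])
     (t ^ 3)%:R * (K / ((minn a b)%:R * t%:R) + 1) <=
  (K * Q%:R ^+ 3 + Q%:R ^+ 4) * ((a%:R ^+ 2)^-1 * (b%:R ^+ 2)^-1) :> R.
Proof.
move=> K0 /andP[a0 aQ] /andP[b0 bQ].
wlog ab : a b a0 aQ b0 bQ / (a <= b)%N => [H|].
  case/orP: (leq_total a b) => [leab|ba]; first exact: H.
  rewrite [X in _ <= _ * X]mulrC minnC.
  by under eq_bigl do rewrite [X in _ && X]andbC; exact: H.
rewrite (minn_idPl ab).
have ra0 : 0 < a%:R :> R by rewrite ltr0n.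
have rb0 : 0 < b%:R :> R by rewrite ltr0n.
have rQ0 : 0 < Q%:R :> R by rewrite ltr0n.
have rab : a%:R <= b%:R :> R by rewrite ler_nat.
have rbQ : b%:R <= Q%:R :> R by rewrite ler_nat ltnW.
pose X : R := Q%:R / b%:R.
have X1 : 1 <= X by rewrite ler_pdivlMr// mul1r.
apply: (@le_trans _ _ (\sum_(t < Q | [&& (0 < t)%N, (a * t < Q)%N & (b * t < Q)%N])
   (K / a%:R * X ^+ 2 + X ^+ 3))).
  apply: ler_sum => t /and3P[t0 _ btQ].
  have rt0 : 0 < t%:R :> R by rewrite ltr0n.
  have tX : t%:R <= X by rewrite ler_pdivlMr// mulrC -natrM ler_nat ltnW.
  rewrite natrX.
  have -> : t%:R ^+ 3 * (K / (a%:R * t%:R) + 1) = K / a%:R * t%:R ^+ 2 + t%:R ^+ 3.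
    by field; apply/andP; split; apply/eqP => E; lra.
  apply: lerD; last by apply: lerXn2r => //; rewrite nnegrE ltW// (lt_le_trans _ X1).
  apply: ler_wpM2l; first by rewrite divr_ge0// ltW.
  by apply: lerXn2r => //; rewrite nnegrE ltW// (lt_le_trans _ X1).
rewrite -[X in \sum_(t < Q | X t) _]/(fun t : 'I_Q => [&& (0 < t)%N, (a * t < Q)%N & (b * t < Q)%N]).
rewrite sumr_const -[X in X <= _]mulr_natl.
set N := #|_|.
have NX : N%:R <= X.
  rewrite -[X in _ <= X](subrK 1) /N -cardsE; apply: card_ord_bounded_diff; first lra.
  move=> x y; rewrite !inE => /and3P[_ _ bx] /and3P[y0 _ _].
  apply: lerB; last by rewrite ler1n.
  by rewrite ler_pdivlMr// mulrC -natrM ler_nat ltnW.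
have pos : 0 <= K / a%:R * X ^+ 2 + X ^+ 3.
  rewrite addr_ge0//; last by rewrite exprn_ge0//; lra.
  by rewrite mulr_ge0 ?divr_ge0 ?sqr_ge0// ltW.
apply: le_trans (ler_wpM2r pos NX) _.
have -> : X * (K / a%:R * X ^+ 2 + X ^+ 3) =
   K * Q%:R ^+ 3 * (a%:R * b%:R ^+ 3)^-1 + Q%:R ^+ 4 * (b%:R ^+ 4)^-1.
  by rewrite /X; field; apply/andP; split; apply/eqP => E; lra.
rewrite [leRHS]mulrDl -invfM.
have Q3 : 0 <= Q%:R ^+ 3 :> R by rewrite exprn_ge0.
have Q4 : 0 <= Q%:R ^+ 4 :> R by rewrite exprn_ge0.
apply: lerD; (apply: ler_wpM2l; first by rewrite ?mulr_ge0).
  rewrite lef_pV2 ?posrE ?mulr_gt0 ?exprn_gt0//.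
  rewrite -subr_ge0 (_ : _ - _ = a%:R * b%:R ^+ 2 * (b%:R - a%:R)); last by ring.
  by rewrite !mulr_ge0 ?sqr_ge0 ?subr_ge0.
rewrite lef_pV2 ?posrE ?mulr_gt0 ?exprn_gt0//.
rewrite (exprD _ 2 2) ler_pM2r ?exprn_gt0//.
by apply: lerXn2r => //; rewrite nnegrE ltW.
Qed.

Variable C : nat.
Hypothesis card_shell : forall t, (0 < t)%N ->
  (#|[set ze | maxabs ze == t]| <= C * t ^ 3)%N.

(** There are [Q^4] choices of [w'] and a fibre bound with factor [Q^3] for [w]. That bound depends
    on [ze] only through [maxabs], so vectors are grouped into shells; the factor 4 is the square of
    [sum 1/a^2 <= 2]. *)
Lemma card_collision (K : R) : 0 <= K ->
  #|[set q | collision K q]|%:R <= 4 * C%:R * Q%:R ^+ 7 * (K * Q%:R ^+ 3 + Q%:R ^+ 4) :> R.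
Proof.
move=> K0.
pose g (a b t : nat) : R :=
  if [&& (0 < a)%N, (0 < b)%N, (0 < t)%N, (a * t < Q)%N & (b * t < Q)%N]
  then (Q ^ 3)%:R * (K / ((minn a b)%:R * t%:R) + 1) else 0.
have step1 : #|[set q | collision K q]|%:R <=
    \sum_(p : 'I_Q * 'I_Q * {ffun 'I_4 -> bool * 'I_Q} * {ffun 'I_4 -> 'I_Q})
      g p.1.1.1 p.1.1.2 (maxabs p.1.2) :> R.
  rewrite -sum1_card (partition_big fst xpredT)//= natr_sum.
  apply: ler_sum => -[[[a b] ze] w'] _ /=; rewrite /g.
  rewrite sum1_card.
  set A := #|_|.
  have leA : (A <= #|[set w | collision K (a, b, ze, w', w)]|)%N.
    rewrite /A; set B := (X in (#|X| <= _)%N).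
    have inj : {in B &, injective snd}.
      move=> [q1 w1] [q2 w2]; rewrite !unfold_in /= => /andP[_ /eqP q1E] /andP[_ /eqP q2E] /= ->.
      by rewrite q1E q2E.
    rewrite -(card_in_imset inj); apply: subset_leq_card; apply/fintype.subsetP => w /imsetP[[q1 w1]].
    by rewrite unfold_in => /andP[h /eqP /= q1E] /= ->; move: h; rewrite q1E !inE.
  apply: (@le_trans _ _ #|[set w | collision K (a, b, ze, w', w)]|%:R); first by rewrite ler_nat.
  case: ifP => [_|hF]; first exact: card_collision_fiber.
  rewrite (_ : [set w | _] = finset.set0) ?cards0//; apply/finset.setP => w; rewrite !inE.
  by apply/negP => /and5P[h1 h2 h3 h4 /andP[h5 _]]; rewrite h1 h2 h3 h4 h5 in hF.
apply: le_trans step1 _.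
have step2 : \sum_(p : 'I_Q * 'I_Q * {ffun 'I_4 -> bool * 'I_Q} * {ffun 'I_4 -> 'I_Q})
      g p.1.1.1 p.1.1.2 (maxabs p.1.2) =
    (Q ^ 4)%:R * \sum_(a < Q) \sum_(b < Q) \sum_(ze : {ffun 'I_4 -> bool * 'I_Q}) g a b (maxabs ze).
  rewrite -(pair_bigA _ (fun (p : 'I_Q * 'I_Q * {ffun 'I_4 -> bool * 'I_Q}) (w : {ffun 'I_4 -> 'I_Q}) => g p.1.1 p.1.2 (maxabs p.2))) /=.
  under eq_bigr do rewrite sumr_const card_ffun !card_ord -mulr_natl.
  rewrite -mulr_sumr; congr (_ * _).
  rewrite -(pair_bigA _ (fun (p : 'I_Q * 'I_Q) (ze : {ffun 'I_4 -> bool * 'I_Q}) => g p.1 p.2 (maxabs ze))) /=.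
  by rewrite -(pair_bigA _ (fun a b : 'I_Q => \sum_(ze : {ffun 'I_4 -> bool * 'I_Q}) g a b (maxabs ze))).
rewrite step2.
pose iv (a : nat) : R := if (0 < a)%N then (a%:R ^+ 2)^-1 else 0.
have iv0 a : 0 <= iv a by rewrite /iv; case: ifP; rewrite ?invr_ge0 ?sqr_ge0.
have KQ0 : 0 <= K * Q%:R ^+ 3 + Q%:R ^+ 4 by rewrite addr_ge0 ?mulr_ge0 ?exprn_ge0.
have step3 (a b : 'I_Q) : \sum_(ze : {ffun 'I_4 -> bool * 'I_Q}) g a b (maxabs ze) <=
    (Q ^ 3)%:R * (C%:R * (K * Q%:R ^+ 3 + Q%:R ^+ 4)) * (iv a * iv b).
  rewrite /iv; case: (posnP a) => [a0|a0].
    by rewrite mul0r mulr0 big1// => ze _; rewrite /g a0.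
  case: (posnP b) => [b0|b0].
    by rewrite !mulr0 big1// => ze _; rewrite /g b0 andbF.
  have maxQ ze : (maxabs ze < Q)%N.
    have := @bigop.eq_bigmax _ (fun i => ((ze i).2 : nat)); rewrite card_ord => /(_ isT)[i iE].
    by rewrite /maxabs iE.
  have W := @collision_weight_sum K a b K0; rewrite a0 b0 !ltn_ord in W.
  have {}W := ler_wpM2l (ler0n R (Q ^ 3 * C)) (W isT isT).
  rewrite (_ : (Q ^ 3)%:R * _ * _ = (Q ^ 3 * C)%:R * ((K * Q%:R ^+ 3 + Q%:R ^+ 4) *
    (a%:R ^- 2 * b%:R ^- 2))); last by rewrite natrM; ring.
  apply: le_trans _ W; rewrite big_distrr /=.
  apply: (@le_trans _ _ (\sum_(ze : {ffun 'I_4 -> bool * 'I_Q}) \sum_(t < Q | maxabs ze == t) g a b t)).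
    apply: ler_sum => ze _; rewrite (big_pred1 (Ordinal (maxQ ze)))//.
  rewrite (exchange_big_dep xpredT) //= [leRHS]big_mkcond; apply: ler_sum => t _.
  rewrite sumr_const /g a0 b0 /=.
  case: ifP => [/andP[t0 _]|_]; last by rewrite mul0rn.
  rewrite -[X in X <= _]mulr_natl natrM [X in X <= _]mulrCA -[X in _ <= X]mulrA; apply: ler_wpM2l => //.
  rewrite mulrA; apply: ler_wpM2r; first by rewrite addr_ge0// divr_ge0// mulr_ge0.
  rewrite -natrM ler_nat; apply: leq_trans (card_shell t0); rewrite cardsE.
  by apply: subset_leq_card; apply/fintype.subsetP.
apply: (@le_trans _ _ ((Q ^ 4)%:R * \sum_(a < Q) \sum_(b < Q)
   (Q ^ 3)%:R * (C%:R * (K * Q%:R ^+ 3 + Q%:R ^+ 4)) * (iv a * iv b))).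
  by apply: ler_wpM2l => //; apply: ler_sum => a _; apply: ler_sum => b _; exact: step3.
have -> : \sum_(a < Q) \sum_(b < Q) (Q ^ 3)%:R * (C%:R * (K * Q%:R ^+ 3 + Q%:R ^+ 4)) * (iv a * iv b) =
   (Q ^ 3)%:R * (C%:R * (K * Q%:R ^+ 3 + Q%:R ^+ 4)) * ((\sum_(a < Q) iv a) * (\sum_(b < Q) iv b)).
  rewrite big_distrlr /= mulr_sumr; apply: eq_bigr => a _; by rewrite mulr_sumr.
have siv := sum_inv_sqr_le2 Q.
rewrite -/(\sum_(a < Q) iv a) in siv.
have siv0 : 0 <= \sum_(a < Q) iv a by exact: sumr_ge0.
rewrite !natrX.
set V := K * _ + _ in KQ0 *; set s := \sum_(a < Q) _ in siv siv0 *.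
have -> : Q%:R ^+ 4 * (Q%:R ^+ 3 * (C%:R * V) * (s * s)) = C%:R * Q%:R ^+ 7 * V * (s * s) by ring.
have -> : 4 * C%:R * Q%:R ^+ 7 * V = C%:R * Q%:R ^+ 7 * V * 4 by ring.
apply: ler_wpM2l; first by rewrite mulr_ge0// mulr_ge0// exprn_ge0.
nra.
Qed.

End Counting.

Lemma card_collision_le (R : realType) : exists2 C : R, 0 <= C &
  forall (Q : nat) (K : R), (0 < Q)%N -> 0 <= K ->
  #|[pred q | @collision R Q K q]|%:R <= C * Q%:R ^+ 7 * (K * Q%:R ^+ 3 + Q%:R ^+ 4).
Proof.
have [C hC] : exists C : nat, forall Q t, (0 < Q)%N -> (0 < t)%N ->
    (#|[set ze | @maxabs Q ze == t]%SET| <= C * t ^ 3)%N.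
  by exists 512%N => Q t Q0 t0; exact: card_maxabs_eq.
exists (4 * C%:R) => [|Q K Q0 K0]; first by rewrite mulr_ge0.
by rewrite -cardsE; apply: card_collision => // t; exact: hC.
Qed.

(** * Blocks and their variance *)

Section Digits.
Local Open Scope nat_scope.
Variable n : nat.
Hypothesis n0 : (0 < n)%N.

Definition digit (i m : nat) : nat :=
  if (i < 3)%N then (m %/ n ^ i) %% n else m %/ n ^ 3.

Definition quots (m : nat) : seq int :=
  [:: m%:Z; (m %/ n)%:Z; (m %/ n ^ 2)%:Z; (m %/ n ^ 3)%:Z].

Definition sqnorm (m : nat) : nat := \sum_(i < 4) digit i m ^ 2.

Lemma digit_recomp m :
  m = digit 0 m + n * (digit 1 m + n * (digit 2 m + n * digit 3 m)).
Proof.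
rewrite /digit /= expn0 divn1 expn1.
have E2 := divn_eq (m %/ n ^ 2) n; have E1 := divn_eq (m %/ n) n; have E0 := divn_eq m n.
rewrite -divnMA -expnSr in E2; rewrite -divnMA mulnn in E1.
move: E0 E1 E2.
move: (m %/ n ^ 2 %% n) (m %/ n %% n) (m %% n) => r2 r1 r0.
by move: (m %/ n ^ 3) (m %/ n ^ 2) (m %/ n) => q3 q2 q1 -> -> ->; lia.
Qed.

Lemma digit_inj m m' : (forall i : 'I_4, digit i m = digit i m') -> m = m'.
Proof.
move=> H; rewrite (digit_recomp m) (digit_recomp m').
have h (i : nat) : (i < 4)%N -> digit i m = digit i m' by move=> i4; exact: (H (Ordinal i4)).
by rewrite !h.
Qed.

Lemma digit_lt i m : (m < 16 * n ^ 4)%N -> (digit i m < 16 * n)%N.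
Proof.
move=> mM; rewrite /digit; case: ifP => _.
  by apply: leq_trans (ltn_pmod _ n0) _; lia.
rewrite ltn_divLR ?expn_gt0 ?n0// -mulnA -expnS; exact: mM.
Qed.

Lemma digit_quots i m : (i < 4)%N ->
  (digit i m)%:Z = (nth 0 (quots m) i - n%:Z * nth 0 (quots m) i.+1)%R.
Proof.
have q (e : nat) : ((m %/ n ^ e) %% n)%:Z = ((m %/ n ^ e)%:Z - n%:Z * (m %/ n ^ e.+1)%:Z)%R.
  have := divn_eq (m %/ n ^ e) n; rewrite -divnMA -expnSr; lia.
case: i => [|[|[|[|//]]]] _; rewrite /digit /=.
- by have := q 0%N; rewrite expn0 divn1 expn1.
- by have := q 1%N; rewrite expn1.
- exact: q.
- by rewrite mulr0 subr0.
Qed.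

End Digits.

(** Counting by an encoding given only as an existential statement; the function is obtained by
    choice. *)
Lemma card_le_rel (A B : finType) (S : pred A) (S' : pred B) (rel : A -> B -> Prop) :
  (forall x, S x -> exists2 y, S' y & rel x y) ->
  (forall x x' y, rel x y -> rel x' y -> x = x') -> (#|S| <= #|S'|)%N.
Proof.
move=> ex inj.
have f_ex (x : {x | S x}) : {y | S' y & rel (val x) y}.
  by apply: cid2; apply: ex; exact: (valP x).
rewrite -card_sig -[leqRHS]card_sig.
pose f (x : {x | S x}) : {y | S' y} := exist _ (s2val (f_ex x)) (s2valP (f_ex x)).
apply: (@leq_card _ _ f) => x x' /(congr1 val) /= fxx'.
apply: val_inj; apply: inj (s2valP' (f_ex x)) _; rewrite fxx'.
exact: s2valP'.
Qed.

Lemma int_norm_lt1 (R : realType) (j : int) : `|j%:~R| < 1 :> R -> j = 0.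
Proof. by rewrite -intr_norm -[X in _ < X]/(1%:~R) ltr_int; lia. Qed.

Section Block.
Context {R : realType}.
Variables (n : nat) (eps : R) (xo : nat -> R).
Hypothesis n0 : (0 < n)%N.
Hypothesis eps0 : 0 < eps.
Let N := (n ^ 4)%N.
Let M := (16 * n ^ 4)%N.
Let Q := (16 * n)%N.

Definition block_elem (P : seq R) (m : nat) : R :=
  dot (1 :: quots n m) P + eps * (sqnorm n m)%:R.

Definition extend (P : seq R) (m : nat) : R :=
  if (m < n ^ 4)%N then xo m else block_elem P m.

Definition quots_diff (m m' : nat) : seq int :=
  [seq p.1 - p.2 | p <- zip (quots n m) (quots n m')].

(* For [p.2 < n ^ 4] the element [xo p.2] is already fixed and belongs to the
   phase.  The last branch is a dummy that keeps the form nonzero for all [p]. *)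
Definition pair_form (p : nat * nat) : seq int :=
  if (p.2 < p.1)%N then
    if (n ^ 4 <= p.2)%N then 0 :: quots_diff p.1 p.2 else 1 :: quots n p.1
  else [:: 1; 0; 0; 0; 0].

Definition pair_phase (p : nat * nat) (al : R) : R :=
  if (n ^ 4 <= p.2)%N then al * (eps * ((sqnorm n p.1)%:R - (sqnorm n p.2)%:R))
  else al * (eps * (sqnorm n p.1)%:R - xo p.2).

Lemma size_pair_form p : size (pair_form p) = 5.
Proof. by rewrite /pair_form; case: ifP => // _; case: ifP. Qed.

Lemma pair_form_neq0 p : has (fun a => a != 0) (pair_form p).
Proof.
rewrite /pair_form; case: ifP => // p21; case: ifP => //= _.
by rewrite subr_eq0 eqz_nat neq_ltn p21 orbT.
Qed.

Lemma measurable_pair_phase p : measurable_fun [set: R] (pair_phase p).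
Proof.
rewrite /pair_phase; case: (n ^ 4 <= p.2)%N; exact: measurable_funM.
Qed.

Lemma pair_formE p (al : R) (P : seq R) : (p.2 < p.1)%N -> (n ^ 4 <= p.1)%N -> size P = 5 ->
  dot (pair_form p) [seq al * x | x <- P] + pair_phase p al =
  al * (extend P p.1 - extend P p.2).
Proof.
move=> p21 p1; case: P => [|P0 [|P1 [|P2 [|P3 [|P4 [|]]]]]] //= _.
rewrite /pair_form p21 /pair_phase /extend ltnNge p1 /=; rewrite ltnNge.
case: ifP => _ /=; rewrite /block_elem /=; last by ring.
rewrite !intrB; ring.
Qed.

Variables (A r : R).
Hypothesis A0 : 0 < A.
Hypothesis r0 : 0 < r.
(** Rules out wrap-around: when the linear part of two parallel forms is eliminated with multipliers
    below [Q], phases and errors together stay below 1, so the integer that remains is 0. *)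
Hypothesis small : 2 * Q%:R * (A * eps * (4 * Q%:R ^+ 2)) + 2 * Q%:R * r <= 1 / 2.

Lemma sqnorm_le m : (m < M)%N -> (sqnorm n m)%:R <= 4 * Q%:R ^+ 2 :> R.
Proof.
move=> mM; rewrite -natrX -natrM ler_nat /sqnorm.
apply: (@leq_trans (\sum_(i < 4) Q ^ 2)).
  by apply: leq_sum => i _; rewrite leq_exp2r// ltnW// digit_lt.
by rewrite sum_nat_const card_ord.
Qed.

(** This is the [chi] of the variance bound: the quantifier over [l] removes the frequencies. *)
Definition shared_near (p p' : nat * nat) (al : R) : Prop :=
  exists l, dist_int (dot (pair_form p) l + pair_phase p al) < r /\
            dist_int (dot (pair_form p') l + pair_phase p' al) < r.

(** Digits are integer combinations of the quotients, so digit differences inherit the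
    proportionality. As [m' < m] and [l' < l], the multipliers [p] and [q] have the same sign; it is
    moved into [ze], leaving positive [a] and [b]. *)
Lemma parallel_new_new m m' l l' : (m' < m)%N -> (l' < l)%N -> (N <= m')%N -> (N <= l')%N ->
  parallel (pair_form (m, m')) (pair_form (l, l')) ->
  exists (a b : nat) (ze : nat -> int), [/\ (0 < a)%N, (0 < b)%N,
    forall i, (i < 4)%N -> (digit n i m)%:Z = (digit n i m')%:Z + a%:Z * ze i,
    forall i, (i < 4)%N -> (digit n i l)%:Z = (digit n i l')%:Z + b%:Z * ze i &
    exists sg z : int, exists zs, [/\ sg ^+ 2 = 1,
      pair_form (m, m') = [seq sg * a%:Z * x | x <- z :: zs] &
      pair_form (l, l') = [seq sg * b%:Z * x | x <- z :: zs]]].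
Proof.
move=> mm ll Nm Nl; rewrite /pair_form /= mm ll Nm Nl.
move=> [p [q [zs [h1 h2]]]].
have := congr1 size h1; rewrite size_map => /esym.
case: zs h1 h2 => [|z [|z0 [|z1 [|z2 [|z3 [|]]]]]] //=.
move=> [pz e0 e1 e2 e3] [qz f0 f1 f2 f3] _.
pose zs := [:: z0; z1; z2; z3].
pose sg := Num.sg z0.
have mm0 : 0 < p * z0 by rewrite -e0 subr_gt0 ltz_nat.
have ll0 : 0 < q * z0 by rewrite -f0 subr_gt0 ltz_nat.
have z00 : z0 != 0 by apply/eqP => z00; rewrite z00 mulr0 ltxx in mm0.
have sg2 : sg * sg = 1 by rewrite -expr2 sqr_sg z00.
have pE : p = sg * `|p|.
  have : Num.sg (p * z0) = 1 by rewrite gtr0_sg.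
  rewrite sgrM => h; rewrite [LHS]numEsg; congr (_ * _).
  by rewrite /sg -[LHS]mulr1 -sg2 /sg mulrA h mul1r.
have qE : q = sg * `|q|.
  have : Num.sg (q * z0) = 1 by rewrite gtr0_sg.
  rewrite sgrM => h; rewrite [LHS]numEsg; congr (_ * _).
  by rewrite /sg -[LHS]mulr1 -sg2 /sg mulrA h mul1r.
have p0 : p != 0 by apply/eqP => p0; rewrite p0 mul0r ltxx in mm0.
have q0 : q != 0 by apply/eqP => q0; rewrite q0 mul0r ltxx in ll0.
exists `|p|%N, `|q|%N, (fun i => sg * (nth 0 zs i - n%:Z * nth 0 zs i.+1)); split.
- by rewrite absz_gt0.
- by rewrite absz_gt0.
- move=> i i4; rewrite !digit_quots// abszE mulrA [_ * sg]mulrC -pE.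
  have H j : nth 0 (quots n m) j = nth 0 (quots n m') j + p * nth 0 zs j.
    move: j => [|[|[|[|j]]]] /=; rewrite -?e0 -?e1 -?e2 -?e3 ?subrKC ?nth_nil ?mulr0 ?addr0//;
    ring.
  rewrite !H; ring.
- move=> i i4; rewrite !digit_quots// abszE mulrA [_ * sg]mulrC -qE.
  have H j : nth 0 (quots n l) j = nth 0 (quots n l') j + q * nth 0 zs j.
    move: j => [|[|[|[|j]]]] /=; rewrite -?f0 -?f1 -?f2 -?f3 ?subrKC ?nth_nil ?mulr0 ?addr0//;
    ring.
  rewrite !H; ring.
- exists sg, z, zs; rewrite !abszE -pE -qE /= -pz -qz -e0 -e1 -e2 -e3 -f0 -f1 -f2 -f3.
  by rewrite expr2.
Qed.

(** Since [|w + a zeta|^2 - |w|^2 = a (2 w . zeta + a |zeta|^2)], the combination [b] times the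
    first form minus [a] times the second kills the linear part and leaves [al eps a b X], with [X]
    the integer in the conclusion. *)
Lemma near_new_new m m' l l' (a b : nat) (ze : nat -> int) (sg z : int) (zs : seq int) al :
  (0 < a < Q)%N -> (0 < b < Q)%N ->
  (m < M)%N -> (m' < M)%N -> (l < M)%N -> (l' < M)%N -> (N <= m')%N -> (N <= l')%N ->
  (forall i, (i < 4)%N -> (digit n i m)%:Z = (digit n i m')%:Z + a%:Z * ze i) ->
  (forall i, (i < 4)%N -> (digit n i l)%:Z = (digit n i l')%:Z + b%:Z * ze i) ->
  sg ^+ 2 = 1 ->
  pair_form (m, m') = [seq sg * a%:Z * x | x <- z :: zs] ->
  pair_form (l, l') = [seq sg * b%:Z * x | x <- z :: zs] ->
  A^-1 <= `|al| <= A ->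
  shared_near (m, m') (l, l') al ->
  `|(2 * (\sum_(i < 4) ze i * ((digit n i m')%:Z - (digit n i l')%:Z)) +
      (a%:Z - b%:Z) * (\sum_(i < 4) ze i ^+ 2))%:~R| * (minn a b)%:R < 2 * r * A / eps.
Proof.
move=> /andP[a0 aQ] /andP[b0 bQ] mM m'M lM l'M Nm' Nl' dm dl sg2 vm vl /andP[alA Aal].
set X := (X in `|X%:~R|).
move=> [y []]; rewrite vm vl !dot_scale; set Y := dot (z :: zs) y.
rewrite /pair_phase /= -/N Nm' Nl'.
have sqE c k k' : (forall i, (i < 4)%N -> (digit n i k)%:Z = (digit n i k')%:Z + c%:Z * ze i) ->
   (sqnorm n k)%:R - (sqnorm n k')%:R =
   (c%:Z * (2 * (\sum_(i < 4) ze i * (digit n i k')%:Z) + c%:Z * \sum_(i < 4) ze i ^+ 2))%:~R :> R.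
  move=> dk.
  have sqZ j : (sqnorm n j)%:Z = \sum_(i < 4) (digit n i j)%:Z ^+ 2.
    rewrite /sqnorm (big_morph Posz PoszD (erefl _)); apply: eq_bigr => i _.
    by rewrite -mulnn PoszM expr2.
  rewrite !pmulrn -intrB; congr _%:~R.
  rewrite !sqZ -sumrB.
  transitivity (\sum_(i < 4) c%:Z * (2 * (ze i * (digit n i k')%:Z) + c%:Z * ze i ^+ 2)).
    by apply: eq_bigr => i _; rewrite dk//; ring.
  by rewrite -mulr_sumr big_split /= -!mulr_sumr.
rewrite (sqE _ _ _ dm) (sqE _ _ _ dl).
set S := \sum_(i < 4) ze i ^+ 2.
set T := \sum_(i < 4) ze i * (digit n i m')%:Z; set T' := \sum_(i < 4) ze i * (digit n i l')%:Z.
have XE : X = 2 * (T - T') + (a%:Z - b%:Z) * S.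
  rewrite /X -/S; congr (2 * _ + _).
  by rewrite /T /T' -sumrB; apply: eq_bigr => i _; rewrite mulrBr.
set c1 := al * _; set c2 := al * _.
move=> /dist_int_ltP[j1 hj1] /dist_int_ltP[j2 hj2].
have ra0 : 0 < a%:R :> R by rewrite ltr0n.
have rb0 : 0 < b%:R :> R by rewrite ltr0n.
have raQ : a%:R <= Q%:R :> R by rewrite ler_nat ltnW.
have rbQ : b%:R <= Q%:R :> R by rewrite ler_nat ltnW.
have al0 : 0 < `|al| by apply: lt_le_trans alA; rewrite invr_gt0.
have cE : b%:R * c1 - a%:R * c2 = al * eps * a%:R * b%:R * X%:~R.
  by rewrite /c1 /c2 XE !(intrM, intrD, intrB) -!pmulrn; ring.
have sqB k k' : (k < M)%N -> (k' < M)%N ->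
   `|(sqnorm n k)%:R - (sqnorm n k')%:R| <= 4 * Q%:R ^+ 2 :> R.
  move=> kM k'M; have := sqnorm_le kM; have := sqnorm_le k'M.
  have := ler0n R (sqnorm n k); have := ler0n R (sqnorm n k').
  by rewrite ler_norml; move=> *; apply/andP; split; lra.
have cB c : `|c| <= 4 * Q%:R ^+ 2 -> `|al * (eps * c)| <= A * eps * (4 * Q%:R ^+ 2).
  move=> hc; rewrite normrM normrM (gtr0_norm eps0) mulrA; apply: ler_pM => //.
    by rewrite mulr_ge0// ltW.
  by rewrite ler_pM2r.
have c1B : `|c1| <= A * eps * (4 * Q%:R ^+ 2).
  by have := cB _ (sqB _ _ mM m'M); rewrite (sqE _ _ _ dm).
have c2B : `|c2| <= A * eps * (4 * Q%:R ^+ 2).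
  by have := cB _ (sqB _ _ lM l'M); rewrite (sqE _ _ _ dl).
have E1 : `|b%:R * ((sg * a%:Z)%:~R * Y + c1 - j1%:~R)| < b%:R * r.
  by rewrite normrM (gtr0_norm rb0) ltr_pM2l.
have E2 : `|a%:R * ((sg * b%:Z)%:~R * Y + c2 - j2%:~R)| < a%:R * r.
  by rewrite normrM (gtr0_norm ra0) ltr_pM2l.
pose j := b%:Z * j1 - a%:Z * j2.
have jE : (b%:R * c1 - a%:R * c2) - j%:~R =
    b%:R * ((sg * a%:Z)%:~R * Y + c1 - j1%:~R) - a%:R * ((sg * b%:Z)%:~R * Y + c2 - j2%:~R).
  by rewrite /j !(intrM, intrB) -!pmulrn; ring.
have E3 : `|(b%:R * c1 - a%:R * c2) - j%:~R| < (a%:R + b%:R) * r.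
  by rewrite jE (le_lt_trans (ler_normB _ _))// mulrDl addrC ltrD.
have two (x : R) : 2 * x = x + x by ring.
have dB : `|b%:R * c1 - a%:R * c2| <= 2 * Q%:R * (A * eps * (4 * Q%:R ^+ 2)).
  apply: le_trans (ler_normB _ _) _; rewrite (normrM b%:R) (normrM a%:R) (gtr0_norm ra0) (gtr0_norm rb0).
  rewrite -mulrA two; apply: lerD; apply: ler_pM => //.
have j0 : j = 0.
  suff : `|j%:~R| < 1 :> R by exact: int_norm_lt1.
  have -> : j%:~R = (b%:R * c1 - a%:R * c2) - ((b%:R * c1 - a%:R * c2) - j%:~R) by ring.
  apply: le_lt_trans (ler_normB _ _) _.
  have : (a%:R + b%:R) * r <= 2 * Q%:R * r.
    by rewrite ler_pM2r//; lra.
  move: small dB E3; clear; set u := 2 * Q%:R * _; set v := 2 * Q%:R * r.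
  by move=> *; lra.
move: E3; rewrite j0 subr0 cE.
(* The error is [(a + b) r <= 2 max(a, b) r]; dividing by the maximum leaves only [min(a, b)] beside
   [X]. *)
have -> : al * eps * a%:R * b%:R * X%:~R = eps * (al * ((minn a b)%:R * (maxn a b)%:R) * X%:~R).
  have -> : (minn a b)%:R * (maxn a b)%:R = a%:R * b%:R :> R.
    by rewrite /minn /maxn; case: ifP => _; rewrite // mulrC.
  ring.
have mx0 : 0 < (maxn a b)%:R :> R by rewrite ltr0n leq_max a0.
have mn0 : 0 < (minn a b)%:R :> R by rewrite ltr0n leq_min a0.
have : a%:R + b%:R <= 2 * (maxn a b)%:R :> R.
  by rewrite two; apply: lerD; rewrite ler_nat leq_max leqnn ?orbT.
rewrite !normrM (gtr0_norm eps0) (gtr0_norm mn0) (gtr0_norm mx0).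
set x := `|X%:~R|; set mn := (minn a b)%:R; set mx := (maxn a b)%:R => hab h.
have x0 : 0 <= x by rewrite normr_ge0.
have h2 : eps * (`|al| * mn * x) * mx < 2 * r * mx.
  have : (a%:R + b%:R) * r <= 2 * mx * r by rewrite ler_pM2r.
  move: h; rewrite (_ : eps * (`|al| * (mn * mx) * x) = eps * (`|al| * mn * x) * mx); last by ring.
  rewrite (_ : 2 * mx * r = 2 * r * mx); last by ring.
  exact: lt_le_trans.
rewrite ltr_pM2r// in h2.
rewrite ltr_pdivlMr// -(ltr_pM2r al0).
apply: (@lt_le_trans _ _ (2 * r)).
  by move: h2; congr (_ < _); ring.
rewrite -[X in _ <= X]mulrA; apply: ler_peMr; first by rewrite mulr_ge0// ltW.
by rewrite -(mulfV (lt0r_neq0 A0)) ler_pM2l.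
Qed.

End Block.

Section PairSum.
Context {R : realType}.
Variables (n : nat) (eps : R) (xo : nat -> R).
Hypothesis n0 : (0 < n)%N.
Hypothesis eps0 : 0 < eps.
Variables (A r : R).
Hypothesis A0 : 0 < A.
Hypothesis r0 : 0 < r.
Let Q := (16 * n)%N.
Let M := (16 * n ^ 4)%N.
Hypothesis small : 2 * Q%:R * (A * eps * (4 * Q%:R ^+ 2)) + 2 * Q%:R * r <= 1 / 2.

Definition natpair (p : 'I_M * 'I_M) : nat * nat := (p.1 : nat, p.2 : nat).

Definition close_pairs (al : R) (x : ('I_M * 'I_M) * ('I_M * 'I_M)) : bool :=
  `[< parallel (pair_form n (natpair x.1)) (pair_form n (natpair x.2)) >] &&
  `[< shared_near n eps xo r (natpair x.1) (natpair x.2) al >].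

Definition new_pair (p : 'I_M * 'I_M) : bool := (p.2 < p.1)%N && (n ^ 4 <= p.2)%N.

Definition encodes (x : ('I_M * 'I_M) * ('I_M * 'I_M))
    (q : 'I_Q * 'I_Q * {ffun 'I_4 -> bool * 'I_Q} * {ffun 'I_4 -> 'I_Q} * {ffun 'I_4 -> 'I_Q}) :=
  let: (a, b, ze, w', w) := q in
  forall i : 'I_4, [/\ digit n i x.1.2 = w i, digit n i x.2.2 = w' i,
    (digit n i x.1.1)%:Z = (w i)%:Z + a%:Z * sgd (ze i) &
    (digit n i x.2.1)%:Z = (w' i)%:Z + b%:Z * sgd (ze i)].

Lemma encodes_inj x y q : encodes x q -> encodes y q -> x = y.
Proof.
case: q => [[[[a b] ze] w'] w]; case: x => [[m m'] [l l']]; case: y => [[p p'] [k k']] /= hx hy.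
have E (u v : 'I_M) : (forall i : 'I_4, digit n i u = digit n i v) -> u = v.
  by move=> h; apply: val_inj; exact: (digit_inj n0 h).
congr ((_, _), (_, _)); apply: E => i; have [h1 h2 h3 h4] := hx i; have [g1 g2 g3 g4] := hy i.
- by apply/eqP; rewrite -eqz_nat h3 g3.
- by rewrite h1 g1.
- by apply/eqP; rewrite -eqz_nat h4 g4.
- by rewrite h2 g2.
Qed.

Lemma close_new_pairs_encode al x : A^-1 <= `|al| <= A ->
  new_pair x.1 -> new_pair x.2 -> close_pairs al x ->
  exists2 q, collision (2 * r * A / eps) q & encodes x q.
Proof.
case: x => [[m m'] [l l']] hal /= /andP[mm Nm] /andP[ll Nl] /andP[/asboolP /= par /asboolP /= near].
have [a [b [ze [a0 b0 dm dl [sg [z [zs [sg2 vm vl]]]]]]]] := parallel_new_new n0 mm ll Nm Nl par.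
have dQ (i : nat) (k : 'I_M) : (digit n i k < Q)%N by apply: digit_lt.
have az i : (i < 4)%N -> (a * `|ze i| < Q)%N.
  move=> i4; have := dm i i4; have := dQ i m; have := dQ i m'.
  rewrite -(absz_nat a) -abszM => h1 h2 h3.
  have -> : a%:Z * ze i = (digit n i m)%:Z - (digit n i m')%:Z by rewrite h3 addrC addKr.
  by move: h1 h2; clear; move: (digit n i m) (digit n i m') Q => u v w; lia.
have bz i : (i < 4)%N -> (b * `|ze i| < Q)%N.
  move=> i4; have := dl i i4; have := dQ i l; have := dQ i l'.
  rewrite -(absz_nat b) -abszM => h1 h2 h3.
  have -> : b%:Z * ze i = (digit n i l)%:Z - (digit n i l')%:Z by rewrite h3 addrC addKr.
  by move: h1 h2; clear; move: (digit n i l) (digit n i l') Q => u v w; lia.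
(* Otherwise [m] and [m'] would have the same digits. A nonzero coordinate also bounds [a] and [b]
   by [Q]. *)
have [i0 zi0] : exists i : 'I_4, ze i != 0.
  apply: contrapT => hz.
  have mE : (m : nat) = m'.
    apply: (digit_inj n0) => i; apply/eqP; rewrite -eqz_nat dm//.
    have [->|zi] := eqVneq (ze i) 0; first by rewrite mulr0 addr0.
    by exfalso; apply: hz; exists i.
  by rewrite mE ltnn in mm.
have zi0' : (0 < `|ze i0|)%N by rewrite absz_gt0.
have aQ : (a < Q)%N by apply: leq_ltn_trans (az i0 (ltn_ord i0)); rewrite leq_pmulr.
have bQ : (b < Q)%N by apply: leq_ltn_trans (bz i0 (ltn_ord i0)); rewrite leq_pmulr.
have zQ (i : 'I_4) : (`|ze i| < Q)%N.
  by apply: leq_ltn_trans (az i (ltn_ord i)); rewrite leq_pmull.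
pose zf : {ffun 'I_4 -> bool * 'I_Q} := [ffun i : 'I_4 => (ze i < 0, Ordinal (zQ i))].
have sgdE i : sgd (zf i) = ze i.
  by rewrite /sgd ffunE /=; case: ltrP => h; lia.
have [i1 i1E] : exists i1 : 'I_4, maxabs zf = `|ze i1|%N.
  have := @bigop.eq_bigmax _ (fun i => ((zf i).2 : nat)); rewrite card_ord => /(_ isT)[i iE].
  by exists i; rewrite /maxabs iE ffunE.
pose w : {ffun 'I_4 -> 'I_Q} := [ffun i : 'I_4 => Ordinal (dQ i m')].
pose w' : {ffun 'I_4 -> 'I_Q} := [ffun i : 'I_4 => Ordinal (dQ i l')].
exists (Ordinal aQ, Ordinal bQ, zf, w', w).
  rewrite /collision /= a0 b0 i1E az// bz//=; apply/andP; split.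
    rewrite -i1E; apply: leq_trans zi0' _.
    by have := @leq_bigmax _ (fun i => ((zf i).2 : nat)) i0; rewrite ffunE.
  have aQ' : (0 < a < 16 * n)%N by rewrite a0.
  have bQ' : (0 < b < 16 * n)%N by rewrite b0.
  have := near_new_new n0 eps0 A0 r0 small aQ' bQ' (ltn_ord m) (ltn_ord m') (ltn_ord l) (ltn_ord l') Nm Nl dm dl sg2 vm vl hal near.
  congr (`|(2 * _ + _ * _)%:~R| * _ < _).
    by apply: eq_bigr => i _; rewrite sgdE !ffunE.
  by apply: eq_bigr => i _; rewrite sgdE.
by move=> i; rewrite /= sgdE !ffunE /=; split => //; [exact: dm|exact: dl].
Qed.

Lemma card_close_new_pairs al : A^-1 <= `|al| <= A ->
  (#|[pred x | new_pair x.1 && new_pair x.2 && close_pairs al x]| <=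
   #|[pred q | @collision R Q (2 * r * A / eps) q]|)%N.
Proof.
move=> hal; apply: (@card_le_rel _ _ _ _ encodes).
  move=> x /= /andP[/andP[n1 n2] c]; exact: close_new_pairs_encode c.
exact: encodes_inj.
Qed.

(** With a common new index, linear part and perturbation cancel in the difference, and the triangle
    inequality leaves a condition on two earlier elements. *)
Lemma shared_near_old p p' al : (p.2 < p.1)%N -> (p'.2 < p'.1)%N ->
  (p.2 < n ^ 4)%N -> (p'.2 < n ^ 4)%N -> p.1 = p'.1 ->
  shared_near n eps xo r p p' al -> dist_int (al * (xo p.2 - xo p'.2)) < 2 * r.
Proof.
move=> h1 h2 h3 h4 h5 [l].
rewrite /pair_form /pair_phase h1 h2 (ltn_geF h3) (ltn_geF h4) h5.
move=> [/dist_int_ltP[j1 hj1] /dist_int_ltP[j2 hj2]].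
apply/dist_int_ltP; exists (j2 - j1); rewrite intrB.
pose D := dot (1 :: quots n p'.1) l; rewrite -/D in hj1 hj2.
rewrite (_ : _ - _ = (D + al * (eps * (sqnorm n p'.1)%:R - xo p'.2) - j2%:~R) -
  (D + al * (eps * (sqnorm n p'.1)%:R - xo p.2) - j1%:~R)); last by ring.
rewrite (_ : 2 * r = r + r); last by ring.
by apply: le_lt_trans (ler_normB _ _) _; exact: ltrD.
Qed.

(** The leading coefficient is 1 for an old second index and 0 for a new one. Two leading 1s force
    equal multipliers, hence equal second coefficients [m] and [l]. *)
Lemma parallel_old m m' l l' : (m' < m)%N -> (l' < l)%N -> (m' < n ^ 4)%N ->
  parallel (pair_form n (m, m')) (pair_form n (l, l')) -> (l' < n ^ 4)%N /\ m = l.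
Proof.
move=> mm ll Nm [p [q [zs [h1 h2]]]]; move: h1 h2.
rewrite /pair_form /= mm ll [(n ^ 4 <= m')%N]leqNgt Nm /=.
case: zs => [//|z [//|z0 zs]] [/esym pz ez _].
have p0 : p != 0 by apply/eqP => p0; move: pz; rewrite p0 mul0r.
have z_neq0 : z != 0 by apply/eqP => z0'; move: pz; rewrite z0' mulr0.
case: leqP => _ [].
  move=> /esym/eqP; rewrite mulf_eq0 (negbTE z_neq0) orbF => /eqP -> /eqP.
  by rewrite mul0r subr_eq0 eqz_nat => /eqP E; rewrite E ltnn in ll.
move=> qz el _; split => //; apply/eqP; rewrite -eqz_nat.
have pq : p = q by apply: (mulIf z_neq0); rewrite pz -qz.
by rewrite ez el pq.
Qed.

Variable V : pred ('I_M * 'I_M).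
Hypothesis V1 : forall p, V p -> (0 < p.2)%N /\ (p.2 < p.1)%N.

(** Mixed pairs are never parallel. New pairs are counted by collisions; for old ones the common
    first index has at most [M] values and the two old indices satisfy [shared_near_old]. *)
Lemma close_pair_sum al : A^-1 <= `|al| <= A ->
  \sum_(p <- enum V) \sum_(p' <- enum V) (close_pairs al (p, p'))%:R <=
  #|[pred q | @collision R Q (2 * r * A / eps) q]|%:R +
  M%:R * \sum_(u < n ^ 4 | (0 < u)%N) \sum_(v < n ^ 4 | (0 < v)%N)
     near_int (2 * r) (al * (xo u - xo v)) :> R.
Proof.
move=> hal.
pose g (u v : nat) : R := near_int (2 * r) (al * (xo u - xo v)).
have g0 u v : 0 <= g u v by exact: near_int_ge0.
pose F (m u l v : nat) : R :=
  if [&& (0 < u)%N, (u < n ^ 4)%N, (0 < v)%N, (v < n ^ 4)%N & m == l] then g u v else 0.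
have F0 m u l v : 0 <= F m u l v by rewrite /F; case: ifP.
rewrite big_enum /=; under eq_bigr do rewrite big_enum /=.
apply: (@le_trans _ _ (\sum_p \sum_p' (((new_pair p && new_pair p' && close_pairs al (p, p')))%:R
     + F p.1 p.2 p'.1 p'.2))).
  rewrite big_mkcond; apply: ler_sum => p _.
  have nn0 p' : 0 <= (new_pair p && new_pair p' && close_pairs al (p, p'))%:R + F p.1 p.2 p'.1 p'.2.
    by rewrite addr_ge0.
  case: ifP => [Vp|_]; last by apply: sumr_ge0.
  rewrite big_mkcond; apply: ler_sum => p' _; case: ifP => [Vp'|_]; last exact: nn0.
  have [p0 p21] := V1 Vp; have [p0' p21'] := V1 Vp'.
  case cp: (close_pairs al (p, p')); last by rewrite addr_ge0.
  move: cp => /andP[/asboolP par /asboolP near].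
  have [Np|pN] := leqP (n ^ 4) p.2.
    have [Np'|pN'] := leqP (n ^ 4) p'.2.
      by rewrite /new_pair p21 p21' Np Np' /= lerDl.
    have par' : parallel (pair_form n (p'.1 : nat, p'.2 : nat)) (pair_form n (p.1 : nat, p.2 : nat)).
      by case: par => [a [b [z [h1 h2]]]]; exists b, a, z.
    by have [] := parallel_old p21' p21 pN' par'; rewrite ltnNge Np.
  have [pN' mE] := parallel_old p21 p21' pN par.
  rewrite /F p0 p0' pN pN' mE eqxx /g /near_int.
  rewrite (@shared_near_old (natpair p) (natpair p') al p21 p21' pN pN' mE near) lerDr.
  by [].
have -> : \sum_(p : 'I_M * 'I_M) \sum_(p' : 'I_M * 'I_M) (((new_pair p && new_pair p' && close_pairs al (p, p')))%:R + F p.1 p.2 p'.1 p'.2)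
    = \sum_(p : 'I_M * 'I_M) \sum_(p' : 'I_M * 'I_M) ((new_pair p && new_pair p' && close_pairs al (p, p')))%:R +
      \sum_(p : 'I_M * 'I_M) \sum_(p' : 'I_M * 'I_M) F p.1 p.2 p'.1 p'.2.
  by rewrite -big_split; apply: eq_bigr => p _; rewrite big_split.
apply: lerD.
  rewrite pair_bigA /= -natr_sum ler_nat.
  apply: leq_trans (card_close_new_pairs hal).
  rewrite -sum1_card [X in (_ <= X)%N]big_mkcond /=; apply: leq_sum => -[p p'] _ /=.
  by rewrite unfold_in /=; case: (_ && _).
rewrite -(pair_bigA _ (fun m u : 'I_M => \sum_(p' : 'I_M * 'I_M) F m u p'.1 p'.2)) /=.
have N_M : (n ^ 4 <= M)%N by rewrite /M leq_pmull.
set W := \sum_(u < n ^ 4 | _) _.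
have -> : M%:R * W = \sum_(m < M) W by rewrite sumr_const card_ord mulr_natl.
apply: ler_sum => m _; rewrite /W.
rewrite (big_ord_widen_cond _ (fun u => (0 < u)%N) (fun u => \sum_(v < n ^ 4 | (0 < v)%N) g u v) N_M).
rewrite [leRHS]big_mkcond; apply: ler_sum => u _.
rewrite -(pair_bigA _ (fun l v : 'I_M => F m u l v)) /= (bigD1 m)//= [X in _ + X]big1 ?addr0; last first.
  move=> l lm; apply: big1 => v _; rewrite /F ifF//.
  by rewrite (_ : (m == l :> nat) = false) ?andbF//; apply/eqP => /val_inj E; rewrite E eqxx in lm.
case: ifP => [/andP[u0 uN]|hu]; last first.
  apply: sumr_le0 => v _; rewrite /F; case: ifP => // /and5P[h1 h2 _ _ _].
  by rewrite h1 h2 in hu.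
rewrite (big_ord_widen_cond _ (fun v => (0 < v)%N) (fun v => g u v) N_M).
rewrite [leRHS]big_mkcond; apply: ler_sum => v _; rewrite /F u0 uN eqxx andbT /=.
by case: ifP.
Qed.

End PairSum.

(** * Integration of the variance over an annulus *)

Section BlockVariance.
Context {R : realType}.
Notation mu := (@lebesgue_measure R).

Definition annulus (A : R) : set R := [set al | A^-1 <= `|al| <= A].

Lemma measurable_annulus A : measurable (annulus A).
Proof.
rewrite (_ : annulus A = (fun x : R => `|x|) @^-1` `[A^-1, A]%classic); last first.
  by apply/seteqP; split => x /=; rewrite /annulus /= in_itv.
by rewrite -[X in measurable X]setTI; exact: normr_measurable.
Qed.

Lemma annulus_sub A : annulus A `<=` `[- A, A]%classic.
Proof. by move=> x /= /andP[_]; rewrite ler_norml in_itv. Qed.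

Lemma measure_annulus A : 0 < A -> (mu (annulus A) <= (2 * A)%:E)%E.
Proof.
move=> A0; apply: (@le_trans _ _ (mu `[- A, A]%classic)).
  by apply: le_measure; rewrite ?inE//; [exact: measurable_annulus|exact: annulus_sub].
rewrite lebesgue_measure_itv /= lte_fin ifT; last lra.
by rewrite -EFinB lee_fin; lra.
Qed.

(** [[-A, A]] is enlarged to a whole number of periods of [b al], at a cost in length of at most
    [1 / |b| <= 1]. *)
Lemma integral_annulus_near_int A r b : 0 < A -> 0 < r -> 2 * r <= 1 / 2 -> 1 <= `|b| ->
  (\int[mu]_(al in annulus A) (near_int (2 * r) (al * b))%:E <=
   ((2 * A + 1) * (4 * r))%:E)%E.
Proof.
move=> A0 r0 r2 b1.
have mN (c : R) : measurable_fun [set: R] (fun x => (near_int (2 * r) (x * c))%:E).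
  apply/measurable_EFinP; apply: measurableT_comp; first exact: measurable_near_int.
  exact: measurable_funM.
have mN1 : measurable_fun [set: R] (fun x => (near_int (2 * r) x)%:E).
  by apply/measurable_EFinP; exact: measurable_near_int.
have nb0 : 0 < `|b| by lra.
pose k := (Num.truncn (2 * A * `|b|)).+1.
have Ab0 : 0 <= 2 * A * `|b| by rewrite mulr_ge0//; lra.
have /andP[k1 k2] : (2 * A * `|b| < k%:R) && (k%:R <= 2 * A * `|b| + 1).
  by have /andP[h1 h2] := Num.Theory.truncn_itv Ab0; rewrite h2 /k -natr1 lerD2r.
have L1 : 2 * A < k%:R / `|b| by rewrite ltr_pdivlMr.
have L2 : k%:R / `|b| <= 2 * A + 1.
  rewrite ler_pdivrMr// mulrDl mul1r; apply: le_trans k2 _; lra.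
apply: (@le_trans _ _ (\int[mu]_(al in `[(- A)%R, (- A + k%:R / `|b|)%R[) (near_int (2 * r) (b * al + 0)%R)%:E)%E).
  under [leRHS]eq_integral do rewrite addr0 [b * _]mulrC.
  apply: ge0_subset_integral => //.
  - exact: measurable_annulus.
  - exact: (measurable_funTS (mN b)).
  - by move=> x _; rewrite lee_fin near_int_ge0.
  - by move=> x /annulus_sub /=; rewrite !in_itv/= => /andP[-> ?] /=; lra.
rewrite (@periodic_integral_affine _ (fun x => (near_int (2 * r) x)%:E) mN1 _ _ _ _ _ _ k)//.
- rewrite unit_integral_near_int; [|lra|lra].
  rewrite -EFinM lee_fin; have : 0 < 4 * r by lra.
  move: L2; set u := _ / _ => *; nra.
- by move=> x; rewrite lee_fin near_int_ge0.
- by move=> x; rewrite near_int_periodic.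
- lra.
- by rewrite -normr_gt0.
- by rewrite mulrC divfK// gt_eqF.
Qed.

Lemma measurable_sum_cond (I : Type) (s : seq I) (P : pred I) (h : I -> R -> R) :
  (forall i, measurable_fun [set: R] (h i)) ->
  measurable_fun [set: R] (fun x => \sum_(i <- s | P i) h i x).
Proof.
move=> mh; under eq_fun do rewrite big_mkcond /=.
by apply: measurable_sum => i; case: (P i).
Qed.

Lemma integral_block_variance (n : nat) (eps A r : R) (xo : nat -> R)
    (V : pred ('I_(16 * n ^ 4) * 'I_(16 * n ^ 4))) (Cc : R) :
  (0 < n)%N -> 0 < eps -> 0 < A -> 0 < r ->
  2 * (16 * n)%:R * (A * eps * (4 * (16 * n)%:R ^+ 2)) + 2 * (16 * n)%:R * r <= 1 / 2 ->
  (forall p, V p -> (0 < p.2)%N /\ (p.2 < p.1)%N) ->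
  (forall u v, (0 < u)%N -> (u < v)%N -> (v < n ^ 4)%N -> xo u + 1 <= xo v) ->
  #|[pred q | @collision R (16 * n) (2 * r * A / eps) q]|%:R <= Cc ->
  (\int[mu]_(al in annulus A) mean 5 (fun l => ((near_count (enum V)
      (fun p => pair_form n (natpair p)) (fun p => pair_phase n eps xo (natpair p)) r al l
        - 2 * r * #|V|%:R) ^+ 2)%:E) <=
   (2 * r * (2 * A * Cc + (16 * n ^ 4)%:R * ((n ^ 4)%:R * (2 * A) +
        (n ^ 4)%:R ^+ 2 * ((2 * A + 1) * (4 * r)))))%:E)%E.
Proof.
move=> n0 eps0 A0 r0 small V1 gap hCc.
set M := (16 * n ^ 4)%N; set N := (n ^ 4)%N.
have Q1 : 1 <= (16 * n)%:R :> R by rewrite ler1n; lia.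
have r2 : 2 * r <= 1 / 2.
  apply: le_trans small; apply: (@le_trans _ _ (2 * (16 * n)%:R * r)).
    by rewrite ler_pM2r//; lra.
  by rewrite lerDr !mulr_ge0// ?exprn_ge0// ltW.
pose v p := pair_form n (@natpair n p).
pose c p := pair_phase n eps xo (@natpair n p).
pose g al : R := Cc + M%:R * \sum_(u < N | (0 < u)%N) \sum_(w < N | (0 < w)%N)
     near_int (2 * r) (al * (xo u - xo w)).
have mN (b : R) : measurable_fun [set: R] (fun x => near_int (2 * r) (x * b)).
  apply: measurableT_comp; first exact: measurable_near_int.
  exact: measurable_funM.
have mg : measurable_fun [set: R] g.
  apply: measurable_funD => //; apply: measurable_funM => //.
  apply: measurable_sum_cond => u; exact: measurable_sum_cond.
have Cc0 : 0 <= Cc by apply: le_trans hCc.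
have g0 al : 0 <= g al.
  apply: addr_ge0 => //; apply: mulr_ge0 => //; apply: sumr_ge0 => u _.
  by apply: sumr_ge0 => w _; exact: near_int_ge0.
have mc p : measurable_fun setT (c p) by exact: measurable_pair_phase.
have mD : seq_measurable 5 (fun al l => ((near_count (enum V) v c r al l - 2 * r * #|V|%:R) ^+ 2)%:E).
  move=> dS S phi xs sxs mphi mxs; apply/measurable_EFinP.
  apply: measurable_funX; apply: measurable_funB => //.
  apply: measurable_sum => p.
  by apply/measurable_EFinP; apply: (seq_measurable_near_int _ _ (mc p)).
apply: (@le_trans _ _ (\int[mu]_(al in annulus A) (2 * r * g al)%:E)%E).
  apply: ge0_le_integral => //.
  - exact: measurable_annulus.
  - by move=> al _; apply: mean_ge0 => l; rewrite lee_fin sqr_ge0.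
  - by apply: measurable_funTS; apply: (mean_measurable mD) => t l; rewrite lee_fin sqr_ge0.
  - by apply: measurable_funTS; apply/measurable_EFinP; exact: measurable_funM.
  move=> al alA.
  have := @ideal_variance R _ _ _ (enum V) 5 v c r r0 _ _ _ mc
    (fun p p' al => `[< shared_near n eps xo r (natpair p) (natpair p') al >]) _ al.
  rewrite -cardE => H; apply: le_trans (H _ _ _ _) _.
  - by lra.
  - by move=> p; exact: size_pair_form.
  - by move=> p; exact: pair_form_neq0.
  - by move=> p p' t l _ h1 h2; apply/asboolP; exists l.
  rewrite lee_fin ler_pM2l ?mulr_gt0//.
  apply: le_trans (close_pair_sum xo n0 eps0 A0 r0 small V1 alA) _.
  by rewrite lerD2r.
rewrite (_ : (fun al => _) = fun al => (2 * r)%:E * (g al)%:E)%E; last first.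
  by apply/funext => al; rewrite EFinM.
rewrite ge0_integralZl//; first last.
- by rewrite lee_fin mulr_ge0// ltW.
- by move=> al _; rewrite lee_fin.
- by apply: measurable_funTS; apply/measurable_EFinP.
- exact: measurable_annulus.
rewrite [leRHS]EFinM; apply: lee_wpmul2l; first by rewrite lee_fin mulr_ge0// ltW.
have mE (b : R) : measurable_fun [set: R] (fun x => (near_int (2 * r) (x * b))%:E).
  by apply/measurable_EFinP; exact: mN.
have nE0 x : (0 <= (near_int (2 * r) x)%:E)%E by rewrite lee_fin near_int_ge0.
(* Distinct old elements are at least 1 apart, so the integral is [O(r)]; the diagonal takes the
   full measure of the annulus but has only [N] terms. *)
have pair_le (u w : nat) : (0 < u)%N -> (0 < w)%N -> (u < N)%N -> (w < N)%N ->
    (\int[mu]_(al in annulus A) (near_int (2 * r) (al * (xo u - xo w)))%:E <=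
     ((if u == w then 2 * A else 0) + (2 * A + 1) * (4 * r))%:E)%E.
  move=> u0 w0 uN wN; have pos : 0 <= (2 * A + 1) * (4 * r) by nra.
  have [uw|uw|uw] := ltngtP u w.
  - rewrite add0r; apply: integral_annulus_near_int => //.
    by have := gap u w u0 uw wN => ?; rewrite ler0_norm; lra.
  - rewrite add0r; apply: integral_annulus_near_int => //.
    by have := gap w u w0 uw uN => ?; rewrite ger0_norm; lra.
  - apply: (@le_trans _ _ (\int[mu]_(al in annulus A) (cst 1 al))%E).
      apply: ge0_le_integral => //.
      + exact: measurable_annulus.
      + exact: (measurable_funTS (mE _)).
      + by move=> x _; rewrite lee_fin /near_int; case: (_ < _)%R.
    rewrite integral_cst//; last exact: measurable_annulus.
    rewrite mul1e; apply: le_trans (measure_annulus A0) _.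
    by rewrite lee_fin lerDl.
rewrite /g; under eq_integral do rewrite EFinD.
rewrite ge0_integralD//; first last.
- apply: measurable_funTS; apply/measurable_EFinP; apply: measurable_funM => //.
  apply: measurable_sum_cond => u; exact: measurable_sum_cond.
- move=> al _; rewrite lee_fin; apply: mulr_ge0 => //; apply: sumr_ge0 => u _.
  by apply: sumr_ge0 => w _; exact: near_int_ge0.
- exact: measurable_annulus.
rewrite EFinD; apply: leeD.
  rewrite integral_cst//; last exact: measurable_annulus.
  rewrite muleC EFinM; apply: lee_wpmul2r; first by rewrite lee_fin.
  exact: measure_annulus.
under eq_integral do rewrite EFinM.
rewrite ge0_integralZl//; first last.
- move=> al _; rewrite lee_fin; apply: sumr_ge0 => u _.
  by apply: sumr_ge0 => w _; exact: near_int_ge0.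
- apply: measurable_funTS; apply/measurable_EFinP.
  apply: measurable_sum_cond => u; exact: measurable_sum_cond.
- exact: measurable_annulus.
rewrite [leRHS]EFinM; apply: lee_wpmul2l; first by rewrite lee_fin.
have -> : (\int[mu]_(al in annulus A) (\sum_(u < N | (0 < u)%N) \sum_(w < N | (0 < w)%N)
     near_int (2 * r) (al * (xo u - xo w)))%:E =
   \sum_(u <- enum [pred u : 'I_N | (0 < u)%N]) \sum_(w <- enum [pred w : 'I_N | (0 < w)%N])
     \int[mu]_(al in annulus A) (near_int (2 * r) (al * (xo u - xo w)))%:E)%E.
  transitivity (\int[mu]_(al in annulus A) (\sum_(u <- enum [pred u : 'I_N | (0 < u)%N])
     \sum_(w <- enum [pred w : 'I_N | (0 < w)%N]) (near_int (2 * r) (al * (xo u - xo w)))%:E))%E.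
    apply: eq_integral => al _; rewrite -sumEFin big_enum; apply: eq_bigr => u _.
    by rewrite -sumEFin big_enum.
  rewrite ge0_integral_sum//; first last.
  - by move=> u al _; apply: sume_ge0.
  - by move=> u; apply: measurable_funTS; apply: emeasurable_sum => w; exact: mE.
  - exact: measurable_annulus.
  apply: eq_bigr => u _; rewrite ge0_integral_sum//.
  - exact: measurable_annulus.
  - by move=> w; exact: (measurable_funTS (mE _)).
apply: (@le_trans _ _ (\sum_(u < N) \sum_(w < N) ((if u == w then 2 * A else 0) + (2 * A + 1) * (4 * r))%:E)%E).
  rewrite big_enum big_mkcond; apply: lee_sum => u _.
  have pos (w : 'I_N) : (0 <= ((if u == w then 2 * A else 0) + (2 * A + 1) * (4 * r))%:E)%E.
    by rewrite lee_fin addr_ge0//; [case: ifP => _ //; lra | nra].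
  case: ifP => [u0|_]; last exact: sume_ge0.
  rewrite big_enum big_mkcond; apply: lee_sum => w _; case: ifP => // w0.
  exact: pair_le.
under eq_bigr do rewrite sumEFin.
rewrite sumEFin lee_fin.
rewrite (eq_bigr (fun=> 2 * A + N%:R * ((2 * A + 1) * (4 * r)))); last first.
  move=> u _; rewrite big_split /= -big_mkcond /= (big_pred1 u); last by move=> w; rewrite eq_sym.
  by rewrite sumr_const card_ord [X in _ = _ + X]mulr_natl.
rewrite sumr_const card_ord -[X in X <= _]mulr_natl mulrDr expr2 -[X in _ <= _ + X]mulrA.
exact: lexx.
Qed.

End BlockVariance.

Section BlockVarianceBound.
Context {R : realType}.
Notation mu := (@lebesgue_measure R).

(** Here [x] is [n], [q x] is [Q], [r = s / x^4] and [eps = k L / x^6]. The collision window has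
    order [x^2 / L], so the three contributions are [x^8 / L], [x^7] and, from old pairs, [x^4]. *)
Lemma block_bound_algebra (Cc q A s k : R) : 0 <= Cc -> 0 < q -> 0 < A -> 0 < s -> 0 < k ->
  exists2 C : R, 0 < C & forall x L, 1 <= x -> 0 < L ->
  2 * (s / x ^+ 4) * (2 * A * (Cc * (q * x) ^+ 7 *
      (2 * (s / x ^+ 4) * A / (k * L / x ^+ 6) * (q * x) ^+ 3 + (q * x) ^+ 4)) +
    q * x ^+ 4 * (x ^+ 4 * (2 * A) + (x ^+ 4) ^+ 2 * ((2 * A + 1) * (4 * (s / x ^+ 4)))))
  <= C * x ^+ 8 * (L^-1 + x^-1).
Proof.
move=> Cc0 q0 A0 s0 k0.
pose c1 := 2 * s * (2 * A * (Cc * q ^+ 7 * (2 * s * A / k * q ^+ 3))).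
pose c2 := 2 * s * (2 * A * (Cc * q ^+ 7 * q ^+ 4)).
pose c3 := 2 * s * q * (2 * A + (2 * A + 1) * (4 * s)).
have c10 : 0 <= c1 by rewrite /c1 !mulr_ge0 ?exprn_ge0 ?invr_ge0// ltW.
have c20 : 0 <= c2 by rewrite /c2 !mulr_ge0 ?exprn_ge0 ?invr_ge0// ltW.
have c30 : 0 <= c3.
  by rewrite /c3 mulr_ge0// ?addr_ge0 ?mulr_ge0 ?ltW// ?addr_gt0 ?mulr_gt0.
exists (c1 + c2 + c3 + 1); first by rewrite ltr_pwDr// !addr_ge0.
move=> x L x1 L0.
have x0 : 0 < x by lra.
have -> : 2 * (s / x ^+ 4) * (2 * A * (Cc * (q * x) ^+ 7 *
      (2 * (s / x ^+ 4) * A / (k * L / x ^+ 6) * (q * x) ^+ 3 + (q * x) ^+ 4)) +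
    q * x ^+ 4 * (x ^+ 4 * (2 * A) + (x ^+ 4) ^+ 2 * ((2 * A + 1) * (4 * (s / x ^+ 4))))) =
    c1 * (x ^+ 8 / L) + c2 * x ^+ 7 + c3 * x ^+ 4.
  rewrite /c1 /c2 /c3; field.
  by rewrite !gt_eqF.
have x7 : x ^+ 8 / x = x ^+ 7 by rewrite exprSr mulfK// gt_eqF.
have x47 : x ^+ 4 <= x ^+ 7 by apply: ler_weXn2l.
rewrite -mulrA mulrDr x7.
have y0 : 0 <= x ^+ 8 / L by rewrite divr_ge0 ?exprn_ge0 ?ltW.
have z0 : 0 <= x ^+ 7 by rewrite exprn_ge0// ltW.
move: y0 z0 x47 c10 c20 c30; move: (x ^+ 8 / L) (x ^+ 7) (x ^+ 4) c1 c2 c3; clear.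
move=> y z w c1 c2 c3 *; nra.
Qed.

(** The left side is of order [L / x^3 + 1 / x^3], at most a constant times [x^-2] because
    [L <= x]. *)
Lemma block_small_algebra (q A s k : R) : 0 < q -> 0 < A -> 0 < s -> 0 < k ->
  exists2 x1 : R, 1 <= x1 & forall x L, x1 <= x -> 0 < L -> L <= x ->
  2 * (q * x) * (A * (k * L / x ^+ 6) * (4 * (q * x) ^+ 2)) + 2 * (q * x) * (s / x ^+ 4) <= 1 / 2.
Proof.
move=> q0 A0 s0 k0.
pose c := 8 * A * k * q ^+ 3 + 2 * q * s.
have c0 : 0 < c by rewrite addr_gt0 ?mulr_gt0 ?exprn_gt0.
exists (2 * c + 1); first lra.
move=> x L hx L0 Lx.
have x1 : 1 <= x by lra.
have x0 : 0 < x by lra.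
have -> : 2 * (q * x) * (A * (k * L / x ^+ 6) * (4 * (q * x) ^+ 2)) + 2 * (q * x) * (s / x ^+ 4) =
    (8 * A * k * q ^+ 3 * L + 2 * q * s) / x ^+ 3.
  by field; rewrite gt_eqF.
rewrite ler_pdivrMr ?exprn_gt0//.
have : 8 * A * k * q ^+ 3 * L + 2 * q * s <= c * x.
  rewrite /c [X in _ <= X]mulrDl; apply: lerD.
    by rewrite ler_pM2l// !mulr_gt0// exprn_gt0.
  by rewrite ler_peMr// mulr_ge0 ?mulr_ge0// ltW.
move=> /le_trans; apply.
have : x ^+ 2 <= x ^+ 3 by apply: ler_weXn2l.
rewrite expr2; nra.
Qed.

Lemma block_variance_bound (A s k : R) : 0 < A -> 0 < s -> 0 < k ->
  exists2 C : R, 0 < C & exists n1 : nat, forall (n : nat) (L : R) (xo : nat -> R)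
    (V : pred ('I_(16 * n ^ 4) * 'I_(16 * n ^ 4))),
  (n1 <= n)%N -> (0 < n)%N -> 0 < L -> L <= n%:R ->
  (forall p, V p -> (0 < p.2)%N /\ (p.2 < p.1)%N) ->
  (forall u v, (0 < u)%N -> (u < v)%N -> (v < n ^ 4)%N -> xo u + 1 <= xo v) ->
  (\int[mu]_(al in annulus A) mean 5 (fun l => ((near_count (enum V)
      (fun p => pair_form n (natpair p))
      (fun p => pair_phase n (k * L / n%:R ^+ 6) xo (natpair p)) (s / n%:R ^+ 4) al l
        - 2 * (s / n%:R ^+ 4) * #|V|%:R) ^+ 2)%:E) <=
   (C * n%:R ^+ 8 * (L^-1 + n%:R^-1))%:E)%E.
Proof.
move=> A0 s0 k0.
have [Cc Cc0 hCc] := card_collision_le R.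
have [q [qE q0]] : exists q : R, q = 16%:R /\ 0 < q by exists 16%:R.
have [C C0 hC] := block_bound_algebra Cc0 q0 A0 s0 k0.
have [x1 x11 hx1] := block_small_algebra q0 A0 s0 k0.
exists C => //; exists (Num.truncn x1).+1 => n L xo V hn n0 L0 Ln V1 gap.
have nx1 : x1 <= n%:R.
  by apply: le_trans (ltW (Num.Theory.truncnS_gt x1)) _; rewrite ler_nat.
have x0 : 0 < n%:R :> R by rewrite ltr0n.
have eps0 : 0 < k * L / n%:R ^+ 6 by rewrite divr_gt0 ?mulr_gt0 ?exprn_gt0.
have r0 : 0 < s / n%:R ^+ 4 by rewrite divr_gt0 ?exprn_gt0.
have QE : (16 * n)%:R = q * n%:R :> R by rewrite natrM qE.
apply: le_trans (@integral_block_variance R n _ A _ xo V _ n0 eps0 A0 r0 _ V1 gap _) _.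
- by rewrite QE; exact: hx1.
- apply: hCc; first by rewrite muln_gt0.
  by rewrite ltW// divr_gt0// mulr_gt0// mulr_gt0.
rewrite lee_fin QE [(16 * n ^ 4)%:R]natrM !natrX -qE; apply: hC => //; lra.
Qed.

End BlockVarianceBound.

(** * Choice of the frequencies *)

Section Stage.
Context {R : realType}.
Notation mu := (@lebesgue_measure R).

Lemma near_int_periodicz r (j : int) (x : R) : near_int r (x + j%:~R) = near_int r x.
Proof.
have := @periodicz R (fun x => (near_int r x)%:E) _ j x.
by move=> /(_ (fun x => congr1 EFin (near_int_periodic r x))) [].
Qed.

Lemma dot_shift v l1 (x : R) l2 : exists j : int,
  dot v (l1 ++ (x + 1) :: l2) = dot v (l1 ++ x :: l2) + j%:~R.
Proof.
elim: l1 v => [|y l1 IH] [|a v] /=.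
- by exists 0; rewrite addr0.
- by exists a; ring.
- by exists 0; rewrite addr0.
- by have [j ->] := IH v; exists j; rewrite addrA.
Qed.

(** The cut at [th * n^4] provides for initial segments that end inside a block. The smaller index
    may lie in any earlier block. *)
Definition block_pairs (n : nat) (th : R) : pred ('I_(16 * n ^ 4) * 'I_(16 * n ^ 4)) :=
  fun p => [&& (0 < p.2)%N, (p.2 < p.1)%N, (n ^ 4 <= p.1)%N & (p.1 : nat)%:R < th * (n ^ 4)%:R].

Definition pair_dev (n : nat) (x : nat -> R) (th s al : R) : R :=
  \sum_(p <- enum (@block_pairs n th)) near_int (s / n%:R ^+ 4) (al * (x p.1 - x p.2))
  - 2 * (s / n%:R ^+ 4) * #|@block_pairs n th|%:R.

Lemma sum_pow_half (K : nat) : \sum_(q < K) (2 ^+ q)^-1 <= 2 :> R.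
Proof.
suff -> : \sum_(q < K) (2 ^+ q)^-1 = 2 - 2 * (2 ^+ K)^-1 :> R.
  by rewrite lerBlDr lerDl mulr_ge0// invr_ge0 exprn_ge0.
elim: K => [|K IH]; first by rewrite big_ord0 expr0 invr1 mulr1 subrr.
rewrite big_ord_recr /= IH exprS invfM mulrA divff// mul1r; lra.
Qed.

Lemma indicator_integral (c : R) (J : set R) (f g : R -> \bar R) : 0 <= c -> measurable J ->
  measurable_fun [set: R] f -> (forall x, 0 <= f x)%E ->
  (forall x, g x = (c * \1_J x)%:E * f x)%E ->
  (\int[mu]_x g x = c%:E * \int[mu]_(x in J) f x)%E.
Proof.
move=> c0 mJ mf f0 gE.
rewrite -ge0_integralZl//; last exact: measurable_funTS.
rewrite [RHS]integral_mkcond; apply: eq_integral => x _.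
rewrite gE /patch indicE; case: ifP => _; first by rewrite mulr1.
by rewrite mulr0 mul0e.
Qed.

Variables (A th s C : nat -> R) (n1 : nat -> nat) (k : R).
Hypotheses (A0 : forall q, 0 < A q) (s0 : forall q, 0 < s q) (C0 : forall q, 0 < C q) (k0 : 0 < k).
Hypothesis block_bound : forall q (n : nat) (L : R) (xo : nat -> R)
    (V : pred ('I_(16 * n ^ 4) * 'I_(16 * n ^ 4))),
  (n1 q <= n)%N -> (0 < n)%N -> 0 < L -> L <= n%:R ->
  (forall p, V p -> (0 < p.2)%N /\ (p.2 < p.1)%N) ->
  (forall u v, (0 < u)%N -> (u < v)%N -> (v < n ^ 4)%N -> xo u + 1 <= xo v) ->
  (\int[mu]_(al in annulus (A q)) mean 5 (fun l => ((near_count (enum V)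
      (fun p => pair_form n (natpair p))
      (fun p => pair_phase n (k * L / n%:R ^+ 6) xo (natpair p)) (s q / n%:R ^+ 4) al l
        - 2 * (s q / n%:R ^+ 4) * #|V|%:R) ^+ 2)%:E) <=
   (C q * n%:R ^+ 8 * (L^-1 + n%:R^-1))%:E)%E.

(** In the constant, [3^5] pays for the five frequencies, 2 bounds the sum of the [2^-q], and
    [2^q C q] undoes the weight of the window [q]. *)
Lemma select_block (K n : nat) (L tau : R) (xo : nat -> R) :
  (0 < n)%N -> 0 < L -> L <= n%:R -> 0 < tau ->
  (forall u v, (0 < u)%N -> (u < v)%N -> (v < n ^ 4)%N -> xo u + 1 <= xo v) ->
  exists P : seq R, [/\ size P = 5, {in P, forall y, tau <= y} &
    forall q, (q < K)%N -> (n1 q <= n)%N ->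
    (\int[mu]_(al in annulus (A q))
       ((pair_dev n (extend n (k * L / n%:R ^+ 6) xo P) (th q) (s q) al) ^+ 2)%:E <=
     (3 ^+ 5 * 2 * (2 ^+ q * C q) * n%:R ^+ 8 * (L^-1 + n%:R^-1))%:E)%E].
Proof.
move=> n0 L0 Ln tau0 gap.
pose eps := k * L / n%:R ^+ 6.
pose D q al l := near_count (enum (@block_pairs n (th q))) (fun p => pair_form n (natpair p))
  (fun p => pair_phase n eps xo (natpair p)) (s q / n%:R ^+ 4) al l
   - 2 * (s q / n%:R ^+ 4) * #|@block_pairs n (th q)|%:R.
(* The weights let one choice of [P] serve all [q < K] at once. *)
pose w q : R := (2 ^+ q * C q)^-1.
have w0 q : 0 < w q by rewrite invr_gt0 mulr_gt0// exprn_gt0.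
pose G q al l : \bar R := ((w q * \1_(annulus (A q)) al * (D q al l) ^+ 2)%:E).
pose qs := [seq q <- index_iota 0 K | (n1 q <= n)%N].
pose F al l : \bar R := (\sum_(q <- qs) G q al l)%E.
have mDD q : seq_measurable 5 (fun al l => (D q al l ^+ 2)%:E).
  move=> dS S phi xs sxs mphi mxs; apply/measurable_EFinP.
  apply: measurable_funX; apply: measurable_funB => //.
  apply: measurable_sum => p.
  apply/measurable_EFinP.
  apply: (seq_measurable_near_int _ _ (measurable_pair_phase _ _ _ _)) => //.
have mind q : measurable_fun [set: R] (\1_(annulus (A q)) : R -> R).
  by apply: measurable_indic; exact: measurable_annulus.
have mG q : seq_measurable 5 (G q).
  move=> dS S phi xs sxs mphi mxs; apply/measurable_EFinP.
  apply: measurable_funM; last by apply/measurable_EFinP; exact: mDD.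
  by apply: measurable_funM => //; exact: measurableT_comp.
have G0 q al l : (0 <= G q al l)%E.
  by rewrite lee_fin mulr_ge0 ?sqr_ge0// mulr_ge0// ltW.
have mF : seq_measurable 5 F by exact: seq_measurable_sum.
have F0 al l : (0 <= F al l)%E by exact: sume_ge0.
pose b : R := 2 * (n%:R ^+ 8 * (L^-1 + n%:R^-1)).
have nR0 : 0 < n%:R :> R by rewrite ltr0n.
have V0 : 0 < n%:R ^+ 8 * (L^-1 + n%:R^-1).
  by rewrite mulr_gt0 ?exprn_gt0// addr_gt0// invr_gt0.
have b0 : 0 < b by rewrite mulr_gt0.
have intF : (\int[mu]_al mean 5 (F al) <= b%:E)%E.
  have meanF al : mean 5 (F al) = (\sum_(q <- qs) mean 5 (G q al))%E by exact: mean_sum.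
  under eq_integral do rewrite meanF.
  rewrite ge0_integral_sum//; first last.
  - by move=> q al _; exact: mean_ge0.
  - by move=> q; exact: (mean_measurable (mG q) (G0 q)).
  have GE q : (n1 q <= n)%N -> (\int[mu]_al mean 5 (G q al) <=
      (2 ^- q * (n%:R ^+ 8 * (L^-1 + n%:R^-1)))%:E)%E.
    move=> hq.
    have V1 p : @block_pairs n (th q) p -> (0 < p.2)%N /\ (p.2 < p.1)%N by move=> /and4P[].
    have bb := block_bound hq n0 L0 Ln V1 gap.
    pose Mq al := mean 5 (fun l => (D q al l ^+ 2)%:E).
    have Mq0 al : (0 <= Mq al)%E by apply: mean_ge0 => l; rewrite lee_fin sqr_ge0.
    have mMq : measurable_fun [set: R] Mq.
      by apply: (mean_measurable (mDD q)) => t l; rewrite lee_fin sqr_ge0.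
    have GM al : mean 5 (G q al) = ((w q * \1_(annulus (A q)) al)%:E * Mq al)%E.
      rewrite -(@meanZl _ _ _ _ (fun al l => (D q al l ^+ 2)%:E))//.
      - by rewrite mulr_ge0// ltW.
      - by move=> t l; rewrite lee_fin sqr_ge0.
    rewrite (indicator_integral (ltW (w0 q)) (measurable_annulus _) mMq Mq0 GM).
      apply: (@le_trans _ _ ((w q)%:E * (C q * n%:R ^+ 8 * (L^-1 + n%:R^-1))%:E)%E).
        by apply: lee_wpmul2l => //; rewrite lee_fin ltW.
      rewrite -EFinM lee_fin /w invfM -!mulrA (mulrA (C q)^-1) mulVf ?mul1r//.
      by rewrite gt_eqF.
  apply: (@le_trans _ _ (\sum_(q <- qs) (2 ^- q * (n%:R ^+ 8 * (L^-1 + n%:R^-1)))%:E)%E).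
    by rewrite big_seq [leRHS]big_seq; apply: lee_sum => q; rewrite mem_filter => /andP[hq _]; exact: GE.
  rewrite sumEFin lee_fin -mulr_suml; apply: ler_wpM2r; first exact: ltW.
  rewrite big_filter big_mkcond big_mkord.
  apply: le_trans (sum_pow_half K).
  apply: ler_sum => q _; case: ifP => // _; by rewrite invr_ge0 exprn_ge0.
(* [S] dominates every radius involved, so the integrand vanishes for [|al| < 1/S]; frequencies of
   size at least [max(tau, S)] then cover full periods wherever it does not. *)
pose S := \sum_(q < K) A q + 1.
have S0 : 0 < S by rewrite ltr_pwDr// sumr_ge0// => q _; exact: ltW.
have AS q : (q < K)%N -> A q <= S.
  move=> qK; rewrite /S (bigD1 (Ordinal qK))//= -addrA lerDl addr_ge0// sumr_ge0// => i _.
  exact: ltW.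
have [||||Ps [sPs hPs hI]] := @select_frequencies R 5 F S^-1 b (Num.max tau S) mF F0 _ _ _ _ b0 intF.
- move=> al l1 x l2; apply: eq_bigr => q _; congr (_%:E); congr (_ * (_ - _) ^+ 2).
  apply: eq_bigr => p _; have [j ->] := dot_shift (pair_form n (natpair p)) l1 x l2.
  by rewrite addrAC near_int_periodicz.
- move=> al l alS; rewrite /F big_seq big1// => q; rewrite mem_filter mem_index_iota => /and3P[_ _ qK].
  have nin : (al \in annulus (A q)) = false.
    apply/negP; rewrite inE => /andP[h _].
    have : S^-1 <= (A q)^-1 by rewrite lef_pV2 ?posrE// AS.
    by move=> /le_trans /(_ h); rewrite leNgt alS.
  by rewrite /G indicE nin mulr0 mul0r.
- by rewrite lt_max tau0.
- by rewrite mulrC ler_pdivlMr// mul1r le_max lexx orbT.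
exists Ps; split => //.
  by move=> y /hPs /andP[]; rewrite ge_max => /andP[].
move=> q qK hq.
have dev al : D q al [seq al * y | y <- Ps] = pair_dev n (extend n eps xo Ps) (th q) (s q) al.
  rewrite /D /pair_dev; congr (_ - _); rewrite /near_count big_seq [RHS]big_seq.
  apply: eq_bigr => p; rewrite mem_enum => /and4P[_ p21 p1 _].
  by rewrite pair_formE.
have GP al : G q al [seq al * y | y <- Ps] = ((w q * \1_(annulus (A q)) al)%:E *
     (pair_dev n (extend n eps xo Ps) (th q) (s q) al ^+ 2)%:E)%E.
  by rewrite /G dev EFinM.
have mPs i : measurable_fun [set: R] (nth (fun=> 0) [seq (fun al : R => al * y) | y <- Ps] i).
  have [iP|iP] := ltnP i (size Ps); last by rewrite nth_default ?size_map.
  by rewrite (nth_map 0)//; exact: measurable_funM.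
have mseq (H : R -> seq R -> \bar R) : seq_measurable 5 H ->
    measurable_fun [set: R] (fun al => H al [seq al * y | y <- Ps]).
  move=> mH; have := mH _ _ (fun al : R => al) [seq (fun al : R => al * y) | y <- Ps].
  rewrite size_map sPs => /(_ erefl (@measurable_id _ _ _) mPs).
  by under eq_fun do rewrite -map_comp.
have : (\int[mu]_al G q al [seq (al * y)%R | y <- Ps] <= (3 ^+ 5 * b)%:E)%E.
  apply: le_trans hI; apply: ge0_le_integral => //.
  - exact: mseq.
  - exact: mseq.
  - move=> al _; rewrite /F (big_rem q)/=; last by rewrite mem_filter hq mem_index_iota.
    by rewrite leeDl// sume_ge0.
under eq_integral do rewrite GP.
have mdev : measurable_fun [set: R] (fun al => (pair_dev n (extend n eps xo Ps) (th q) (s q) al ^+ 2)%:E).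
  by under eq_fun do rewrite -dev; apply: (mseq (fun al l => (D q al l ^+ 2)%:E)).
have dev0 al : (0 <= (pair_dev n (extend n eps xo Ps) (th q) (s q) al ^+ 2)%:E)%E.
  by rewrite lee_fin sqr_ge0.
rewrite (indicator_integral (ltW (w0 q)) (measurable_annulus _) mdev dev0 (fun=> erefl)).
set I := integral _ _ _ => hI2.
have := @lee_wpmul2l _ ((w q)^-1)%:E _ _ _ hI2.
rewrite lee_fin invr_ge0 (ltW (w0 q)) => /(_ isT).
rewrite muleA -EFinM mulVf ?gt_eqF// mul1e => /le_trans; apply.
rewrite -EFinM lee_fin /w invrK /b le_eqVlt; apply/orP; left; apply/eqP; ring.
Qed.

End Stage.

(** * Spacing and the recursive construction of the sequence *)

Section BlockGap.
Context {R : realType}.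

Lemma dot_cons a v (y : R) P : dot (a :: v) (y :: P) = a%:~R * y + dot v P.
Proof. by []. Qed.

Lemma dot_mono (v w : seq int) (P : seq R) : size v = size w ->
  (forall i, nth 0 v i <= nth 0 w i) -> {in P, forall y, 0 <= y} -> dot v P <= dot w P.
Proof.
elim: v w P => [|a v IH] [|b w] [|y P] //= [svw] vw P0.
apply: lerD; last first.
  apply: IH => // [i|z zP]; first exact: (vw i.+1).
  by apply: P0; rewrite inE zP orbT.
apply: ler_wpM2r; first by apply: P0; rewrite mem_head.
by rewrite ler_int; exact: (vw 0%N).
Qed.

(** The coefficient [m] gains 1 and contributes at least 2, the other quotients do not decrease, and
    the quadratic term loses at most 1, even at a carry. *)
Lemma block_elem_gap (n : nat) (eps : R) (P : seq R) (m : nat) : (0 < n)%N -> 0 <= eps ->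
  eps * (4 * (16 * n)%:R ^+ 2) <= 1 -> size P = 5 -> {in P, forall y, 2 <= y} ->
  (m < 16 * n ^ 4)%N -> block_elem n eps P m + 1 <= block_elem n eps P m.+1.
Proof.
move=> n0 eps0 heps sP hP mM.
case: P sP hP => [|P0 [|P1 P]] //= [sP] hP.
have P1_2 : 2 <= P1 by apply: hP; rewrite !inE eqxx orbT.
have Ppos : {in P, forall y, 0 <= y}.
  by move=> y yP; apply: le_trans (hP y _) => //; rewrite !inE yP !orbT.
rewrite /block_elem /quots !dot_cons.
have H : dot [:: (m %/ n)%N%:Z; (m %/ n ^ 2)%N%:Z; (m %/ n ^ 3)%N%:Z] P <=
     dot [:: (m.+1 %/ n)%N%:Z; (m.+1 %/ n ^ 2)%N%:Z; (m.+1 %/ n ^ 3)%N%:Z] P.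
  apply: dot_mono => // -[|[|[|i]]] //=; rewrite ?lez_nat ?leq_div2r// nth_nil//.
have e1 : eps * (sqnorm n m)%:R <= 1.
  by apply: le_trans heps; apply: ler_wpM2l => //; exact: sqnorm_le.
have e2 : 0 <= eps * (sqnorm n m.+1)%:R by rewrite mulr_ge0.
have E : m.+1%:R = m%:R + 1 :> R by rewrite natr1.
rewrite -!pmulrn E; set d := dot _ _ in H *; set d' := dot _ _ in H *.
move: H e1 e2; move: d d' (eps * _) (eps * _) => d d' u u' *; nra.
Qed.

Lemma block_elem_first (n : nat) (eps : R) (P : seq R) (m : nat) (c : R) : 0 <= eps ->
  size P = 5 -> {in P, forall y, c <= y} -> 0 <= c -> c <= block_elem n eps P m.
Proof.
move=> eps0 sP hP c0.
case: P sP hP => [|P0 P] //= [sP] hP.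
have P0c : c <= P0 by apply: hP; rewrite mem_head.
rewrite /block_elem /quots dot_cons mul1r -addrA; apply: le_trans P0c _; rewrite lerDl addr_ge0//.
  apply: le_trans (_ : dot [:: 0; 0; 0; 0] P <= _).
    have zer (l : seq R) : dot [:: 0; 0; 0; 0] l = 0 by apply: dot_eq0.
    by rewrite zer.
  apply: dot_mono => // [[|[|[|[|i]]]] //=|y yP]; rewrite ?nth_nil//.
  by apply: le_trans c0 (hP y _); rewrite inE yP orbT.
by rewrite mulr_ge0.
Qed.

Lemma gap_from_step (x : nat -> R) (N : nat) :
  (forall m, (0 < m)%N -> (m.+1 < N)%N -> x m + 1 <= x m.+1) ->
  forall u v, (0 < u)%N -> (u < v)%N -> (v < N)%N -> x u + 1 <= x v.
Proof.
move=> hs u v u0; elim: v => // v IH; rewrite ltnS leq_eqVlt => /predU1P[uE|uv] vN.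
  by rewrite uE; apply: hs => //; rewrite -uE.
have := IH uv (ltnW vN); have := hs v (ltn_trans u0 uv) vN; lra.
Qed.

End BlockGap.

Section Construction.
Context {R : realType}.
Notation mu := (@lebesgue_measure R).
Variables (L : nat -> R) (k : R) (good : nat -> (nat -> R) -> seq R -> Prop).
Hypotheses (k0 : 0 < k) (k1 : k * (4 * 16%:R ^+ 2) <= 1).
Hypotheses (L0 : forall j, 0 < L j) (L2 : forall j, L j <= (2 ^ j)%:R).

Let N j := ((2 ^ j) ^ 4)%N.
Let eps j := k * L j / (2 ^ j)%:R ^+ 6.

Definition spaced (M : nat) (x : nat -> R) : Prop :=
  forall u v, (0 < u)%N -> (u < v)%N -> (v < M)%N -> x u + 1 <= x v.

Hypothesis select : forall j xo tau, 0 < tau -> spaced (N j) xo ->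
  exists P : seq R, [/\ size P = 5, {in P, forall y, tau <= y} & good j xo P].

Definition block_index (m : nat) : nat := trunc_log 16 m.

Lemma N_block j : N j = (16 ^ j)%N.
Proof. by rewrite /N -expnM mulnC expnM. Qed.

Lemma block_index_lt j m : (0 < m)%N -> (m < N j)%N -> (block_index m < j)%N.
Proof.
rewrite N_block => m0 mj; rewrite -(ltn_exp2l _ _ (isT : 1 < 16)%N).
by apply: leq_ltn_trans mj; exact: trunc_logP.
Qed.

Lemma block_indexE j m : (N j <= m)%N -> (m < N j.+1)%N -> block_index m = j.
Proof. by rewrite !N_block => h1 h2; apply: trunc_log_eq => //; rewrite h1. Qed.

(** Reads a finite history of frequency vectors as a sequence on all of [nat]; on blocks not yet
    chosen, the default [[::]] gives values that do not matter. *)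
Definition assemble (h : seq (seq R)) (m : nat) : R :=
  block_elem (2 ^ block_index m) (eps (block_index m)) (nth [::] h (block_index m)) m.

Lemma exists_sequence : exists (x : nat -> R) (P : nat -> seq R),
  [/\ forall j m, (N j <= m)%N -> (m < N j.+1)%N -> x m = block_elem (2 ^ j) (eps j) (P j) m,
      forall j, size (P j) = 5,
      forall M, spaced M x &
      forall j, exists2 xo, good j xo (P j) &
        forall m, (0 < m)%N -> (m < N j.+1)%N -> extend (2 ^ j) (eps j) xo (P j) m = x m].
Proof.
have eps0 j : 0 < eps j.
  by rewrite divr_gt0 ?exprn_gt0 ?mulr_gt0// ltr0n expn_gt0.
have heps j : eps j * (4 * (16 * 2 ^ j)%:R ^+ 2) <= 1.
  have : 1 <= (2 ^ j)%:R :> R by rewrite ler1n expn_gt0.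
  have q0 : 0 <= 16%:R :> R by [].
  rewrite /eps natrM; move: (L2 j) (L0 j) k1 q0; move: (2 ^ j)%:R (L j) 16%:R => n l q ln l0 kq q0 n1.
  have n0 : 0 < n by lra.
  have -> : k * l / n ^+ 6 * (4 * (q * n) ^+ 2) = k * (4 * q ^+ 2) * (l / n) * (n ^+ 3)^-1.
    by field; rewrite gt_eqF.
  have ln1 : l / n <= 1 by rewrite ler_pdivrMr// mul1r.
  have n31 : (n ^+ 3)^-1 <= 1 by rewrite invf_le1 ?exprn_gt0// exprn_ege1.
  have a0 : 0 <= k * (4 * q ^+ 2) by rewrite !mulr_ge0// ?sqr_ge0// ltW.
  have b0 : 0 <= l / n by rewrite divr_ge0// ltW.
  have c0 : 0 <= (n ^+ 3)^-1 by rewrite invr_ge0 exprn_ge0// ltW.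
  apply: le_trans (_ : 1 * 1 * 1 <= _); last by rewrite !mulr1.
  by apply: ler_pM => //; [apply: mulr_ge0|apply: ler_pM].
(* The choice is made total by guarding it with [spaced], so the recursion can be defined before
   spacing is proved. The bound [|last| + 2] gives the gap at the block boundary and frequencies at
   least 2 within the block. *)
have pick j (h : seq (seq R)) : {P : seq R | spaced (N j) (assemble h) ->
    [/\ size P = 5, {in P, forall y, `|assemble h (N j).-1| + 2 <= y} & good j (assemble h) P]}.
  apply: cid; have [sp|nsp] := pselect (spaced (N j) (assemble h)); last by exists [::].
  by have [|P hP] := select (tau := `|assemble h (N j).-1| + 2) _ sp; [rewrite ltr_wpDl|exists P].
pose fix hist (j : nat) : seq (seq R) :=
  if j is j'.+1 then rcons (hist j') (projT1 (pick j' (hist j'))) else [::].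
pose P j := projT1 (pick j (hist j)).
have shist j : size (hist j) = j by elim: j => //= j IH; rewrite size_rcons IH.
have nhist j i : (i < j)%N -> nth [::] (hist j) i = P i.
  elim: j => // j IH; rewrite ltnS leq_eqVlt => /predU1P[->|ij] /=.
    by rewrite nth_rcons shist ltnn eqxx.
  by rewrite nth_rcons shist ij IH.
pose x m := block_elem (2 ^ block_index m) (eps (block_index m)) (P (block_index m)) m.
have asm j m : (0 < m)%N -> (m < N j)%N -> assemble (hist j) m = x m.
  by move=> m0 mj; rewrite /assemble nhist//; exact: block_index_lt.
have xE j m : (N j <= m)%N -> (m < N j.+1)%N -> x m = block_elem (2 ^ j) (eps j) (P j) m.
  by move=> h1 h2; rewrite /x (block_indexE h1 h2).
have N0 j : (0 < N j)%N by rewrite N_block expn_gt0.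
have NS j : N j.+1 = (16 * (2 ^ j) ^ 4)%N by rewrite -/(N j) !N_block expnS.
have sp j : spaced (N j) x.
  elim: j => [|j IH]; first by move=> u v u0 uv; rewrite /N /= => v1; lia.
  have spa : spaced (N j) (assemble (hist j)).
    move=> u v u0 uv vN; rewrite !asm//; [exact: IH|exact: leq_trans u0 (ltnW uv)|exact: ltn_trans vN].
  have [sP hP _] := projT2 (pick j (hist j)) spa; rewrite -/(P j) in sP hP.
  apply: gap_from_step => m m0 mN.
  have [mj|jm] := ltnP m.+1 (N j); first by apply: IH.
  have [mj|{}jm] := ltnP m (N j).
    have mE : m = (N j).-1 by lia.
    rewrite (xE j m.+1)//.
    apply: (@le_trans _ _ (`|assemble (hist j) (N j).-1| + 2)).
      rewrite -mE asm//; have := ler_norm (x m); lra.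
    by apply: block_elem_first => //; exact: ltW.
  rewrite (xE j m)//; last exact: ltnW.
  rewrite (xE j m.+1)//; last exact: leqW.
  apply: block_elem_gap => //.
  - by rewrite expn_gt0.
  - exact: ltW.
  - by move=> y /hP; have := normr_ge0 (assemble (hist j) (N j).-1); lra.
  - by rewrite -NS; exact: ltnW.
have spa j : spaced (N j) (assemble (hist j)).
  move=> u v u0 uv vN; rewrite !asm//; [exact: (sp j)|exact: leq_trans u0 (ltnW uv)|exact: ltn_trans vN].
exists x, P; split => //.
- by move=> j; have [] := projT2 (pick j (hist j)) (spa j).
- move=> M u v u0 uv vM; apply: (sp v) => //.
  by rewrite N_block; exact: ltn_expl.
- move=> j; have [_ _ g] := projT2 (pick j (hist j)) (spa j).
  exists (assemble (hist j)) => // m m0 mN; rewrite /extend -/(N j).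
  by case: ltnP => mj; [exact: asm|rewrite (xE j m)].
Qed.

End Construction.

(** * Convergence of the variances and almost sure limits *)

Section Summability.
Context {R : realType}.
Notation mu := (@lebesgue_measure R).

(** The comparison of [x^(-1-c)] on [[a, b]] with its value at [b], obtained without integration
    from [expR u >= 1 + u] and [ln u <= u - 1]. *)
Lemma powR_telescope (a b c : R) : 0 < a -> a <= b -> 0 < c ->
  c * ((b - a) * (b `^ (1 + c))^-1) <= a `^ (- c) - b `^ (- c).
Proof.
move=> a0 ab c0; have b0 : 0 < b by exact: lt_le_trans ab.
have pE (x y : R) : 0 < x -> x `^ y = expR (y * ln x) by move=> x0; rewrite /powR gt_eqF.
have bc : (b `^ (1 + c))^-1 = b `^ (- c) * b^-1.
  have -> : b^-1 = expR (- ln b) by rewrite expRN lnK ?posrE.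
  rewrite !pE// -expRN -expRD; congr expR; ring.
have -> : a `^ (- c) = b `^ (- c) * expR (c * (ln b - ln a)).
  by rewrite !pE// -expRD; congr expR; ring.
have H : 1 + c * ((b - a) / b) <= expR (c * (ln b - ln a)).
  apply: le_trans (expR_ge1Dx _); rewrite lerD2l ler_pM2l// lerBrDl -lerBrDr.
  have -> : (b - a) / b = 1 - a / b by rewrite mulrBl divff// gt_eqF.
  have : ln (a / b) <= a / b - 1.
    have ab0 : 0 < a / b by rewrite divr_gt0.
    by have := @le_ln1Dx R (a / b - 1); rewrite addrCA subrr addr0; apply; lra.
  rewrite ln_div ?posrE//; lra.
have bp : 0 < b `^ (- c) by exact: powR_gt0.
rewrite bc; have -> : c * ((b - a) * (b `^ (- c) / b)) = b `^ (- c) * (c * ((b - a) / b)) by ring.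
move: H bp; move: (expR _) (b `^ (- c)) (c * ((b - a) / b)) => e p y *; nra.
Qed.

(** The shift by 3 keeps [ln (j + 2)], the other end of the telescoping step, positive from [j = 0]
    on. *)
Definition slow_log (c : R) (j : nat) : R := (j + 3)%:R * (ln (j + 3)%:R) `^ (1 + c).

Lemma ln_natD3_gt0 j : 0 < ln (j + 2)%:R :> R.
Proof. by apply: ln_gt0; rewrite ltr1n addn2. Qed.

Lemma slow_log_gt0 c j : 0 < slow_log c j.
Proof.
by rewrite /slow_log addn3 mulr_gt0// powR_gt0// ln_gt0// ltr1n.
Qed.

Lemma slow_log_inv_le c j : 0 < c ->
  (slow_log c j)^-1 <= c^-1 * ((ln (j + 2)%:R) `^ (- c) - (ln (j + 3)%:R) `^ (- c)).
Proof.
move=> c0; rewrite ler_pdivlMl//.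
have l2 := ln_natD3_gt0 j.
have j2 : 0 < (j + 2)%:R :> R by rewrite ltr0n addn2.
have j3 : 0 < (j + 3)%:R :> R by rewrite ltr0n addn3.
have j23 : (j + 3)%:R = (j + 2)%:R + 1 :> R by rewrite natr1 !addnS.
have l23 : ln (j + 2)%:R <= ln (j + 3)%:R :> R by rewrite ler_ln ?posrE// j23; lra.
apply: le_trans (powR_telescope l2 l23 c0); rewrite ler_pM2l// /slow_log invfM.
apply: ler_wpM2r; first by rewrite invr_ge0 powR_ge0.
have : ln ((j + 2)%:R / (j + 3)%:R) <= - (j + 3)%:R^-1 :> R.
  have E : (j + 2)%:R / (j + 3)%:R = 1 + - (j + 3)%:R^-1 :> R.
    by rewrite j23; field; apply/eqP; lra.
  rewrite E; apply: le_ln1Dx; rewrite ltrN2 invf_lt1//; rewrite j23; lra.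
rewrite ln_div ?posrE//; lra.
Qed.

(** The cap secures [L <= n] on every block and adds only a geometric series to the sum of
    inverses. *)
Definition growth (c : R) (j : nat) : R := Num.min (slow_log c j) (2 ^ j)%:R.

Lemma growth_gt0 c j : 0 < growth c j.
Proof. by rewrite lt_min slow_log_gt0 ltr0n expn_gt0. Qed.

Lemma growth_le c j : growth c j <= (2 ^ j)%:R.
Proof. by rewrite ge_min lexx orbT. Qed.

Lemma sum_growth_inv_le c : 0 < c -> exists B, forall K,
  \sum_(j < K) ((growth c j)^-1 + (2 ^ j)%:R^-1) <= B.
Proof.
move=> c0; exists (c^-1 * (ln 2%:R) `^ (- c) + 4) => K.
have half : \sum_(j < K) (2 ^ j)%:R^-1 <= 2 :> R.
  suff -> : \sum_(j < K) (2 ^ j)%:R^-1 = 2 - 2 * (2 ^ K)%:R^-1 :> R.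
    by rewrite lerBlDr lerDl mulr_ge0// invr_ge0.
  elim: K => [|K IH]; first by rewrite big_ord0 invr1 mulr1 subrr.
  rewrite big_ord_recr /= IH expnS natrM invfM mulrA divff// mul1r; lra.
have tele : \sum_(j < K) (slow_log c j)^-1 <= c^-1 * (ln 2%:R) `^ (- c).
  apply: (@le_trans _ _ (c^-1 * ((ln 2%:R) `^ (- c) - (ln (K + 2)%:R) `^ (- c)))).
    elim: K {half} => [|K IH]; first by rewrite big_ord0 subrr mulr0.
    rewrite big_ord_recr /=; apply: le_trans (lerD IH (slow_log_inv_le K c0)) _.
    by rewrite addSnnS; lra.
  by rewrite ler_pM2l ?invr_gt0// lerBlDr lerDl powR_ge0.
have : \sum_(j < K) ((growth c j)^-1 + (2 ^ j)%:R^-1) <=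
    \sum_(j < K) ((slow_log c j)^-1 + (2 ^ j)%:R^-1 + (2 ^ j)%:R^-1).
  apply: ler_sum => j _; rewrite lerD2r /growth.
  have a0 : 0 <= (slow_log c j)^-1 by rewrite invr_ge0 ltW// slow_log_gt0.
  have b0 : 0 <= (2 ^ j)%:R^-1 :> R by rewrite invr_ge0.
  by rewrite minEle; case: ifP => _; rewrite ?lerDl ?lerDr.
by rewrite !big_split /=; lra.
Qed.

(** By monotone convergence the sum of the [f j] is integrable, hence finite almost everywhere, and
    the terms of a convergent series tend to 0. *)
Lemma ae_cvg0 (D : set R) (f : nat -> R -> R) (u : nat -> R) (B : R) (j0 : nat) :
  measurable D -> (forall j, measurable_fun [set: R] (f j)) -> (forall j x, 0 <= f j x) ->
  (forall j, (j0 <= j)%N -> (\int[mu]_(x in D) (f j x)%:E <= (u j)%:E)%E) ->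
  (forall K, \sum_(j < K) u (j + j0)%N <= B) ->
  {ae mu, forall x, D x -> (fun j => f j x) @ \oo --> (0 : R)}.
Proof.
move=> mD mf f0 hf hB.
pose g j x := (f (j + j0)%N x)%:E.
have mg j : measurable_fun D (g j) by apply: measurable_funTS; apply/measurable_EFinP.
have g0 j x : (0 <= g j x)%E by rewrite lee_fin.
have int_le : (\int[mu]_(x in D) (\sum_(j <oo) g j x) <= B%:E)%E.
  rewrite integral_nneseries//; apply: lime_le.
    by apply: is_cvg_nneseries => j _ _; exact: integral_ge0.
  near=> K; rewrite big_mkord.
  apply: (@le_trans _ _ (\sum_(j < K) (u (j + j0)%N)%:E)%E).
    by apply: lee_sum => j _; apply: hf; rewrite leq_addl.
  by rewrite sumEFin lee_fin.
have mS : measurable_fun D (fun x => \sum_(j <oo) g j x)%E.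
  by apply: ge0_emeasurable_sum => // j x _ _; exact: g0.
have S0 x : (0 <= \sum_(j <oo) g j x)%E by exact: nneseries_ge0.
have iS : mu.-integrable D (fun x => \sum_(j <oo) g j x)%E.
  apply/integrableP; split => //.
  under eq_integral do rewrite gee0_abs//.
  by apply: le_lt_trans int_le _; exact: ltry.
move/integrable_ae: iS => /(_ mD); apply: filterS => x /= hx Dx.
have {hx}Sfin := hx Dx.
rewrite -(cvg_shiftn j0).
have bnd K : \sum_(0 <= j < K) f (j + j0)%N x <= fine (\sum_(j <oo) g j x)%E.
  rewrite -lee_fin fineK// -sumEFin; apply: (nneseries_lim_ge K).
  by move=> j _ _; exact: g0.
apply: (@cvg_series_cvg_0 _ _ (fun j => f (j + j0)%N x)).
apply: nondecreasing_is_cvgn.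
  apply/nondecreasing_seqP => K; rewrite /series /= big_nat_recr//= lerDl.
  exact: f0.
by exists (fine (\sum_(j <oo) g j x)%E) => _ [K _ <-]; exact: bnd.
Unshelve. all: by end_near.
Qed.

End Summability.

(** * Pair correlation *)

Section BlockCount.
Context {R : realType}.

Lemma sum_block_pairs (n : nat) (th : R) (F : nat -> nat -> R) : (0 < n)%N ->
  \sum_(p <- enum (@block_pairs R n th)) F p.1 p.2 =
  \sum_(n ^ 4 <= m < 16 * n ^ 4 | m%:R < th * (n ^ 4)%:R) \sum_(1 <= m' < m) F m m'.
Proof.
move=> n0; rewrite big_enum big_mkcond /=.
rewrite [RHS](@big_nat_widenl _ _ _ _ 0)// [RHS]big_mkord [RHS]big_mkcond /=.
rewrite -(pair_bigA _ (fun m m' : 'I_(16 * n ^ 4) =>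
  if (m, m') \in @block_pairs R n th then F m m' else 0)) /=.
apply: eq_bigr => m _.
rewrite (@big_nat_widenl _ _ _ _ 0)// (@big_nat_widen _ _ _ 0 m (16 * n ^ 4)%N)//; last exact: ltnW.
rewrite big_mkord; case: ifP => [/andP[h1 h2]|h].
  rewrite [RHS]big_mkcond; apply: eq_bigr => m' _.
  by rewrite unfold_in /block_pairs /= h1 h2 !andbT.
apply: big1 => m' _; rewrite unfold_in /block_pairs /=.
case: ifP => // /and4P[_ _ h1 h2]; by rewrite h1 h2 in h.
Qed.

Lemma sum_pred_nat (a b : nat) : (0 < a)%N -> (a <= b)%N ->
  2 * (\sum_(a <= m < b) (m%:R - 1)) =
  (b%:R - 1) * (b%:R - 2) - (a%:R - 1) * (a%:R - 2) :> R.
Proof.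
move=> a0; elim: b => [|b IH].
  by rewrite leqn0 => /eqP ->; rewrite big_geq// subrr mulr0.
rewrite leq_eqVlt => /predU1P[<-|ab]; first by rewrite big_geq// subrr mulr0.
rewrite big_nat_recr// mulrDr IH// -(natr1 b); ring.
Qed.

(** An index [m] has [m - 1] partners, so twice the count is [(E - 1)(E - 2) - (N - 1)(N - 2)] with
    [E] the ceiling of [th N]. The linear error terms are at most [3 th N <= 48 N]; 60 leaves
    room. *)
Lemma card_block_pairs (n : nat) (th : R) : (0 < n)%N -> 1 <= th <= 16%:R ->
  `|2 * #|@block_pairs R n th|%:R / (n ^ 4)%:R ^+ 2 - (th ^+ 2 - 1)| <= 60%:R / (n ^ 4)%:R.
Proof.
move=> n0 /andP[th1 th16]; set N := (n ^ 4)%N.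
have N1 : 1 <= N%:R :> R by rewrite ler1n expn_gt0 n0.
have cE : #|@block_pairs R n th|%:R =
    \sum_(N <= m < 16 * N | m%:R < th * N%:R) (m%:R - 1) :> R.
  rewrite cardE -[size _]count_predT -sum1_count natr_sum.
  rewrite (@sum_block_pairs n th (fun _ _ => 1%:R) n0).
  rewrite big_nat_cond [RHS]big_nat_cond; apply: eq_bigr => m /andP[/andP[Nm _] _].
  rewrite sumr_const_nat natrB//.
  by apply: leq_trans Nm; rewrite expn_gt0 n0.
pose E := `|Num.ceil (th * N%:R)|%N.
have thN : 0 <= th * N%:R by rewrite mulr_ge0//; lra.
have ER : E%:R = (Num.ceil (th * N%:R))%:~R :> R.
  rewrite /E natr_absz ger0_norm// ceil_ge0; lra.
have /andP[E1 E2] := Num.Theory.ceil_itv (th * N%:R).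
rewrite intrB -ER in E1; rewrite -ER in E2.
have NE : (N <= E)%N by rewrite -(ler_nat R); nra.
have E16 : (E <= 16 * N)%N.
  rewrite /E -lez_nat gez0_abs ?ceil_ge0; last lra.
  rewrite ceil_le_int -pmulrn (natrM _ 16 N); apply: ler_wpM2r => //; lra.
have ltE (m : nat) : (m%:R < th * N%:R) = (m < E)%N.
  apply/idP/idP => h; first by rewrite -(ltr_nat R) (lt_le_trans h).
  rewrite ltNge; apply/negP => h'; have : (E <= m)%N.
    by rewrite /E -lez_nat gez0_abs ?ceil_ge0 ?ceil_le_int -?pmulrn//; lra.
  by rewrite leqNgt h.
have {}cE : 2 * #|@block_pairs R n th|%:R =
    (E%:R - 1) * (E%:R - 2) - (N%:R - 1) * (N%:R - 2) :> R.
  rewrite cE -(sum_pred_nat _ NE) ?expn_gt0 ?n0//; congr (_ * _).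
  rewrite [RHS](big_nat_widen _ _ _ _ _ E16) /=.
  by apply: eq_bigl => m; rewrite ltE.
rewrite cE; move: th16 N1 E1 E2; move: (N%:R : R) (E%:R : R) => x y th16 x1 y1 y2.
have x0 : 0 < x by lra.
have -> : ((y - 1) * (y - 2) - (x - 1) * (x - 2)) / x ^+ 2 - (th ^+ 2 - 1) =
   ((y - 1) * (y - 2) - (th * x) ^+ 2 + (x ^+ 2 - (x - 1) * (x - 2))) / x ^+ 2.
  by field; rewrite gt_eqF.
have -> : 60%:R / x = 60%:R * x / x ^+ 2 by field; rewrite gt_eqF.
rewrite normrM [`|_^-1|]ger0_norm ?invr_ge0 ?sqr_ge0//.
apply: ler_wpM2r; first by rewrite invr_ge0 sqr_ge0.
have tx : th * x <= 16%:R * x by rewrite ler_pM2r.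
have tx1 : x <= th * x by rewrite ler_peMl// ltW.
move: tx tx1 y1 y2; move: (th * x) => t t16 xt y1 y2.
have h1 : (y - 1) * (y - 2) <= t * (t - 1) by nra.
have h2 : t * (t - 3%:R) <= (y - 1) * (y - 2) by nra.
rewrite ler_norml; apply/andP; split; nra.
Qed.

End BlockCount.

Section PairCorrelation.
Context {R : realType}.
Notation N j := ((2 ^ j) ^ 4)%N.

Lemma block_startS j : N j.+1 = (16 * N j)%N.
Proof. by rewrite (expnS 2 j) expnMn. Qed.

Lemma block_start_gt0 j : (0 < N j)%N.
Proof. by rewrite !expn_gt0. Qed.

Lemma near_int_le (r r' x : R) : r <= r' -> near_int r x <= near_int r' x.
Proof.
move=> rr'; rewrite /near_int ler_nat; case: ltP => //= h.
by rewrite (lt_le_trans h rr').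
Qed.

(** Each unordered pair counts once: about [N^2 (th^2 - 1) / 2] pairs, each close with probability
    [2 s / N], so after division by [N] the expected limit is [s (th^2 - 1)]. *)
Definition block_count (y : nat -> R) j (th s : R) : R :=
  (\sum_(N j <= m < 16 * N j | m%:R < th * (N j)%:R)
     \sum_(1 <= m' < m) near_int (s / (N j)%:R) (y m - y m')) / (N j)%:R.

Lemma block_count_ge0 y j th s : 0 <= block_count y j th s.
Proof.
by rewrite divr_ge0// sumr_ge0// => m _; rewrite sumr_ge0// => m' _; exact: near_int_ge0.
Qed.

Lemma block_count_le y j th th' s s' : th <= th' -> s <= s' ->
  block_count y j th s <= block_count y j th' s'.
Proof.
move=> tt ss; rewrite /block_count ler_wpM2r ?invr_ge0// big_mkcond [leRHS]big_mkcond.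
apply: ler_sum => m _; case: ltP => h.
  rewrite (lt_le_trans h) ?ler_wpM2r//.
  by apply: ler_sum => m' _; apply: near_int_le; rewrite ler_wpM2r ?invr_ge0.
by case: ifP => // _; rewrite sumr_ge0// => m' _; exact: near_int_ge0.
Qed.

Lemma block_count_bound y j th s : block_count y j th s <= (256 * N j)%:R.
Proof.
rewrite /block_count ler_pdivrMr ?ltr0n ?block_start_gt0//. rewrite -(natrM R (256 * N j) (N j)).
have near1 (r x : R) : near_int r x <= 1 by rewrite /near_int lern1 leq_b1.
apply: (@le_trans _ _ (\sum_(N j <= m < 16 * N j) (16 * N j)%:R)).
  rewrite big_mkcond; apply: ler_sum_nat => m /andP[_ m16]; case: ifP => // _.
  apply: (@le_trans _ _ (\sum_(1 <= m' < m) 1)); first by apply: ler_sum => m' _.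
  by rewrite sumr_const_nat ler_nat; lia.
rewrite sumr_const_nat -mulrnA ler_nat; nia.
Qed.

Lemma block_count0 y j th : block_count y j th 0 = 0.
Proof.
rewrite /block_count mul0r big1 ?mul0r// => m _; rewrite big1// => m' _.
rewrite /near_int ltNge; suff -> : 0 <= dist_int (y m - y m') by [].
rewrite /dist_int le_min; set z := y m - y m'.
have /andP[h1 h2] := Num.Theory.floor_itv z.
rewrite intrD in h2; apply/andP; split; lra.
Qed.

Definition grid_th (i m : nat) : R := 1 + 15%:R * i%:R / m.+1%:R.
Definition grid_s (b m : nat) : R := b%:R / m.+1%:R.


(** Change of the limit [s (th^2 - 1)] over one grid cell. Since [t + 15 v <= 31], the constants are
    [960 = 31^2 - 1] and [705 = 15 * (31 + 16)]. *)
Lemma area_perturb_up (S s th u t v : R) : 1 <= th <= 16%:R -> 0 <= s <= S ->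
  0 <= v -> v <= 1 -> s <= u + v -> u <= s -> t <= th -> th <= t + 15%:R * v -> 1 <= t ->
  (u + v) * ((t + 15%:R * v) ^+ 2 - 1) - s * (th ^+ 2 - 1) <= (960%:R + 705%:R * S) * v.
Proof.
move=> /andP[th1 th16] /andP[s0 sS] v0 v1 su us tth tht t1.
have -> : (u + v) * ((t + 15%:R * v) ^+ 2 - 1) - s * (th ^+ 2 - 1) =
  (u + v - s) * ((t + 15%:R * v) ^+ 2 - 1) +
  s * ((t + 15%:R * v - th) * (t + 15%:R * v + th)) by ring.
have -> : (960%:R + 705%:R * S) * v = v * 960%:R + S * ((15%:R * v) * 47%:R) by ring.
have [z [zE z1 z31]] : exists z, [/\ z = t + 15%:R * v, 1 <= z & z <= 31%:R].
  by exists (t + 15%:R * v); split => //; lra.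
rewrite -zE in tht *; apply: lerD; apply: ler_pM => //; rewrite ?subr_ge0//.
- by rewrite expr_ge1// ltW// (lt_le_trans ltr01).
- by clear - su us; lra.
- by clear - z1 z31; nra.
- by rewrite mulr_ge0 ?subr_ge0//; clear - z1 th1; lra.
- apply: ler_pM; rewrite ?subr_ge0//; first (by clear - z1 th1; lra).
    by clear - zE tth; lra.
  by clear - z31 th16; lra.
Qed.

Lemma area_perturb_down (S s th u t v : R) : 1 <= th <= 16%:R -> 0 <= s <= S ->
  0 <= v -> s <= u + v -> 0 <= u -> u <= s -> t <= th -> th <= t + 15%:R * v -> 1 <= t ->
  s * (th ^+ 2 - 1) - u * (t ^+ 2 - 1) <= (960%:R + 705%:R * S) * v.
Proof.
move=> /andP[th1 th16] /andP[s0 sS] v0 su u0 us tth tht t1.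
have -> : s * (th ^+ 2 - 1) - u * (t ^+ 2 - 1) =
  (s - u) * (th ^+ 2 - 1) + u * ((th - t) * (th + t)) by ring.
have -> : (960%:R + 705%:R * S) * v = v * 960%:R + S * ((15%:R * v) * 47%:R) by ring.
apply: lerD; apply: ler_pM => //; rewrite ?subr_ge0//.
- by rewrite expr_ge1// (le_trans ler01).
- by clear - su; lra.
- by clear - th1 th16; nra.
- by rewrite mulr_ge0 ?subr_ge0//; clear - t1 th1; lra.
- exact: le_trans us sS.
- apply: ler_pM; rewrite ?subr_ge0//; first (by clear - t1 th1; lra).
    by clear - tht; lra.
  by clear - th16 tth; lra.
Qed.

(** Monotone functions with a continuous limit converge uniformly: [(th, s)] is enclosed between two
    corners of a fine grid cell, and only finitely many grid points are involved. *)
Lemma block_count_uniform (y : nat -> R) (S d : R) : 0 < S -> 0 < d ->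
  (forall i b m, (i <= m.+1)%N -> (0 < b)%N ->
     block_count y j (grid_th i m) (grid_s b m) @[j --> \oo]
       --> grid_s b m * (grid_th i m ^+ 2 - 1)) ->
  \forall j \near \oo, forall th s, 1 <= th <= 16%:R -> 0 <= s <= S ->
    `|block_count y j th s - s * (th ^+ 2 - 1)| <= d.
Proof.
move=> S0 d0 H.
have [m mP] : exists m : nat, (960%:R + 705%:R * S) / m.+1%:R <= d / 2.
  exists (Num.truncn ((960%:R + 705%:R * S) / (d / 2))).
  rewrite ler_pdivrMr// (mulrC (d / 2)) -ler_pdivrMr; last lra.
  exact/ltW/truncnS_gt.
pose B := (Num.truncn (S * m.+1%:R)).+1.
have HH : \forall j \near \oo, forall (i : 'I_m.+2) (b : 'I_B.+1),
    `|block_count y j (grid_th i m) (grid_s b m) -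
      grid_s b m * (grid_th i m ^+ 2 - 1)| <= d / 2.
  apply: filter_forall => i; apply: filter_forall => b.
  (* [H] supplies no limit at [s = 0], where both the count and the limit vanish. *)
  have [b0|b0] := posnP b.
    near=> j; rewrite b0 /grid_s mul0r block_count0 mul0r subrr normr0; lra.
  have d2 : 0 < d / 2 by lra.
  have := H i b m; rewrite -ltnS ltn_ord => /(_ isT b0).
  move=> /cvgrPdist_le /(_ _ d2); apply: filterS => j; by rewrite distrC.
near=> j => th s /andP[th1 th16] /andP[s0 sS].
have HG : forall (i : 'I_m.+2) (b : 'I_B.+1),
    `|block_count y j (grid_th i m) (grid_s b m) -
      grid_s b m * (grid_th i m ^+ 2 - 1)| <= d / 2 by near: j.
have m0 : 0 < m.+1%:R :> R by rewrite ltr0n.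
pose b := Num.truncn (s * m.+1%:R).
have sm0 : 0 <= s * m.+1%:R by rewrite mulr_ge0// ltW.
have bB : (b < B)%N by rewrite ltnS /b le_truncn// ler_pM2r.
have /andP[b1 b2] := truncn_itv sm0; rewrite -/b in b1 b2.
have [i [im i1 i2]] : exists i : nat, [/\ (i <= m)%N, grid_th i m <= th & th <= grid_th i.+1 m].
  pose t := (th - 1) / 15%:R * m.+1%:R.
  have t0 : 0 <= t by rewrite /t mulr_ge0// divr_ge0//; lra.
  have thE : th = 1 + 15%:R * t / m.+1%:R.
    by rewrite /t; field; rewrite gt_eqF.
  have tm : t <= m.+1%:R by rewrite /t; move: m0; move: (m.+1%:R : R) => u u0; nra.
  have [i [im i1 i2]] : exists i : nat, [/\ (i <= m)%N, i%:R <= t & t <= i.+1%:R].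
    have /andP[i1 i2] := truncn_itv t0.
    have [h|h] := leqP (Num.truncn t) m; first by exists (Num.truncn t); split => //; exact: ltW.
    (* At [th = 16] the truncation is [m + 1], so the last cell is taken instead. *)
    exists m; split => //; apply: le_trans i1; rewrite ler_nat; exact: ltnW.
  exists i; split => //.
    by rewrite /grid_th [leRHS]thE lerD2l ler_wpM2r ?invr_ge0 ?(ltW m0)// ler_wpM2l.
  by rewrite /grid_th [leLHS]thE lerD2l ler_wpM2r ?invr_ge0 ?(ltW m0)// ler_wpM2l.
have bs1 : grid_s b m <= s by rewrite /grid_s ler_pdivrMr.
have bs2 : s <= grid_s b.+1 m by rewrite /grid_s ler_pdivlMr// ltW.
have iM : (i < m.+2)%N := leqW im.
have iM1 : (i.+1 < m.+2)%N := im.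
have bB1 : (b < B.+1)%N := leqW bB.
have bB2 : (b.+1 < B.+1)%N := bB.
have := HG (Ordinal iM) (Ordinal bB1); have := HG (Ordinal iM1) (Ordinal bB2).
rewrite !ler_distl => /andP[_ hi] /andP[lo _].
have up := block_count_le y j i2 bs2.
have dn := block_count_le y j i1 bs1.
rewrite /= in hi lo.
have bS : grid_s b.+1 m = grid_s b m + m.+1%:R^-1 by rewrite /grid_s -(natr1 b) mulrDl div1r.
have iS : grid_th i.+1 m = grid_th i m + 15%:R * m.+1%:R^-1.
  by rewrite /grid_th -(natr1 i); move: m.+1%:R^-1 => u; ring.
have g0 : 0 <= grid_s b m by rewrite /grid_s divr_ge0// ltW.
have g1 : 1 <= grid_th i m by rewrite /grid_th lerDl divr_ge0 ?mulr_ge0// ltW.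
rewrite bS iS in up hi bs2 i2; move: mP up dn hi lo bs1 bs2 i1 i2 g0 g1.
have v0 : 0 < m.+1%:R^-1 :> R by rewrite invr_gt0.
have v1 : m.+1%:R^-1 <= 1 :> R by rewrite invf_le1// ler1n.
move: v0 v1.
move: (grid_s b m) (grid_th i m) m.+1%:R^-1 (block_count _ _ _ _) (block_count _ _ _ _)
  (block_count _ _ _ _) => u t v f f1 f2 v0 v1 mP up dn hi lo bs1 bs2 i1 i2 g0 g1.
clear - th1 th16 s0 sS S0 v0 v1 mP up dn hi lo bs1 bs2 i1 i2 g0 g1.
have w1 := area_perturb_up (introT andP (conj th1 th16)) (introT andP (conj s0 sS)) (ltW v0) v1 bs2 bs1 i1 i2 g1.
have w2 := area_perturb_down (introT andP (conj th1 th16)) (introT andP (conj s0 sS)) (ltW v0) bs2 g0 bs1 i1 i2 g1.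
move: w1 w2; clear - mP up dn hi lo => *; lra.
Unshelve. all: by end_near.
Qed.
End PairCorrelation.

Section PairCorrelationOfBlocks.
Context {R : realType}.
Notation N j := ((2 ^ j) ^ 4)%N.

Lemma near_intN (r x : R) : near_int r (- x) = near_int r x.
Proof. by rewrite /near_int dist_intN. Qed.

Lemma sum_offdiag_sym (M : nat) (G : nat -> nat -> R) : (forall i j, G i j = G j i) ->
  \sum_(i < M) \sum_(j < M | i != j) G i j = 2 * \sum_(0 <= i < M) \sum_(0 <= j < i) G i j.
Proof.
move=> Gsym; elim: M => [|M IH]; first by rewrite big_ord0 big_geq// mulr0.
rewrite big_ord_recr big_nat_recr// mulrDr -IH /=.
have -> : \sum_(j < M.+1 | ord_max != j) G M j = \sum_(0 <= j < M) G M j.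
  rewrite big_mkcond big_ord_recr /= eqxx addr0 big_mkord; apply: eq_bigr => i _.
  by rewrite -val_eqE /= gtn_eqF.
have -> : \sum_(i < M) \sum_(j < M.+1 | widen_ord (leqnSn M) i != j) G i j =
    \sum_(i < M) (\sum_(j < M | i != j) G i j + G M i).
  apply: eq_bigr => i _; rewrite big_mkcond big_ord_recr [in RHS]big_mkcond /=.
  by rewrite -val_eqE /= ltn_eqF// Gsym; congr (_ + _); apply: eq_bigr.
rewrite big_split /= !big_mkord; ring.
Qed.

Lemma pc_countE (y : nat -> R) (M : nat) (s : R) :
  (pc_count y M s)%:R =
  2 * \sum_(1 <= m < M.+1) \sum_(1 <= m' < m) near_int (s / M%:R) (y m - y m').
Proof.
rewrite big_add1 /=.
under eq_bigr do rewrite big_add1 /=.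
rewrite -(@sum_offdiag_sym M (fun i j => near_int (s / M%:R) (y i.+1 - y j.+1))); last first.
  by move=> i j; rewrite -near_intN opprB.
rewrite /pc_count cardE -[size _]count_predT -sum1_count natr_sum big_enum.
under [RHS]eq_bigr do rewrite big_mkcond.
rewrite (pair_bigA _ (fun i j : 'I_M => if i != j then near_int (s / M%:R) (y i.+1 - y j.+1) else 0)) /=.
rewrite big_mkcond; apply: eq_bigr => -[i j] _ /=.
have -> : ((i, j) \in in_set
    [set t : 'I_M * 'I_M | (t.1 != t.2) && (dist_int (y t.1.+1 - y t.2.+1) < s / M%:R)]) =
    (i != j) && (dist_int (y i.+1 - y j.+1) < s / M%:R).
  by apply/idP/idP => [/set_mem|h]; [|exact/mem_set].
by case: (i != j) => //=; rewrite /near_int; case: ifP.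
Qed.


Lemma block_start_le j : (N j <= N j.+1)%N.
Proof. by rewrite block_startS leq_pmull. Qed.

(** The window [s / M] of the whole sequence is the window of parameter [s N_j / M] at the scale of
    the block [j]. This parameter varies with [M], hence the need for uniformity in [s]. *)
Lemma block_countM (y : nat -> R) (M j E : nat) (s : R) : (0 < M)%N ->
  (N j <= E)%N -> (E <= N j.+1)%N ->
  \sum_(N j <= m < E) \sum_(1 <= m' < m) near_int (s / M%:R) (y m - y m') =
  (N j)%:R * block_count y j (E%:R / (N j)%:R) (s * (N j)%:R / M%:R).
Proof.
move=> M0 jE; rewrite block_startS => E16.
have Nj : (N j)%:R != 0 :> R by rewrite pnatr_eq0 -lt0n block_start_gt0.
have M0' : M%:R != 0 :> R by rewrite pnatr_eq0 -lt0n.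
rewrite /block_count [RHS]mulrC !(divfK Nj).
have -> : s * (N j)%:R / M%:R / (N j)%:R = s / M%:R by rewrite mulrAC mulfK.
rewrite (big_nat_widen _ _ _ _ _ E16) /=.
by apply: eq_bigl => m; rewrite ltr_nat.
Qed.

Lemma pc_sum_blocks (y : nat -> R) (M k : nat) (s : R) : (N k <= M)%N -> (M < N k.+1)%N ->
  \sum_(1 <= m < M.+1) \sum_(1 <= m' < m) near_int (s / M%:R) (y m - y m') =
  \sum_(0 <= j < k.+1) (N j)%:R *
    block_count y j ((if (j < k)%N then N j.+1 else M.+1)%:R / (N j)%:R) (s * (N j)%:R / M%:R).
Proof.
move=> kM Mk; have M0 : (0 < M)%N := leq_trans (block_start_gt0 k) kM.
pose G m := \sum_(1 <= m' < m) near_int (s / M%:R) (y m - y m').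
have Gk i : (i <= k)%N -> \sum_(1 <= m < N i) G m =
    \sum_(0 <= j < i) (N j)%:R * block_count y j
      ((if (j < k)%N then N j.+1 else M.+1)%:R / (N j)%:R) (s * (N j)%:R / M%:R).
  elim: i => [|i IH] ik; first by rewrite !big_geq.
  rewrite (big_cat_nat (block_start_gt0 i) (block_start_le i)) big_nat_recr//=.
  by rewrite IH ?(ltnW ik)// ik block_countM// block_start_le.
rewrite (big_cat_nat (block_start_gt0 k) (leqW kM)) /= -/G (Gk k (leqnn k)) [RHS]big_nat_recr//= ltnn.
by rewrite block_countM// leqW.
Qed.

Lemma sum_block_start_sq k : 255%:R * \sum_(0 <= j < k) (N j)%:R ^+ 2 = (N k)%:R ^+ 2 - 1 :> R.
Proof.
elim: k => [|k IH]; first by rewrite big_geq// mulr0 expr1n subrr.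
rewrite big_nat_recr//= mulrDr IH block_startS natrM; ring.
Qed.

Lemma sum_block_start_le k : \sum_(0 <= j < k.+1) (N j)%:R <= 2 * (N k)%:R :> R.
Proof.
elim: k => [|k IH]; first by rewrite big_nat1 ler_peMl// ler1n.
rewrite big_nat_recr//= (block_startS k) natrM.
have : 0 <= (N k)%:R :> R by [].
by move: IH; move: (\sum_(0 <= j < k.+1) _) ((N k)%:R : R) => *; lra.
Qed.

Lemma sum_truncate_le (c : nat -> R) (J k : nat) : (forall j, 0 <= c j) ->
  \sum_(0 <= j < k | (j < J)%N) c j <= \sum_(0 <= j < J) c j.
Proof.
move=> c0; rewrite (big_nat_widen _ _ (k + J)) ?leq_addr// [leRHS](big_nat_widen _ _ (k + J)) ?leq_addl//.
rewrite big_mkcond [leRHS]big_mkcond; apply: ler_sum => j _ /=.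
by case: (j < J)%N => //=; case: ifP.
Qed.

Lemma pair_correlation_of_blocks (y : nat -> R) :
  (forall i b m, (i <= m.+1)%N -> (0 < b)%N ->
     block_count y j (grid_th i m) (grid_s b m) @[j --> \oo]
       --> grid_s b m * (@grid_th R i m ^+ 2 - 1)) ->
  poissonian_pc y.
Proof.
move=> H s s0; apply/cvgrPdist_le => e e0.
(* The blocks contribute [2 d M] as their starts sum to at most [2 N_k]; doubling for ordered pairs
   gives [e / 2]. The other half absorbs [4 s] and the early blocks [j < J], bounded trivially
   through [c]. *)
have d0 : 0 < e / 8%:R by rewrite divr_gt0.
set d := e / 8%:R in d0 *.
have [J _ JP] := block_count_uniform s0 d0 H.
pose c j := (N j)%:R * ((256 * N j)%:R + s * 255%:R) : R.
have c0 j : 0 <= c j.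
  apply: mulr_ge0; first exact: ler0n.
  by apply: addr_ge0; [exact: ler0n|apply: mulr_ge0; [exact: ltW|exact: ler0n]].
pose K := \sum_(0 <= j < J) c j.
have K0 : 0 <= K by rewrite /K sumr_ge0.
near=> M.
have M0 : (0 < M)%N by near: M; exists 1%N.
have MK : (4%:R * s + 2 * K) / (e / 2) <= M%:R by near: M; exact: nbhs_infty_ger.
have M0' : 0 < M%:R :> R by rewrite ltr0n.
pose k := trunc_log 16 M.
have kM : (N k <= M)%N by rewrite -expnM mulnC expnM trunc_logP.
have Mk : (M < N k.+1)%N by rewrite -expnM mulnC expnM; exact: trunc_log_ltn.
pose th j : R := (if (j < k)%N then N j.+1 else M.+1)%:R / (N j)%:R.
pose sg j : R := s * (N j)%:R / M%:R.
have N0 j : 0 < (N j)%:R :> R by rewrite ltr0n block_start_gt0.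
have thP j : (j <= k)%N -> 1 <= th j <= 16%:R.
  move=> jk; rewrite /th; case: ltnP => h.
    by rewrite block_startS natrM mulfK ?gt_eqF// lexx ler1n.
  have {jk h} -> : j = k by lia.
  rewrite ler_pdivlMr// mul1r ler_pdivrMr// -natrM !ler_nat.
  by rewrite leqW//= -block_startS.
have sgP j : (j <= k)%N -> 0 <= sg j <= s.
  move=> jk; rewrite /sg divr_ge0 ?mulr_ge0 ?(ltW s0)//= ler_pdivrMr// ler_pM2l// ler_nat.
  apply: leq_trans kM; rewrite leq_exp2r// leq_exp2l//.
(* The full blocks telescope to [N_k^2 - 1] and the last one adds [(M + 1)^2 - N_k^2]; the total
   [M^2 + 2 M] is multiplied by [s / M]. *)
have target : \sum_(0 <= j < k.+1) (N j)%:R * (sg j * (th j ^+ 2 - 1)) = s * (M%:R + 2).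
  rewrite big_nat_recr//= (_ : \sum_(0 <= j < k) _ = s / M%:R * (255%:R * \sum_(0 <= j < k) (N j)%:R ^+ 2)).
    rewrite sum_block_start_sq /th ltnn /sg -(natr1 M).
    have := N0 k; move: ((N k)%:R : R) (M%:R : R) M0' => u v v0 u0.
    by field; rewrite !gt_eqF.
  rewrite mulr_sumr mulr_sumr; apply: eq_big_nat => j /andP[_ jk].
  rewrite /th jk /sg block_startS natrM mulfK ?gt_eqF//; ring.
have err j : (j <= k)%N -> `|(N j)%:R * block_count y j (th j) (sg j) - (N j)%:R * (sg j * (th j ^+ 2 - 1))|
    <= d * (N j)%:R + (if (j < J)%N then c j else 0).
  move=> jk; rewrite -mulrBr normrM (ger0_norm (ltW (N0 j))).
  case: ltnP => [jJ|Jj].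
    apply: (@le_trans _ _ (c j)); last by rewrite lerDr mulr_ge0 ?(ltW (N0 j))// ltW.
    rewrite /c ler_pM2l//; apply: le_trans (ler_normB _ _) _.
    have /andP[t1 t2] := thP j jk; have /andP[g1 g2] := sgP j jk.
    have t3 : 0 <= th j ^+ 2 - 1 by rewrite subr_ge0 expr_ge1// (le_trans ler01).
    rewrite !ger0_norm ?block_count_ge0 ?mulr_ge0 ?(ltW s0)//; apply: lerD; first exact: block_count_bound.
    by apply: ler_pM => //; clear - t1 t2; nra.
  by rewrite addr0 mulrC ler_wpM2r ?(ltW (N0 j))//; apply: JP => //; [exact: thP|exact: sgP].
have tot : `|\sum_(1 <= m < M.+1) \sum_(1 <= m' < m) near_int (s / M%:R) (y m - y m') - s * (M%:R + 2)|
    <= 2 * d * M%:R + K.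
  rewrite (pc_sum_blocks _ _ kM Mk) -target -sumrB.
  apply: le_trans (ler_norm_sum _ _ _) _.
  apply: (@le_trans _ _ (\sum_(0 <= j < k.+1) (d * (N j)%:R + (if (j < J)%N then c j else 0)))).
    by apply: ler_sum_nat => j /andP[_ jk]; exact: err.
  rewrite big_split /= -mulr_sumr -big_mkcond; apply: lerD; last exact: sum_truncate_le.
  rewrite -mulrA mulrCA ler_pM2l//; apply: le_trans (sum_block_start_le k) _.
  by rewrite ler_pM2l// ler_nat.
rewrite pc_countE.
move: tot; set T := \sum_(1 <= m < M.+1) _ => tot.
have -> : 2 * s - 2 * T / M%:R = (- 2 * (T - s * (M%:R + 2)) - 4%:R * s) / M%:R.
  by field; rewrite gt_eqF.
rewrite normrM [`|M%:R^-1|]ger0_norm ?invr_ge0// ler_pdivrMr//.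
move: MK; rewrite ler_pdivrMr; last by rewrite divr_gt0.
move: tot; rewrite ler_norml => /andP[h1 h2] h3.
rewrite /d in h1 h2; rewrite ler_norml; clear - h1 h2 h3 s0.
move: (T - _) h1 h2 => z h1 h2; apply/andP; split; lra.
Unshelve. all: by end_near.
Qed.

End PairCorrelationOfBlocks.

(** * Additive energy *)

Section Energy.
Context {R : realType}.

Section FromDigits.
Local Open Scope nat_scope.
Variable n : nat.

Definition from_digits (a b c d : nat) : nat := a + n * (b + n * (c + n * d)).

Lemma div_digit_cons (a u : nat) : a < n -> (a + n * u) %/ n = u.
Proof.
move=> an; have n0 : 0 < n by exact: leq_ltn_trans an.
by rewrite addnC mulnC divnMDl// divn_small// addn0.
Qed.

Lemma digit_cons_inj (a a' u u' : nat) : a < n -> a' < n -> a + n * u = a' + n * u' ->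
  a = a' /\ u = u'.
Proof.
move=> an an' E; have uu : u = u' by rewrite -(div_digit_cons u an) E div_digit_cons.
by split => //; move: E; rewrite uu => /addIn.
Qed.

Lemma digit_cons_add (a b c d u v w z : nat) : a + b = c + d -> u + v = w + z ->
  a + n * u + (b + n * v) = c + n * w + (d + n * z).
Proof. by move=> E F; rewrite addnACA -mulnDr E F mulnDr addnACA. Qed.

Lemma quots_from_digits (a b c d : nat) : a < n -> b < n -> c < n ->
  quots n (from_digits a b c d) =
  [:: (from_digits a b c d)%:Z; (b + n * (c + n * d))%:Z; (c + n * d)%:Z; d%:Z].
Proof.
move=> an bn cn; rewrite /quots /from_digits (expnS n 2) (expnS n 1) expn1 !divnMA.
by rewrite !div_digit_cons.
Qed.

Lemma from_digits_bound (a b c d : nat) : a < n -> b < n -> c < n -> n <= d -> d < 16 * n ->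
  n ^ 4 <= from_digits a b c d < 16 * n ^ 4.
Proof.
move=> an bn cn nd dn; rewrite /from_digits; apply/andP; split.
  rewrite 3!expnS expn1; apply: leq_trans (leq_addl _ _); rewrite leq_mul2l; apply/orP; right.
  apply: leq_trans (leq_addl _ _); rewrite leq_mul2l; apply/orP; right.
  by apply: leq_trans (leq_addl _ _); rewrite leq_mul2l nd orbT.
have step x y B : x < n -> y < B -> x + n * y < n * B.
  by move=> xn yB; apply: (@leq_trans (n * y.+1)); [rewrite mulnS ltn_add2r|rewrite leq_mul2l yB orbT].
rewrite (_ : 16 * n ^ 4 = n * (n * (n * (16 * n)))); last by rewrite !expnS expn0; lia.
by do 3 apply: (step _ _ _) => //.
Qed.

End FromDigits.

(** The linear parts cancel; what remains is [eps] times two sums of two squared norms, each norm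
    between 0 and [4 (16 n)^2]. *)
Lemma four_block_elems (n : nat) (eps : R) (P : seq R) (m1 m2 m3 m4 : nat) :
  (0 < n)%N -> 0 <= eps -> size P = 5 ->
  [/\ (m1 < 16 * n ^ 4)%N, (m2 < 16 * n ^ 4)%N, (m3 < 16 * n ^ 4)%N & (m4 < 16 * n ^ 4)%N] ->
  (forall i, nth 0 (quots n m1) i + nth 0 (quots n m2) i =
             nth 0 (quots n m3) i + nth 0 (quots n m4) i) ->
  `|block_elem n eps P m1 + block_elem n eps P m2
    - block_elem n eps P m3 - block_elem n eps P m4| <= eps * (8%:R * (16 * n)%:R ^+ 2).
Proof.
move=> n0 eps0 sP [h1 h2 h3 h4] H.
have dE : dot (1 :: quots n m1) P + dot (1 :: quots n m2) P
    = dot (1 :: quots n m3) P + dot (1 :: quots n m4) P :> R.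
  have HR i : (nth 0 (quots n m1) i)%:~R + (nth 0 (quots n m2) i)%:~R
     = (nth 0 (quots n m3) i)%:~R + (nth 0 (quots n m4) i)%:~R :> R.
    by rewrite -!intrD H.
  case: P sP => [|P0 [|P1 [|P2 [|P3 [|P4 [|? ?]]]]]] //= _.
  have := HR 0; have := HR 1; have := HR 2; have := HR 3 => /=.
  do 4 move/(canRL (addrK _)) => ->.
  ring.
rewrite /block_elem.
have -> : dot (1 :: quots n m1) P + eps * (sqnorm n m1)%:R + (dot (1 :: quots n m2) P + eps * (sqnorm n m2)%:R)
    - (dot (1 :: quots n m3) P + eps * (sqnorm n m3)%:R) - (dot (1 :: quots n m4) P + eps * (sqnorm n m4)%:R)
  = eps * ((sqnorm n m1)%:R + (sqnorm n m2)%:R - (sqnorm n m3)%:R - (sqnorm n m4)%:R).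
  by move: dE; do 4 move: (dot _ _) => ?; move=> dE; lra.
rewrite normrM ger0_norm//; apply: ler_wpM2l => //.
have := @sqnorm_le R n n0 m1 h1; have := @sqnorm_le R n n0 m2 h2.
have := @sqnorm_le R n n0 m3 h3; have := @sqnorm_le R n n0 m4 h4.
have q i : 0 <= (sqnorm n i)%:R :> R by [].
have := q m1; have := q m2; have := q m3; have := q m4.
move: ((16 * n)%:R ^+ 2) => u; do 4 move: ((sqnorm n _)%:R) => ?.
by clear=> *; rewrite ler_norml; apply/andP; split; lra.
Qed.

(** Three digit vectors with [h^4] choices each determine the fourth index. With [n = 4 h] the
    fourth digits stay below [3 h], so nothing carries; the extra [n] in the top digit puts all
    indices into the block. *)
Lemma add_energy_ge (x : nat -> R) (h M : nat) (eps g : R) (P : seq R) :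
  (0 < h)%N -> 0 <= eps -> size P = 5 ->
  (forall m, ((4 * h) ^ 4 <= m < 16 * (4 * h) ^ 4)%N -> x m = block_elem (4 * h) eps P m) ->
  (16 * (4 * h) ^ 4 <= M)%N -> eps * (8%:R * (16 * (4 * h))%:R ^+ 2) < g ->
  (h ^ 12 <= add_energy x M g)%N.
Proof.
move=> h0 eps0 sP xE hM hg; case: M hM => [|M] hM.
  by move: hM; rewrite leqNgt muln_gt0 expn_gt0 muln_gt0 h0.
have [n nE] : exists n, n = (4 * h)%N by exists (4 * h)%N.
rewrite -nE in xE hM hg.
pose A := ('I_h * 'I_h * 'I_h * 'I_h)%type.
(* Digits in [[h, 2 h[] leave room for [d1 + d2 - d3] without carry. *)
pose f (a : A) := from_digits n (h + a.1.1.1) (h + a.1.1.2) (h + a.1.2) (n + h + a.2).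
pose e (a b c : 'I_h) := (h + a + b - c)%N.
pose f4 (a b c : A) := from_digits n (e a.1.1.1 b.1.1.1 c.1.1.1) (e a.1.1.2 b.1.1.2 c.1.1.2)
  (e a.1.2 b.1.2 c.1.2) (n + e a.2 b.2 c.2).
have lt_n (a : 'I_h) : (h + a < n)%N by rewrite nE; have := ltn_ord a; lia.
have e_n (a b c : 'I_h) : (e a b c < n)%N.
  by rewrite nE /e; have := ltn_ord a; have := ltn_ord b; lia.
have eE (a b c : 'I_h) : (h + a + (h + b) = h + c + e a b c)%N.
  by rewrite /e; have := ltn_ord c; lia.
have fB a : (n ^ 4 <= f a < 16 * n ^ 4)%N.
  by apply: from_digits_bound => //; have := lt_n a.2; lia.
have f4B a b c : (n ^ 4 <= f4 a b c < 16 * n ^ 4)%N.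
  by apply: from_digits_bound => //; have := e_n a.2 b.2 c.2; lia.
have n0 : (0 < n)%N by rewrite nE muln_gt0 h0.
have N0 : (0 < n ^ 4)%N by rewrite expn_gt0 n0.
pose pos (m : nat) : 'I_M.+1 := inord m.-1.
have posE m : (n ^ 4 <= m < 16 * n ^ 4)%N -> (pos m).+1 = m.
  move=> /andP[m1 m2]; have m0 := leq_trans N0 m1.
  by rewrite /pos inordK prednK// (leq_trans (ltnW m2)).
pose G (q : A * A * A) := (pos (f q.1.1), pos (f q.1.2), pos (f q.2), pos (f4 q.1.1 q.1.2 q.2)).
have fI : injective f.
  move=> [[[a1 a2] a3] a4] [[[b1 b2] b3] b4] /= E.
  have [/addnI/val_inj/= -> {}E] := digit_cons_inj (lt_n _) (lt_n _) E.
  have [/addnI/val_inj/= -> {}E] := digit_cons_inj (lt_n _) (lt_n _) E.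
  have [/addnI/val_inj/= -> /addnI/val_inj/= ->] := digit_cons_inj (lt_n _) (lt_n _) E.
  by [].
have posI a b : pos (f a) = pos (f b) -> a = b.
  by move=> /(congr1 (fun i : 'I_M.+1 => i.+1)); rewrite !posE// => /fI.
have GI : injective G.
  move=> [[a b] c] [[a' b'] c'] E.
  have -> : a = a' by exact: posI (congr1 (fun t => t.1.1.1) E).
  have -> : b = b' by exact: posI (congr1 (fun t => t.1.1.2) E).
  by have -> : c = c' by exact: posI (congr1 (fun t => t.1.2) E).
have -> : (h ^ 12 = #|{: A * A * A}|)%N.
  by rewrite !card_prod !card_ord (expnM h 4 3) !expnS !expn0 !muln1 !mulnA.
rewrite -(fintype.card_image GI) /add_energy; apply: subset_leq_card.
apply/fintype.subsetP => _ /codomP[[[a b] c] ->]; apply/mem_set => /=.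
rewrite !posE//; rewrite !xE//.
apply: le_lt_trans hg; apply: four_block_elems => //.
  by split; [have /andP[] := fB a|have /andP[] := fB b|have /andP[] := fB c|have /andP[] := f4B a b c].
have tE : (n + h + a.2 + (n + h + b.2) = n + h + c.2 + (n + e a.2 b.2 c.2))%N.
  by have := eE a.2 b.2 c.2; lia.
rewrite /f /f4 !quots_from_digits// => -[|[|[|[|i]]]]; rewrite /= -?PoszD ?nth_nil//; congr Posz;
  by do ?apply: digit_cons_add.
Qed.

Notation N j := ((2 ^ j) ^ 4)%N.

(** [ln M >= 4 (k + 1) ln 2 >= 2 (k + 1) >= k + 3] since [ln 2 >= 1/2] and [k >= 1], while [M] is at
    most [16^2 N_k]. *)
Lemma slow_log_le_gammaN (c : R) (k M : nat) : 0 < c -> (0 < k)%N ->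
  (N k.+1 <= M)%N -> (M < N k.+2)%N ->
  slow_log c k / (16%:R ^+ 2 * (N k)%:R) <= gammaN c M.
Proof.
move=> c0 k0 h1 h2.
have M0 : 0 < M%:R :> R by rewrite ltr0n (leq_trans _ h1)// block_start_gt0.
have ln2 : 1 <= 2 * ln 2 :> R.
  have := @le_ln1Dx R (- (1 / 2)); rewrite (_ : 1 + - (1 / 2) = 2^-1); last by lra.
  by rewrite lnV ?posrE// => /(_ ltac:(lra)); lra.
have lnM : (k + 3)%:R <= ln M%:R :> R.
  apply: (@le_trans _ _ (ln (N k.+1)%:R)); last first.
    by rewrite ler_ln ?posrE ?ler_nat// ltr0n block_start_gt0.
  rewrite -expnM natrX lnXn// -[ln _ *+ _]mulr_natr.
  rewrite !natrD !natrM; have : 1 <= k%:R :> R by rewrite ler1n.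
  by rewrite -(natr1 k); move: ln2; move: (ln 2) (k%:R : R) => l u *; nra.
have k3 : 0 < (k + 3)%:R :> R by rewrite ltr0n addn3.
have lk3 : 0 <= ln (k + 3)%:R :> R by rewrite ln_ge0// ler1n addn3.
have lnlnM : ln (k + 3)%:R <= ln (ln M%:R) :> R.
  by rewrite ler_ln ?posrE// (lt_le_trans k3).
have MU : M%:R <= 16%:R ^+ 2 * (N k)%:R :> R.
  apply: (@le_trans _ _ (N k.+2)%:R); first by rewrite ler_nat ltnW.
  by rewrite !block_startS !natrM mulrA expr2.
rewrite /gammaN /slow_log; apply: ler_pM.
- by rewrite mulr_ge0 ?powR_ge0// ltW.
- by rewrite invr_ge0 mulr_ge0// exprn_ge0.
- apply: ler_pM => //; first exact: powR_ge0.
  by apply: ge0_ler_powR; rewrite ?nnegrE//; [lra|exact: le_trans lnlnM].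
- rewrite lef_pV2 ?posrE// (lt_le_trans M0)//.
Qed.

(** For [N_(j+3) <= M < N_(j+4)] the block [j + 2] is complete below [M] and has [n = 4 h] with
    [h = 2^j]. Then [M <= (16 h)^4], whence the constant [16^-12]. *)
Lemma energy_lower_bound (x : nat -> R) (P : nat -> seq R) (c kappa : R) : 0 < c -> 0 < kappa ->
  kappa * (8%:R * 16%:R ^+ 4) < 1 ->
  (forall j m, (N j <= m)%N -> (m < N j.+1)%N ->
     x m = block_elem (2 ^ j) (kappa * growth c j / (2 ^ j)%:R ^+ 6) (P j) m) ->
  (forall j, size (P j) = 5) ->
  exists C : R, 0 < C /\ exists N0 : nat, forall M : nat, (N0 <= M)%N ->
    C * M%:R ^+ 3 <= (add_energy x M (gammaN c M))%:R.
Proof.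
move=> c0 ka0 ka1 xE sP; exists ((16%:R ^+ 12)^-1); split; first by rewrite invr_gt0 exprn_gt0.
exists (N 3) => M hM.
have M0 : (0 < M)%N by apply: leq_trans hM; rewrite block_start_gt0.
have [j [jM Mj]] : exists j, (N j.+3 <= M)%N /\ (M < N j.+4)%N.
  have E k : (N k = 16 ^ k)%N by rewrite -expnM mulnC expnM.
  have h3 : (3 <= trunc_log 16 M)%N by apply: trunc_log_max => //; rewrite -E.
  have [i iE] : exists i, trunc_log 16 M = i.+3 by exists (trunc_log 16 M - 3)%N; move: h3; clear; lia.
  by exists i; rewrite !E -iE; split; [exact: trunc_logP|exact: trunc_log_ltn].
pose h := (2 ^ j)%N; have h0 : (0 < h)%N by rewrite expn_gt0.
have nE : (2 ^ j.+2 = 4 * h)%N by rewrite !expnS mulnA.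
have en : (h ^ 12 <= add_energy x M (gammaN c M))%N.
  apply: (@add_energy_ge x h M (kappa * growth c j.+2 / (4 * h)%:R ^+ 6) _ (P j.+2)) => //.
  - by rewrite divr_ge0 ?mulr_ge0 ?exprn_ge0// ltW// growth_gt0.
  - by move=> m /andP[m1 m2]; rewrite -nE in m1 m2 *; apply: xE => //; rewrite block_startS.
  - by rewrite -nE -block_startS.
  apply: lt_le_trans (@slow_log_le_gammaN c j.+2 M c0 isT jM Mj).
  rewrite -nE; have gs : growth c j.+2 <= slow_log c j.+2 by rewrite ge_min lexx.
  have g0 : 0 < slow_log c j.+2 :> R by exact: slow_log_gt0.
  have n0 : 0 < (2 ^ j.+2)%:R :> R by rewrite ltr0n expn_gt0.
  rewrite natrM (natrX _ (2 ^ j.+2) 4); move: gs g0 n0 ka1; move: (2 ^ j.+2)%:R => n.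
  have [q [-> q0]] : exists q : R, 16%:R = q /\ 0 < q by exists 16%:R.
  move: (growth _ _) (slow_log _ _) => g s gs s0 n0 ka1.
  have -> : kappa * g / n ^+ 6 * (8%:R * (q * n) ^+ 2) = kappa * (8%:R * q ^+ 4) * g / (q ^+ 2 * n ^+ 4).
    by field; rewrite !gt_eqF.
  rewrite ltr_pM2r ?invr_gt0 ?mulr_gt0 ?exprn_gt0//.
  apply: le_lt_trans (_ : kappa * (8%:R * q ^+ 4) * s < s).
    by rewrite ler_wpM2l// !mulr_ge0 ?exprn_ge0// ltW.
  by rewrite -[ltRHS]mul1r ltr_pM2r.
rewrite mulrC ler_pdivrMr ?exprn_gt0//.
apply: (@le_trans _ _ ((h ^ 12)%:R * 16%:R ^+ 12)); last by rewrite ler_pM2r ?exprn_gt0// ler_nat.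
have Mh : (M <= (h * 16) ^ 4)%N.
  by apply: leq_trans (ltnW Mj) _; rewrite /h -(expnD 2 _ 4) addn4.
have : (M ^ 3 <= (h * 16) ^ 12)%N by rewrite (expnM _ 4 3) leq_exp2r.
by rewrite expnMn -(ler_nat R) natrX natrM [(16 ^ 12)%:R]natrX.
Qed.

End Energy.

(** * From small variances to almost every [alpha] *)

Section Assembly.
Context {R : realType}.
Notation mu := (@lebesgue_measure R).
Notation N j := ((2 ^ j) ^ 4)%N.

Lemma measurable_pair_dev n x (th s : R) : measurable_fun [set: R] (pair_dev n x th s).
Proof.
apply: measurable_funB => //; apply: measurable_sum => p.
by apply: measurableT_comp; [exact: measurable_near_int|exact: measurable_funM].
Qed.

Lemma eq_pair_dev n x x' (th s al : R) :
  (forall m, (0 < m)%N -> (m < 16 * n ^ 4)%N -> x m = x' m) ->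
  pair_dev n x th s al = pair_dev n x' th s al.
Proof.
move=> xx; rewrite /pair_dev; congr (_ - _); rewrite !big_enum_cond.
apply: eq_bigr => -[[m hm] [m' hm']]; rewrite unfold_in /= andbT => /and4P[/= m0 mm _ _].
by rewrite !xx// (ltn_trans m0).
Qed.

Lemma block_count_pair_dev (x : nat -> R) (th s al : R) j :
  block_count (fun m => al * x m) j th s =
  (pair_dev (2 ^ j) x th s al + s / (N j)%:R * (2 * #|@block_pairs R (2 ^ j) th|%:R)) / (N j)%:R.
Proof.
congr (_ / _); rewrite /pair_dev -natrX [X in _ = _ - _ + X]mulrCA [X in _ = _ - _ + X]mulrA subrK.
rewrite (@sum_block_pairs _ _ _ (fun m m' => near_int (s / (N j)%:R) (al * (x m - x m')))) ?expn_gt0//.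
by apply: eq_bigr => m _; apply: eq_bigr => m' _; rewrite mulrBr.
Qed.

Lemma le_block_start j : (j <= N j)%N.
Proof.
apply: (@leq_trans (2 ^ j)); first exact/ltnW/ltn_expl.
by rewrite -{1}(expn1 (2 ^ j)) leq_pexp2l// expn_gt0.
Qed.

(** As [(2^j)^8 = N_j^2], the hypothesis says that the deviation divided by [N_j] tends to 0; the
    main term comes from [card_block_pairs]. *)
Lemma block_count_cvg (x : nat -> R) (th s al : R) : 1 <= th <= 16%:R -> 0 < s ->
  (fun j => (pair_dev (2 ^ j) x th s al) ^+ 2 / (2 ^ j)%:R ^+ 8) @ \oo --> (0 : R) ->
  block_count (fun m => al * x m) j th s @[j --> \oo] --> s * (th ^+ 2 - 1).
Proof.
move=> th16 s0 dev0; apply/cvgrPdist_le => e e0.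
have e2 : 0 < e / 2 by rewrite divr_gt0.
have e22 : 0 < (e / 2) ^+ 2 by rewrite exprn_gt0.
move/cvgrPdist_le/(_ _ e22): dev0 => dev0.
near=> j.
have d2 : `|0 - (pair_dev (2 ^ j) x th s al) ^+ 2 / (2 ^ j)%:R ^+ 8| <= (e / 2) ^+ 2 by near: j.
have jb : s * 60%:R / (e / 2) <= j%:R by near: j; exact: nbhs_infty_ger.
have N0 : 0 < (N j)%:R :> R by rewrite ltr0n block_start_gt0.
have d1 : `|pair_dev (2 ^ j) x th s al / (N j)%:R| <= e / 2.
  rewrite -(@ler_pXn2r _ 2)// ?nnegrE// ?(ltW e2)// real_normK ?num_real//.
  apply: le_trans d2; rewrite sub0r normrN; apply: le_trans (ler_norm _).
  by rewrite exprMn exprVn natrX -exprM.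
have := @card_block_pairs R (2 ^ j) th; rewrite expn_gt0 => /(_ isT th16) card.
rewrite block_count_pair_dev mulrDl; set D := pair_dev _ _ _ _ _ / _ in d1 *.
set q := 2 * _ in card *.
have -> : s * (th ^+ 2 - 1) - (D + s / (N j)%:R * q / (N j)%:R) =
   - D - s * (q / (N j)%:R ^+ 2 - (th ^+ 2 - 1)).
  by move: N0; move: ((N j)%:R : R) => u u0; field; rewrite gt_eqF.
apply: le_trans (ler_normB _ _) _; rewrite normrN [`|s * _|]normrM (gtr0_norm s0).
have : s * `|q / (N j)%:R ^+ 2 - (th ^+ 2 - 1)| <= e / 2.
  apply: (@le_trans _ _ (s * (60%:R / (N j)%:R))); first by rewrite ler_pM2l.
  rewrite mulrA ler_pdivrMr// (mulrC (e / 2)) -ler_pdivrMr//; apply: le_trans jb _.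
  by rewrite ler_nat le_block_start.
by move: d1; clear; move: `|D| (s * _) => *; lra.
Unshelve. all: by end_near.
Qed.

Lemma ae_neq0 : {ae mu, forall al : R, al != 0}.
Proof.
exists [set 0]; split; first exact: measurable_set1; first exact: lebesgue_measure_set1.
by move=> al /= /negP; rewrite negbK => /eqP.
Qed.

Lemma annulus_cover (al : R) : al != 0 -> exists a : nat, annulus a.+1%:R al.
Proof.
move=> al0; have a0 : 0 < `|al| by rewrite normr_gt0.
exists (Num.truncn (`|al| + `|al|^-1)) => /=.
have h : `|al| + `|al|^-1 <= (Num.truncn (`|al| + `|al|^-1)).+1%:R by exact/ltW/truncnS_gt.
have i0 : 0 < `|al|^-1 by rewrite invr_gt0.
apply/andP; split; last by apply: le_trans h; rewrite lerDl ltW.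
rewrite invf_ple ?posrE//; first by apply: le_trans h; rewrite lerDr ltW.
Qed.

(** The block [j] is asked to serve only the windows [q < j] with [n1 q <= 2^j]. A fixed [q] is then
    served by all but finitely many blocks, which is enough for [ae_cvg0]. *)
Lemma sequence_with_small_variance (c kappa : R) (A th s : nat -> R) : 0 < c -> 0 < kappa ->
  kappa * (4 * 16%:R ^+ 2) <= 1 -> (forall q, 0 < A q) -> (forall q, 0 < s q) ->
  exists (x : nat -> R) (P : nat -> seq R),
  [/\ forall j m, (N j <= m)%N -> (m < N j.+1)%N ->
        x m = block_elem (2 ^ j) (kappa * growth c j / (2 ^ j)%:R ^+ 6) (P j) m,
      forall j, size (P j) = 5,
      forall M, spaced M x &
      forall q, {ae mu, forall al, annulus (A q) al ->
        (fun j => (pair_dev (2 ^ j) x (th q) (s q) al) ^+ 2 / (2 ^ j)%:R ^+ 8) @ \oo --> (0 : R)}].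
Proof.
move=> c0 ka0 ka1 A0 s0.
pose b q := cid2 (block_variance_bound (A0 q) (s0 q) ka0).
pose C q := s2val (b q); pose n1 q := projT1 (cid (s2valP' (b q))).
have C0 q : 0 < C q := s2valP (b q).
pose B q j := 3 ^+ 5 * 2 * (2 ^+ q * C q) * ((growth c j)^-1 + (2 ^ j)%:R^-1).
have B0 q : 0 <= 3 ^+ 5 * 2 * (2 ^+ q * C q) by rewrite !mulr_ge0 ?exprn_ge0// ltW.
pose f (x : nat -> R) q j (al : R) := (pair_dev (2 ^ j) x (th q) (s q) al) ^+ 2 / (2 ^ j)%:R ^+ 8.
pose good j (xo : nat -> R) P := forall q, (q < j)%N -> (n1 q <= 2 ^ j)%N ->
  (\int[mu]_(al in annulus (A q))
     (f (extend (2 ^ j) (kappa * growth c j / (2 ^ j)%:R ^+ 6) xo P) q j al)%:E <= (B q j)%:E)%E.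
have select j xo tau : 0 < tau -> spaced (N j) xo ->
    exists P : seq R, [/\ size P = 5, {in P, forall y, tau <= y} & good j xo P].
  move=> tau0 sxo.
  have n0 : (0 < 2 ^ j)%N by rewrite expn_gt0.
  have [P [sP tP bP]] := @select_block R A th s C n1 kappa A0 C0
    (fun q => projT2 (cid (s2valP' (b q)))) j (2 ^ j) (growth c j) tau xo n0 (growth_gt0 c j)
    (growth_le c j) tau0 sxo.
  exists P; split => // q qj nq.
  have N8 : 0 < (2 ^ j)%:R ^+ 8 :> R by rewrite exprn_gt0// ltr0n.
  under eq_integral do rewrite /f mulrC EFinM.
  rewrite ge0_integralZl//; last 3 first.
  - exact: measurable_annulus.
  - apply/measurable_EFinP; apply: measurable_funX; apply: measurable_funTS.
    exact: measurable_pair_dev.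
  - by move=> al _; rewrite lee_fin sqr_ge0.
  apply: le_trans (lee_wpmul2l _ (bP q qj nq)) _; first by rewrite lee_fin invr_ge0 ltW.
  rewrite -EFinM lee_fin /B le_eqVlt; apply/orP; left; apply/eqP.
  by move: N8; move: (_ ^+ 8) (_ + _) => u t u0; field; rewrite gt_eqF.
have [x [P [xE sP spx ext]]] := @exists_sequence R (growth c) kappa good ka0 ka1
  (fun j => growth_gt0 c j) (fun j => growth_le c j) select.
exists x, P; split => // q.
have [S SP] := sum_growth_inv_le c0.
apply: (@ae_cvg0 R _ (f x q) (B q) (3 ^+ 5 * 2 * (2 ^+ q * C q) * S) (maxn q.+1 (n1 q))).
- exact: measurable_annulus.
- by move=> j; apply: measurable_funM => //; apply: measurable_funX; exact: measurable_pair_dev.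
- by move=> j al; rewrite divr_ge0 ?sqr_ge0.
- move=> j; rewrite geq_max => /andP[qj nj].
  have [xo gxo ex] := ext j.
  apply: le_trans (gxo q qj (leq_trans nj (ltnW (ltn_expl _ _)))) => //.
  rewrite le_eqVlt; apply/orP; left; apply/eqP; apply: eq_integral => al _.
  rewrite /f; congr ((_ ^+ 2 / _)%:E); apply: eq_pair_dev => m m0 mN.
  by rewrite ex// block_startS.
move=> K; rewrite -mulr_sumr ler_wpM2l//; apply: le_trans (SP (maxn q.+1 (n1 q) + K)%N).
rewrite big_split_ord /= -[leLHS]add0r; apply: lerD.
  apply: sumr_ge0 => i _; apply: addr_ge0; last by rewrite invr_ge0.
  by rewrite invr_ge0 ltW// growth_gt0.
by apply: ler_sum => i _; rewrite addnC.
Qed.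

Lemma grid_th_itv i m : (i <= m.+1)%N -> 1 <= @grid_th R i m <= 16%:R.
Proof.
move=> im; have m0 : 0 < m.+1%:R :> R by rewrite ltr0n.
rewrite /grid_th lerDl divr_ge0 ?mulr_ge0//=.
have : i%:R / m.+1%:R <= 1 :> R by rewrite ler_pdivrMr// mul1r ler_nat.
by rewrite -mulrA; move: (_ / _) => u *; lra.
Qed.

(** [D] enumerates annulus radius, two grid indices and grid fineness. Countably many null sets and
    the point 0 are discarded; every remaining [al] lies in some annulus. *)
Lemma ae_poissonian (x : nat -> R) (D : nat -> nat * nat * nat * nat) :
  (forall t, exists q, D q = t) ->
  (forall q, {ae mu, forall al, annulus (D q).1.1.1.+1%:R al ->
        (fun j => (pair_dev (2 ^ j) x (grid_th (D q).1.1.2 (D q).2) (grid_s (D q).1.2.+1 (D q).2) al) ^+ 2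
            / (2 ^ j)%:R ^+ 8) @ \oo --> (0 : R)}) ->
  {ae mu, forall al, poissonian_pc (fun m => al * x m)}.
Proof.
move=> Dsurj /ae_foralln H.
move: H ae_neq0; apply: filterS2 => al H al0.
apply: pair_correlation_of_blocks => i [//|b] m im _.
have [a aal] := annulus_cover al0.
have [q Dq] := Dsurj (a, i, b, m).
have := H q; rewrite Dq => /(_ aal) h.
apply: block_count_cvg => //; first exact: grid_th_itv.
by rewrite /grid_s divr_gt0.
Qed.

End Assembly.

Unset Implicit Arguments.
Set Strict Implicit.

Theorem theorem1 (R : realType) (c : R) (hc : 0 < c) :
  exists x : nat -> R,
    (forall n : nat, (1 <= n)%N -> x n < x n.+1) /\
    (forall n : nat, (1 <= n)%N -> 1 <= x n.+1 - x n) /\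
    (exists C : R, 0 < C /\ exists N0 : nat, forall N : nat, (N0 <= N)%N ->
        C * (N%:R) ^+ 3 <= (add_energy x N (gammaN c N))%:R) /\
    {ae (@lebesgue_measure R), forall alpha : R,
        poissonian_pc (fun n => alpha * x n)}.
Proof.
have [kappa [k0 k1 k2]] : exists kappa : R,
    [/\ 0 < kappa, kappa * (4 * 16%:R ^+ 2) <= 1 & kappa * (8%:R * 16%:R ^+ 4) < 1].
  (* One extra factor 16 makes the energy condition strict; the weaker first condition controls the
     gaps inside blocks. *)
  exists ((8%:R * 16%:R ^+ 5)^-1).
  have [q [-> q1]] : exists q : R, 16%:R = q /\ 1 < q by exists 16%:R; rewrite ltr1n.
  have q0 : 0 < q := lt_trans ltr01 q1.
  have Q0 : 0 < 8%:R * q ^+ 5 by rewrite mulr_gt0// exprn_gt0.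
  rewrite invr_gt0; split => //; rewrite mulrC.
    rewrite ler_pdivrMr// mul1r; apply: ler_pM; rewrite ?exprn_ge0 ?(ltW q0)//.
      by rewrite ler_nat.
    by rewrite ler_weXn2l// ltW.
  by rewrite ltr_pdivrMr// mul1r ltr_pM2l// ltr_eXn2l.
(* Codes of no quadruple are sent to a default one. The successors taken below keep all radii and
   window sizes positive. *)
pose D q : nat * nat * nat * nat := odflt (0, 0, 0, 0)%N (unpickle q).
have Dsurj t : exists q, D q = t by exists (pickle t); rewrite /D pickleK.
have A0 q : 0 < (D q).1.1.1.+1%:R :> R by rewrite ltr0n.
have s0 q : 0 < grid_s (D q).1.2.+1 (D q).2 :> R by rewrite /grid_s divr_gt0.
have [x [P [xE sP spx dev]]] := @sequence_with_small_variance R c kappa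
  (fun q => (D q).1.1.1.+1%:R) (fun q => grid_th (D q).1.1.2 (D q).2)
  (fun q => grid_s (D q).1.2.+1 (D q).2) hc k0 k1 A0 s0.
have step n : (1 <= n)%N -> x n + 1 <= x n.+1 by move=> n1; apply: (spx n.+2).
exists x; split; [|split; [|split]].
- by move=> n /step; apply: lt_le_trans; rewrite ltrDl.
- by move=> n /step; rewrite lerBrDl.
- exact: energy_lower_bound hc k0 k2 xE sP.
- exact: ae_poissonian Dsurj dev.
Qed.
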